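(* Let $\Lambda\subset\mathbb R^2$ be a unimodular lattice and $I=[a,b]\subset\mathbb R$ a finite interval with $a<b$. Then the measures $\rho_{\Lambda,I,\tau}$ (defined for $\tau>0$ with $\mathcal F_I(\Lambda,\tau)\neq\emptyset$) converge weak-$*$ on the Farey triangle $\mathscr T$ to $m$ as $\tau\to\infty$: $$\rho_{\Lambda,I,\tau}\rightharpoonup m .$$
   Context: A unimodular lattice has covolume $1$. A nonzero $v\in\Lambda$ is primitive if the only lattice point in $\{rv\mid r\in[0,1)\}$ is the origin; $\Lambda_{\mathrm{prim}}$ is the set of primitive points. For $\tau>0$, $S_\tau=(0,\tau]\times\mathbb R$, $\mathcal F(\Lambda,\tau)=\Lambda_{\mathrm{prim}}\cap S_\tau$, and for an interval $I$, $\mathcal F_I(\Lambda,\tau)=\{\begin{pmatrix}q \\ a\end{pmatrix}\in\mathcal F(\Lambda,\tau)\mid a/q\in I\}$, $N_{\Lambda,I}(\tau)=\#\mathcal F_I(\Lambda,\tau)$. Write $\mathcal F_I(\Lambda,\tau)=\left\{\begin{pmatrix}q_i \\ a_i\end{pmatrix}\right\}_{i=0}^{N_{\Lambda,I}(\tau)-1}$ in order of increasing slope $a_i/q_i$; if $i=N_{\Lambda,I}(\tau)$ is needed, $\begin{pmatrix}q_i \\ a_i\end{pmatrix}$ denotes the element of $\mathcal F(\Lambda,\tau)$ with the next larger slope after the last element of $\mathcal F_I(\Lambda,\tau)$. The Farey triangle is $\mathscr T=\{(x,y)\in\mathbb R^2\mid 0<x,y\le1,\ x+y>1\}$, $dm=2\,dx\,dy$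 on $\mathscr T$, and the BCZ map $T:\mathscr T\to\mathscr T$ is $T(x,y)=\left(y,\left\lfloor\frac{1+x}{y}\right\rfloor y-x\right)$. The measures are $$\rho_{\Lambda,I,\tau}=\frac1{N_{\Lambda,I}(\tau)}\sum_{i=0}^{N_{\Lambda,I}(\tau)-1}\delta_{T^i\left(\frac{q_0}{\tau},\frac{q_1}{\tau}\right)},$$ where $T^i\left(\frac{q_0}{\tau},\frac{q_1}{\tau}\right)=\left(\frac{q_i}{\tau},\frac{q_{i+1}}{\tau}\right)$. *)

(* Defs.v *)
From HB Require Import structures.
From mathcomp Require Import all_boot all_order all_algebra.
From mathcomp Require Import finmap.
From mathcomp Require Import all_classical all_reals all_analysis.
From mathcomp Require Import measurable_realfun.

Set Implicit Arguments.
Unset Strict Implicit.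
Unset Printing Implicit Defensive.

Import Order.TTheory GRing.Theory Num.Theory.
Import numFieldNormedType.Exports.

Local Open Scope classical_set_scope.
Local Open Scope ring_scope.

Definition det2 (R : realType) (u v : R * R) : R := u.1 * v.2 - u.2 * v.1.

Definition lattice_span (R : realType) (u v : R * R) : set (R * R) :=
  [set w | exists m n : int, w = u *~ m + v *~ n].

(* The covolume of the lattice spanned by a basis (u, v) is |det (u, v)|. *)
Definition unimodular_lattice (R : realType) (L : set (R * R)) : Prop :=
  exists u v : R * R, `|det2 u v| = 1 /\ L = lattice_span u v.

Definition primitive_points (R : realType) (L : set (R * R)) : set (R * R) :=
  [set v | [/\ L v, v != 0 &
    forall r : R, 0 <= r < 1 -> L (r * v.1, r * v.2) ->
      (r * v.1, r * v.2) = 0 :> R * R]].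

(* Points are written (q, a), with slope a / q. *)
Definition slope (R : realType) (v : R * R) : R := v.2 / v.1.

Definition farey (R : realType) (L : set (R * R)) (tau : R) : set (R * R) :=
  [set v | primitive_points L v /\ 0 < v.1 <= tau].

Definition farey_in (R : realType) (L : set (R * R)) (I : set R) (tau : R)
    : set (R * R) :=
  [set v | farey L tau v /\ I (slope v)].

(* [fset_set] lists the elements of a finite set ([farey_in L I tau] is finite
   for bounded I); points of [farey L tau] are determined by their slopes, so
   the order is strict. *)
Definition farey_seq (R : realType) (L : set (R * R)) (I : set R) (tau : R)
    : seq (R * R) :=
  sort (fun u v => slope u <= slope v) (enum_fset (fset_set (farey_in L I tau))).

Definition farey_num (R : realType) (L : set (R * R)) (I : set R) (tau : R)
    : nat := size (farey_seq L I tau).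

(* The element of [farey L tau] with the next larger slope after that of v. *)
Definition farey_next (R : realType) (L : set (R * R)) (tau : R) (v : R * R)
    : R * R :=
  xget 0 [set w | [/\ farey L tau w, slope v < slope w &
    forall u, farey L tau u -> slope v < slope u -> slope w <= slope u]].

(* The default value of [nth] provides the element of index [farey_num]. *)
Definition farey_pt (R : realType) (L : set (R * R)) (I : set R) (tau : R)
    (i : nat) : R * R :=
  let s := farey_seq L I tau in nth (farey_next L tau (last 0 s)) s i.

Definition farey_triangle (R : realType) : set (R * R) :=
  [set p | [/\ 0 < p.1 <= 1, 0 < p.2 <= 1 & 1 < p.1 + p.2]].

Lemma measurable_farey_triangle (R : realType) :
  measurable (@farey_triangle R : set (measurableTypeR R * measurableTypeR R)).
Proof.
have m1 : measurable_fun setT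
  (fst : measurableTypeR R * measurableTypeR R -> measurableTypeR R).
  exact: measurable_fst.
have m2 : measurable_fun setT
  (snd : measurableTypeR R * measurableTypeR R -> measurableTypeR R).
  exact: measurable_snd.
have mS := measurable_funD m1 m2.
have -> : @farey_triangle R =
    (fst @^-1` `]0, 1]) `&` (snd @^-1` `]0, 1]) `&`
    ((fun p => p.1 + p.2) @^-1` `]1, +oo[).
  apply/seteqP; split => p /=; rewrite !in_itv /= ?andbT.
    by case.
  by case=> -[].
apply: measurableI; first apply: measurableI.
- by rewrite -[X in measurable X]setTI; apply: m1.
- by rewrite -[X in measurable X]setTI; apply: m2.
- by rewrite -[X in measurable X]setTI; apply: mS.
Qed.

(* Total on R * R; only its restriction to [farey_triangle] is meaningful. *)
Definition BCZ (R : realType) (p : R * R) : R * R :=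
  (p.2, (Num.floor ((1 + p.1) / p.2))%:~R * p.2 - p.1).

Definition farey_measure (R : realType)
    : {measure set (measurableTypeR R * measurableTypeR R) -> \bar R} :=
  mscale (2%:R : R)%:nng
    (mrestr (lebesgue_measure \x lebesgue_measure)%E
       (@measurable_farey_triangle R)).

(* This is the zero measure when [farey_in L I tau] is empty. *)
Definition rho (R : realType) (L : set (R * R)) (I : set R) (tau : R)
    : {measure set (measurableTypeR R * measurableTypeR R) -> \bar R} :=
  let N := farey_num L I tau in
  let p := ((farey_pt L I tau 0).1 / tau, (farey_pt L I tau 1).1 / tau) in
  mscale ((N%:R : R)^-1)%:nng
    (msum (fun i => \d_(iter i (@BCZ R) p : measurableTypeR R * measurableTypeR R)) N).

(* Test functions are the bounded continuous functions on the subspace X. For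
   probability measures on a locally compact X with a probability measure as
   limit, this is the same as testing against C_0(X) or C_c(X). *)
Definition weak_star_cvg (R : realType) (X : set (R * R))
    (mu : R -> {measure set (measurableTypeR R * measurableTypeR R) -> \bar R})
    (F : set_system R)
    (nu : {measure set (measurableTypeR R * measurableTypeR R) -> \bar R})
    : Prop :=
  forall f : R * R -> R,
    {within X, continuous f} ->
    (exists M : R, forall x, X x -> `|f x| <= M) ->
    (fun t => \int[mu t]_(x in X) (f x)%:E)%E @ F
      --> (\int[nu]_(x in X) (f x)%:E)%E.

(* Main.v *)
(* Two primitive vectors v, v' are consecutive in the Farey set of height tau exactly
   when det (v, v') = 1 and tau - v.1 < v'.1 <= tau, so rho counts the v for which
   (v.1, v'.1) / tau lies in a given set.  For slopes in a short interval, take a basis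
   (u, w) of the lattice whose cone contains that interval.  With m = det (v, w),
   n = det (u, v) and k = det (v', w), the pairs (v, v') correspond to the solutions of
   n k = -1 mod m, with n in an interval of length proportional to m.  These solutions
   are equidistributed in boxes, by the bound for Kloosterman sums that follows from
   their fourth moment; so the vectors v whose pair falls in a given box are,
   asymptotically, at least as many as predicted by the mean of phi (m) / m over an
   interval of m.  This mean is asymptotically the same for all intervals of length
   comparable to tau, as one sees by counting the coprime pairs of a rectangle along
   rows and along columns.  An upper bound for the total number of Farey vectors
   involves the same mean, which cancels: asymptotically, rho gives each box at least
   the mass that the limit measure gives it.  As rho has mass at most 1 and the limit
   has mass 1, such lower bounds on the boxes of a fine grid give the convergence. *)

Require Import Defs.
From HB Require Import structures.
From mathcomp Require Import all_boot all_order all_algebra all_solvable all_field.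
From mathcomp Require Import finmap.
From mathcomp Require Import all_classical all_reals all_analysis.
From mathcomp Require Import measurable_realfun.
From mathcomp Require Import ring lra zify.

Set Implicit Arguments.
Unset Strict Implicit.
Unset Printing Implicit Defensive.

Import Order.TTheory GRing.Theory Num.Theory.
Import numFieldNormedType.Exports.

(** * Divisors, totients and greatest common divisors *)

(** The ranges of [n] and [k] have length proportional to [m], so any power saving in the
    Kloosterman sums is enough. The fourth moment gives $|S|^4 \le 2 m^3 d(m)^3 \gcd(h,m)$. As [m]
    runs over all integers, divisors and common factors cannot be avoided: hence the bound $d(m)^8
    \le C m$ and the separate treatment of frequencies with a large gcd. For given [m] the expected
    number of pairs (n, k) is $\phi(m)/m^2$ times $D m$ times $b \tau$, that is $\phi(m)/m$ times a
    quantity free of [m]. This is why only the mean of $\phi(m)/m$ enters and why the limit has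
    constant density. A lower bound 1/8 for that mean makes errors $e \tau^2$ small relative to the
    main term. Slopes are localized because $\det(v,w) = v_1 (w_2 - w_1 s)$ with [s] the slope of
    [v]: only where the second factor is nearly constant does a condition on $v_1$ become a
    condition on [m]. Smoothing the boxes costs the upper estimate, so everything is arranged around
    lower bounds; the total count is bounded above through coprime pairs alone. *)

Lemma size_divisors_mul a b : 0 < a -> 0 < b ->
  size (divisors (a * b)) <= size (divisors a) * size (divisors b).
Proof.
move=> a0 b0; rewrite -(size_allpairs muln).
apply: uniq_leq_size (divisors_uniq _) _ => d.
rewrite -dvdn_divisors ?muln_gt0 ?a0 // => dab.
have g0 : 0 < gcdn d a by rewrite gcdn_gt0 a0 orbT.
(* Each divisor [d] of [a * b] splits as a divisor of [a], its gcd with [a], times a cofactor, which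
   then divides [b]. *)
apply/allpairsP; exists (gcdn d a, d %/ gcdn d a) => /=.
rewrite -!dvdn_divisors // dvdn_gcdr; split => //; last first.
  by rewrite mulnC divnK // dvdn_gcdl.
rewrite -(@dvdn_pmul2l (gcdn d a)) // [_ * (d %/ _)]mulnC divnK ?dvdn_gcdl //.
by rewrite muln_gcdl dvdn_gcd dab dvdn_mulr.
Qed.

Lemma size_divisors_pfactor p e : prime p -> size (divisors (p ^ e)) <= e.+1.
Proof.
move=> pp; rewrite -[leqRHS](size_iota 0) -(size_map (expn p) (iota _ _)).
apply: uniq_leq_size (divisors_uniq _) _ => d.
rewrite -dvdn_divisors ?expn_gt0 ?prime_gt0 // => /(dvdn_pfactor _ _ pp)[i ie ->].
by apply: map_f; rewrite mem_iota.
Qed.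

Lemma succ_le_exp2 e : e.+1 <= 2 ^ e.
Proof. by exact: ltn_expl. Qed.

Lemma leq_expr m n e : m <= n -> m ^ e <= n ^ e.
Proof. by case: e => // e mn; rewrite leq_exp2r. Qed.

Lemma succ_exp8_le : exists2 K, 0 < K & forall e, e.+1 ^ 8 <= K * 2 ^ e.
Proof.
exists (8 ^ 8) => [|e]; first by rewrite expn_gt0.
(* Write e = 8 q + r: then e + 1 <= 8 (q + 1) <= 8 * 2 ^ q. *)
have h : e.+1 <= 8 * 2 ^ (e %/ 8).
  apply: leq_trans (leq_mul (leqnn 8) (succ_le_exp2 _)).
  by rewrite mulnC ltn_ceil.
apply: (@leq_trans ((8 * 2 ^ (e %/ 8)) ^ 8)); first by rewrite leq_exp2r.
by rewrite expnMn -expnM leq_pmul2l ?expn_gt0 // leq_exp2l // leq_divM.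
Qed.

(** Induction on a strict bound [n] for the primes dividing [m], splitting off the full power
    [n ^ e] at each prime. A prime below 256 costs a factor [K]; a larger one costs nothing, since
    $(e+1)^8 \le 256^e \le n^e$. Hence the constant [K ^ minn n 256], which stops growing. The
    exponent 8 only has to exceed 6, where [small_gcd_estimate] would lose its power saving. *)
Lemma divisors_bound :
  exists2 C, 0 < C & forall m, 0 < m -> size (divisors m) ^ 8 <= C * m.
Proof.
have [K K0 hK] := succ_exp8_le; pose c n := K ^ minn n 256.
have cS n : c n <= c n.+1.
  by rewrite leq_pexp2l // leq_min geq_minr andbT (leq_trans (geq_minl _ _)).
suff h n m : 0 < m -> (forall p, prime p -> p %| m -> p < n) ->
    size (divisors m) ^ 8 <= c n * m.
  exists (K ^ 256) => [|m m0]; first by rewrite expn_gt0 K0.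
  apply: leq_trans (h m.+1 m m0 _) _ => [p pp pm|].
    by rewrite ltnS dvdn_leq.
  by rewrite leq_mul2r leq_pexp2l ?geq_minr ?orbT.
elim: n m => [|n IH] m m0 hm.
  have -> : m = 1.
    apply/eqP; rewrite eqn_leq m0 andbT leqNgt; apply/negP => m1.
    by have := hm _ (pdiv_prime m1) (pdiv_dvd m).
  by rewrite /c min0n.
have [/andP[pn nm]|hn] := boolP (prime n && (n %| m)); last first.
  apply: leq_trans (IH m m0 _) _ => [p pp pm|]; last by rewrite leq_mul2r cS orbT.
  have := hm p pp pm; rewrite ltnS leq_eqVlt => /orP[/eqP pE|//].
  by rewrite -pE pp pm in hn.
have [k nk mE] := pfactor_coprime pn m0.
set e := logn n m in mE.
have k0 : 0 < k by move: m0; rewrite mE muln_gt0 => /andP[].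
have ne0 : 0 < n ^ e by rewrite expn_gt0 prime_gt0.
have hk : size (divisors k) ^ 8 <= c n * k.
  apply: IH => // p pp pk.
  have := hm p pp; rewrite mE dvdn_mulr // ltnS leq_eqVlt => /(_ isT)/orP[/eqP pE|//].
  by move: nk; rewrite prime_coprime // -pE pk.
rewrite mE; apply: leq_trans (_ : (size (divisors k) * e.+1) ^ 8 <= _).
  rewrite leq_exp2r //; apply: leq_trans (size_divisors_mul k0 ne0) _.
  by rewrite leq_mul2l size_divisors_pfactor ?orbT.
rewrite expnMn; apply: leq_trans (leq_mul hk (leqnn _)) _.
rewrite mulnA mulnAC [leqRHS]mulnAC leq_pmul2r //.
have n1 := prime_gt1 pn.
have [n256|n256] := ltnP n 256.
  have -> : c n.+1 = c n * K.
    by rewrite /c (minn_idPl n256) (minn_idPl (ltnW n256)) expnSr.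
  rewrite -mulnA leq_pmul2l ?expn_gt0 ?K0 //.
  by rewrite (leq_trans (hK e)) // leq_pmul2l // leq_expr.
apply: leq_mul (cS n) _; apply: (@leq_trans (256 ^ e)); last exact: leq_expr.
by rewrite -[256]/(2 ^ 8) -expnM mulnC expnM leq_exp2r // succ_le_exp2.
Qed.

Lemma leq_totient_mul_prime d p : 0 < d -> prime p -> totient d <= totient (d * p).
Proof.
move=> d0 pp.
have [k kp dE] := pfactor_coprime pp d0.
have ckp e : coprime k (p ^ e) by rewrite coprimeXr // coprime_sym.
rewrite {}dE -mulnA -expnSr !totient_coprime // leq_mul //.
rewrite [leqRHS](totient_pfactor pp) //.
case: (logn p d) => [|e].
  have := prime_gt1 pp; case: (p) => [|[|q]] // _; rewrite ?muln_gt0 ?expn_gt0 //.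
by rewrite totient_pfactor //= leq_mul2l leq_exp2l ?leqnSn ?orbT // prime_gt1.
Qed.

Lemma leq_totient_dvd d m : 0 < m -> d %| m -> totient d <= totient m.
Proof.
move=> m0 /dvdnP[k mE]; move: m0; rewrite {}mE.
elim/ltn_ind: k => k IH; rewrite muln_gt0 => /andP[k0 d0].
have [->|k1] := eqVneq k 1; first by rewrite mul1n.
have {}k1 : 1 < k by rewrite ltn_neqAle eq_sym k1.
have pp := pdiv_prime k1; have := pdiv_dvd k => /dvdnP[j kE].
have j0 : 0 < j by move: k0; rewrite kE muln_gt0 => /andP[].
apply: (@leq_trans (totient (j * d))).
  apply: IH; last by rewrite muln_gt0 j0.
  by rewrite [ltnRHS]kE ltn_Pmulr // prime_gt1.
by rewrite [in leqRHS]kE mulnAC leq_totient_mul_prime // muln_gt0 j0.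
Qed.

(** Gauss's identity $m = \sum_{d | m} \phi(d)$, with each term at most $\phi(m)$. In
    [kloosterman_bound] it limits the cost of dividing by $\phi(m)$ to one divisor factor. *)
Lemma leq_totient_mul_divisors m : 0 < m -> m <= totient m * size (divisors m).
Proof.
move=> m0; rewrite -{1}(sum_totient_dvd m).
apply: (@leq_trans (\sum_(d < m.+1 | d %| m) totient m)).
  by apply: leq_sum => d; apply: leq_totient_dvd.
rewrite sum_nat_const mulnC leq_mul2l; apply/orP; right.
rewrite cardE -(size_map val (enum _)).
apply: uniq_leq_size => [|d /mapP[i]].
  by rewrite map_inj_uniq ?enum_uniq //; apply: val_inj.
by rewrite mem_enum unfold_in => im -> /=; rewrite -dvdn_divisors.
Qed.

Lemma card_dvd_ord m k : 0 < k -> k %| m -> #|[pred x : 'I_m | k %| x]| <= m %/ k.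
Proof.
move=> k0 /dvdnP[j ->]; rewrite mulnK // -[leqRHS](size_iota 0) -(size_map (muln k) (iota _ _)).
rewrite cardE -(size_map val (enum _)); apply: uniq_leq_size => [|d /mapP[i]].
  by rewrite map_inj_uniq ?enum_uniq //; apply: val_inj.
rewrite mem_enum inE => /dvdnP[q iE] -> /=; rewrite iE mulnC map_f // mem_iota /=.
by rewrite add0n -(ltn_pmul2r k0) -iE ltn_ord.
Qed.

(** The gcd is one of the common divisors [d] of [x] and [m], so it is at most their sum; exchanging
    sums, each [d] contributes at most $d \cdot m/d = m$. *)
Lemma sum_gcdn_le m : 0 < m ->
  \sum_(x < m) gcdn x m <= m * size (divisors m).
Proof.
move=> m0.
apply: (@leq_trans (\sum_(x < m) \sum_(d <- divisors m | d %| x) d)).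
  apply: leq_sum => x _; rewrite (big_rem (gcdn x m)) /=; last first.
    by rewrite -dvdn_divisors // dvdn_gcdr.
  by rewrite dvdn_gcdl leq_addr.
have -> : m * size (divisors m) = \sum_(d <- divisors m) m.
  by rewrite big_const_seq count_predT iter_addn_0.
rewrite (exchange_big_dep predT) //=.
rewrite big_seq_cond [leqRHS]big_seq_cond; apply: leq_sum => d; rewrite andbT -dvdn_divisors // => dm.
have d0 := dvdn_gt0 m0 dm.
by rewrite sum_nat_const -[leqRHS](divnK dm) leq_mul2r card_dvd_ord ?orbT.
Qed.

Lemma leq_gcdnM a b m : 0 < m -> gcdn (a * b) m <= gcdn a m * gcdn b m.
Proof.
move=> m0; apply: dvdn_leq; first by rewrite muln_gt0 !gcdn_gt0 m0 !orbT.
set g := gcdn (a * b) m.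
have gm : g %| m := dvdn_gcdr _ _; have gab : g %| a * b := dvdn_gcdl _ _.
rewrite muln_gcdl !muln_gcdr !dvdn_gcd gab /=.
by rewrite dvdn_mull //= !dvdn_mulr.
Qed.

(** Subtracting one solution [x0] injects the solutions into the multiples of [m / gcd (h, m)]. *)
Lemma card_mul_eq_modn m h r : 0 < m ->
  #|[pred x : 'I_m | (h * x == r %[mod m])%N]| <= gcdn h m.
Proof.
move=> m0; set P := [pred x : 'I_m | _]; set g := gcdn h m.
have g0 : 0 < g by rewrite gcdn_gt0 m0 orbT.
have [/eqP ->//|] := boolP (#|P| == 0); rewrite -lt0n => /card_gt0P[x0 /eqP Px0].
have mg0 : 0 < m %/ g by rewrite divn_gt0 // dvdn_leq // dvdn_gcdr.
have mgm : m %/ g %| m by rewrite dvdn_div ?dvdn_gcdr.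
have gE : g = m %/ (m %/ g) by rewrite divnA ?dvdn_gcdr // mulKn.
rewrite gE; apply: leq_trans _ (card_dvd_ord mg0 mgm).
pose f (x : 'I_m) : 'I_m := Ordinal (ltn_pmod (x + (m - x0)) m0).
have fi : injective f.
  move=> x y [] /eqP; rewrite eqn_modDr !modn_small // => /eqP; exact: val_inj.
rewrite -(fintype.card_image fi); apply: subset_leq_card.
apply/fintype.subsetP => y /fintype.imageP[x].
rewrite !inE => /eqP Px ->.
have : m %| h * (x + (m - x0)).
  rewrite /dvdn mulnDr -modnDml Px -Px0 modnDml -mulnDr.
  by rewrite subnKC 1?ltnW // modnMl.
rewrite /= /dvdn => hm; rewrite modn_dvdm //.
have : m %/ g %| h %/ g * (x + (m - x0)).
  by rewrite -(@dvdn_pmul2r g) // divnK ?dvdn_gcdr // mulnAC divnK ?dvdn_gcdl.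
rewrite Gauss_dvdr // coprime_sym /coprime -(eqn_pmul2r g0) mul1n muln_gcdl.
by rewrite !divnK ?dvdn_gcdl ?dvdn_gcdr.
Qed.

(** * Kloosterman sums *)

Lemma sum_bool_card (I : finType) (P : pred I) : \sum_i (P i) = #|P|.
Proof. by rewrite -sum1_card [RHS]big_mkcond; apply: eq_bigr => i _; rewrite unfold_in; case: (P i). Qed.

Section Kloosterman.
Local Open Scope ring_scope.
Variables (p : nat) (z : algC).
Local Notation m := p.+2.
Local Notation Zm := 'I_p.+2.
Hypothesis zP : m.-primitive_root z.

(** A faithful additive character of Z/m. The modulus is [p.+2] so that the ordinals form a
    nontrivial ring. *)
Definition addchar (x : Zm) : algC := z ^+ x.
Local Notation e := addchar.

Lemma addchar0 : e 0 = 1. Proof. by []. Qed.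

Lemma addcharD x y : e (x + y) = e x * e y.
Proof. by rewrite /e /= prim_expr_mod // exprD. Qed.

Lemma addchar_eq1 x : (e x == 1) = (x == 0).
Proof. by rewrite /e -(prim_order_dvd zP) /dvdn modn_small. Qed.

Lemma norm_addchar x : `|e x| = 1.
Proof.
have z1 : `|z| = 1.
  by apply/eqP; rewrite -(@pexpr_eq1 _ _ m) // -normrX (prim_expr_order zP) normr1.
by rewrite normrX z1 expr1n.
Qed.

Lemma addchar_neq0 x : e x != 0.
Proof. by rewrite -normr_eq0 norm_addchar oner_eq0. Qed.

Lemma addcharN x : e (- x) = (e x)^-1.
Proof. by apply: (mulIf (addchar_neq0 x)); rewrite -addcharD addNr mulVf // addchar_neq0. Qed.

Lemma conj_addchar x : (e x)^* = e (- x).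
Proof.
rewrite addcharN; apply: (mulfI (addchar_neq0 x)).
by rewrite -normCK norm_addchar expr1n mulfV // addchar_neq0.
Qed.

Lemma sum_addchar h : \sum_x e (h * x) = m%:R * (h == 0)%:R.
Proof.
have [->|h0] := eqVneq h 0.
  rewrite mulr1 (eq_bigr (fun=> 1)) => [|x _]; last by rewrite mul0r.
  by rewrite sumr_const card_ord.
rewrite mulr0; set S := \sum_x _.
have : e h * S = S.
  rewrite mulr_sumr [RHS](reindex_inj (addrI 1)) /=.
  by apply: eq_bigr => x _; rewrite mulrDr mulr1 addcharD.
move/eqP; rewrite -subr_eq0 -{2}[S]mul1r -mulrBl mulf_eq0 subr_eq0 addchar_eq1.
by rewrite (negPf h0) => /eqP.
Qed.

Lemma sum_addcharl h : \sum_x e (x * h) = m%:R * (h == 0)%:R.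
Proof. by rewrite -sum_addchar; apply: eq_bigr => x _; rewrite mulrC. Qed.

Definition unitm : pred Zm := fun x => x \is a GRing.unit.

Definition kloosterman (h k : Zm) : algC := \sum_(x | unitm x) e (h * x + k * x^-1).
Local Notation S := kloosterman.

Lemma kloostermanC h k : S h k = S k h.
Proof.
rewrite /S (reindex_inj (@invr_inj _)) /=; apply: eq_big => [x|x _].
  by rewrite /unitm unitrV.
by rewrite invrK addrC.
Qed.

Lemma kloosterman_scale h k u : unitm u -> S (h * u) (k * u^-1) = S h k.
Proof.
move=> uu; rewrite [RHS](reindex_inj (mulrI uu)) /=; apply: eq_big => [x|x xu].
  by rewrite /unitm unitrMr.
by rewrite invrM // !mulrA [k * _ * _]mulrAC.
Qed.

Lemma norm_kloosterman h k : `|S h k| <= m%:R.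
Proof.
apply: le_trans (ler_norm_sum _ _ _) _.
rewrite (eq_bigr (fun=> 1)) => [|x _]; last by rewrite norm_addchar.
by rewrite sumr_const ler_nat -[leqRHS]card_ord max_card.
Qed.

Lemma card_unitm : #|unitm| = totient m.
Proof.
rewrite totient_count_coprime big_mkord -sum_bool_card; apply: eq_bigr => x _.
by rewrite /unitm -{1}[x]natr_Zp (@unitZpE m).
Qed.

Lemma kloosterman00 : S 0 0 = (totient m)%:R.
Proof.
rewrite /S (eq_bigr (fun=> 1)) => [|x _]; last by rewrite !mul0r addr0.
by rewrite sumr_const card_unitm.
Qed.

Lemma card_mul_eq (h r : Zm) : (\sum_(x : Zm) (h * x == r)%R <= gcdn h m)%N.
Proof.
rewrite (sum_bool_card [pred x : Zm | h * x == r]).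
apply: leq_trans _ (@card_mul_eq_modn m h r isT).
apply: subset_leq_card; apply/fintype.subsetP => x; rewrite !inE => /eqP <-.
by rewrite modn_mod.
Qed.

(** Expanding the square, the sums over [h] and [k] are orthogonality relations and keep only the
    pairs (i, j) on which both [f] and [g] agree: a second moment counts coincidences. *)
Lemma parseval_pair (I : finType) (P : pred I) (f g : I -> Zm) :
  \sum_h \sum_k `|\sum_(i | P i) e (h * f i + k * g i)| ^+ 2 =
  m%:R ^+ 2 * \sum_(i | P i) \sum_(j | P j) ((f i == f j) && (g i == g j))%:R.
Proof.
have H h k : `|\sum_(i | P i) e (h * f i + k * g i)| ^+ 2 =
    \sum_(i | P i) \sum_(j | P j) e (h * (f i - f j)) * e (k * (g i - g j)).
  rewrite normCK rmorph_sum mulr_suml; apply: eq_bigr => i _.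
  rewrite mulr_sumr; apply: eq_bigr => j _.
  by rewrite /= conj_addchar -!addcharD; congr e; ring.
rewrite (eq_bigr (fun h => \sum_k \sum_(i | P i) \sum_(j | P j)
   e (h * (f i - f j)) * e (k * (g i - g j)))); last by move=> h _; apply: eq_bigr.
rewrite (eq_bigr (fun h => \sum_(i | P i) \sum_(j | P j)
   e (h * (f i - f j)) * (m%:R * (g i == g j)%:R))); last first.
  move=> h _; rewrite exchange_big; apply: eq_bigr => i _.
  rewrite exchange_big; apply: eq_bigr => j _.
  by rewrite -mulr_sumr sum_addcharl subr_eq0.
rewrite exchange_big mulr_sumr; apply: eq_bigr => i _.
rewrite exchange_big mulr_sumr; apply: eq_bigr => j _.
by rewrite -mulr_suml sum_addcharl subr_eq0 -mulnb natrM; ring.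
Qed.

Lemma parseval (I : finType) (P : pred I) (f : I -> Zm) :
  \sum_h `|\sum_(i | P i) e (h * f i)| ^+ 2 =
  m%:R * \sum_(i | P i) \sum_(j | P j) (f i == f j)%:R.
Proof.
have m0 : (m%:R : algC) != 0 by rewrite pnatr_eq0.
apply: (mulfI m0); rewrite mulrA -expr2.
transitivity (m%:R ^+ 2 * \sum_(i | P i) \sum_(j | P j)
    ((f i == f j) && ((0 : Zm) == 0))%:R : algC); last first.
  by congr (_ * _); apply: eq_bigr => i _; apply: eq_bigr => j _; rewrite andbT.
rewrite -parseval_pair mulr_sumr; apply: eq_bigr => h _.
under [RHS]eq_bigr do under eq_bigr do rewrite mulr0 addr0.
by rewrite sumr_const card_ord mulr_natl.
Qed.

(** Multiplying the second equation by $abcd$ and using the first gives $(a+b)cd = (a+b)ab$; then $d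
    = a+b-c$ makes the difference factor. Zero divisors modulo [m] prevent going on to c = a, c = b
    or a + b = 0. *)
Lemma unit_sum_eq (a b c d : Zm) : unitm a -> unitm b -> unitm c -> unitm d ->
  a + b = c + d -> a^-1 + b^-1 = c^-1 + d^-1 -> (c - a) * (c - b) * (a + b) = 0.
Proof.
move=> ua ub uc ud e1 e2.
have : (a + b) * (c * d) = (a + b) * (a * b).
  transitivity ((a^-1 + b^-1) * (a * b * c * d)).
    transitivity ((a / a) * b * c * d + (b / b) * a * c * d); last by ring.
    by rewrite !mulrV //; ring.
  rewrite e2; transitivity ((c / c) * d * a * b + (d / d) * c * a * b); first by ring.
  by rewrite !mulrV // e1; ring.
move/eqP; rewrite -subr_eq0 -mulrBr => /eqP h.
have dE : d = a + b - c by rewrite e1; ring.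
by rewrite -[RHS]oppr0 -h dE; ring.
Qed.

(* By unit_sum_eq, a pair x and one entry of y determine y; in the variables c - x.1,
   c - x.2 the remaining equation is linear in c. *)
Lemma additive_energy_le (U2 := fun x : Zm * Zm => unitm x.1 && unitm x.2) :
  (\sum_(x | U2 x) \sum_(y | U2 y)
    ((x.1 + x.2 == y.1 + y.2) && (x.1^-1 + x.2^-1 == y.1^-1 + y.2^-1))%R <=
  2 * (m * size (divisors m)) ^ 2)%N.
Proof.
apply: (@leq_trans (\sum_(x : Zm * Zm) \sum_(c : Zm) \sum_(d : Zm)
   (((c - x.1) * (c - x.2) * (x.1 + x.2) == 0) && (d == x.1 + x.2 - c))%R)%N).
  rewrite big_mkcond; apply: leq_sum => x _; case: ifP => // /andP[ux1 ux2].
  rewrite pair_big /= big_mkcond; apply: leq_sum => -[c d] _ /=.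
  case: ifP => // /andP[/= uc ud].
  case: eqP => //= e1; case: eqP => //= e2.
  rewrite (unit_sum_eq ux1 ux2 uc ud e1 e2) eqxx /= e1.
  by rewrite addrAC subrr add0r eqxx.
apply: (@leq_trans (\sum_(x : Zm * Zm) \sum_(c : Zm)
   ((c - x.1) * (c - x.2) * (x.1 + x.2) == 0)%R)%N).
  apply: leq_sum => x _; apply: leq_sum => c _.
  rewrite (bigD1 (x.1 + x.2 - c)) //= eqxx andbT big1 ?addn0 // => d /negPf ->.
  by rewrite andbF.
rewrite exchange_big /=.
have E c : (\sum_(x : Zm * Zm) ((c - x.1) * (c - x.2) * (x.1 + x.2) == 0)%R =
    \sum_(a : Zm) \sum_(b : Zm) (a * b * 2%:R * c == a * b * (a + b))%R)%N.
  rewrite pair_big /= (reindex_inj (h := fun x => (c - x.1, c - x.2))) /=.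
    apply: eq_bigr => -[a b] _ /=; rewrite -[in RHS]subr_eq0; congr (nat_of_bool (_ == _)).
    by ring.
  by move=> [a b] [a' b'] h; move: (congr1 fst h) (congr1 snd h) => /= /addrI/oppr_inj -> /addrI/oppr_inj ->.
rewrite (eq_bigr _ (fun c _ => E c)) exchange_big /=.
have vM (x y : Zm) : nat_of_ord (x * y) = ((x * y)%N %% m)%N by [].
have h2 : (gcdn (2%:R : Zm) m <= 2)%N.
  by rewrite Zp_nat /= gcdn_modl dvdn_leq // dvdn_gcdl.
(* For fixed [a] and [b] this is a linear congruence in [c] with coefficient $2ab$, so it has at
   most $\gcd(2ab,m) \le 2 \gcd(a,m)\gcd(b,m)$ solutions; the double sum then factors. *)
apply: (@leq_trans (\sum_(a : Zm) \sum_(b : Zm) 2 * (gcdn a m * gcdn b m))%N).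
  apply: leq_sum => a _; rewrite exchange_big; apply: leq_sum => b _ /=.
  apply: leq_trans (card_mul_eq _ _) _.
  rewrite vM gcdn_modl; apply: leq_trans (leq_gcdnM _ _ _) _ => //.
  by rewrite mulnC vM gcdn_modl leq_mul ?leq_gcdnM //.
under eq_bigr do rewrite -big_distrr -big_distrr /=.
rewrite -big_distrr -big_distrl /= leq_mul2l /= -mulnn.
by rewrite leq_mul // sum_gcdn_le.
Qed.

(** $S^2$ is a character sum over pairs of units with frequencies $x_1+x_2$ and $x_1^{-1}+x_2^{-1}$,
    so Parseval turns $\sum |S^2|^2$ into the additive energy of the modular hyperbola. *)
Lemma kloosterman_fourth_moment :
  \sum_h \sum_k `|S h k| ^+ 4 <= (2 * m ^ 4 * size (divisors m) ^ 2)%:R.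
Proof.
pose U2 (x : Zm * Zm) := unitm x.1 && unitm x.2.
have S2 h k : `|S h k| ^+ 4 =
    `|\sum_(x | U2 x) e (h * (x.1 + x.2) + k * (x.1^-1 + x.2^-1))| ^+ 2.
  rewrite (exprM _ 2 2) -normrX; congr (`|_| ^+ _).
  rewrite expr2 /S big_distrlr /= pair_big /=; apply: eq_bigr => x _.
  by rewrite -addcharD; congr e; ring.
under eq_bigr do under eq_bigr do rewrite S2.
rewrite parseval_pair.
have -> : (2 * m ^ 4 * size (divisors m) ^ 2 =
  m ^ 2 * (2 * (m * size (divisors m)) ^ 2))%N by rewrite expnMn; nia.
rewrite natrM natrX ler_wpM2l ?exprn_ge0 //.
under eq_bigr do rewrite -natr_sum.
by rewrite -natr_sum ler_nat additive_energy_le.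
Qed.

(* The sum is invariant under (h, k) |-> (h u, k / u) for each unit u, so the fourth
   moment bounds phi (m) copies of it, up to the multiplicity gcd (h, m). *)
Lemma kloosterman_bound h k :
  `|S h k| ^+ 4 <= (2 * m ^ 3 * size (divisors m) ^ 3 * gcdn h m)%:R.
Proof.
have phi0 : (0 : algC) < (totient m)%:R by rewrite ltr0n totient_gt0.
rewrite -(ler_pM2l phi0).
have Sge0 h' k' : 0 <= `|S h' k'| ^+ 4 by rewrite exprn_ge0.
have -> : (totient m)%:R * `|S h k| ^+ 4 =
    \sum_(u | unitm u) `|S (h * u) (k * u^-1)| ^+ 4.
  rewrite (eq_bigr (fun=> `|S h k| ^+ 4)) => [|u uu]; last by rewrite kloosterman_scale.
  by rewrite sumr_const card_unitm mulr_natl.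
apply: (@le_trans _ _ (\sum_u \sum_h' \sum_k' (h * u == h')%:R * (k' == k * u^-1)%:R * `|S h' k'| ^+ 4)).
  rewrite big_mkcond; apply: ler_sum => u _; case: ifP => uu; last first.
    by do 2 (apply: sumr_ge0 => ? _); rewrite !mulr_ge0.
  rewrite (bigD1 (h * u)) //= (bigD1 (k * u^-1)) //= !eqxx !mul1r -addrA lerDl.
  by rewrite addr_ge0 // !sumr_ge0 // => ? _; rewrite ?sumr_ge0 // => *; rewrite !mulr_ge0.
apply: (@le_trans _ _ (\sum_h' \sum_k' (gcdn h m)%:R * `|S h' k'| ^+ 4)).
  rewrite exchange_big; apply: ler_sum => h' _.
  rewrite exchange_big; apply: ler_sum => k' _ /=.
  rewrite -mulr_suml ler_wpM2r //.
  apply: (@le_trans _ _ (\sum_u (h * u == h')%:R)).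
    by apply: ler_sum => u _; case: (h * u == h'); rewrite ?mul0r // mul1r lern1 leq_b1.
  rewrite -natr_sum ler_nat ; exact: card_mul_eq.
under eq_bigr do rewrite -mulr_sumr.
rewrite -mulr_sumr; apply: le_trans (ler_wpM2l _ kloosterman_fourth_moment) _ => //.
rewrite -!natrM ler_nat.
(* One factor [m] of the fourth moment is traded for $\phi(m) d(m)$, and $\phi(m)$ cancels against
   the number of copies. *)
have := leq_totient_mul_divisors (isT : 0 < m)%N.
set d := size _; set t := totient m; move=> mtd.
apply: (@leq_trans (gcdn h m * (2 * m ^ 3 * (t * d) * d ^ 2))); last by nia.
have -> : (m ^ 4 = m ^ 3 * m)%N by rewrite -expnSr.
by rewrite !(leq_mul2l, leq_mul2r, mulnA) mtd !orbT.
Qed.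

End Kloosterman.

(** * Points of the modular hyperbola in boxes *)

Section Box.
Local Open Scope ring_scope.

(** Full periods of length [M] sum to 0, and the remainder has at most [M] terms of modulus 1. *)
Lemma norm_sum_expr_le (w : algC) M n : (0 < M)%N -> w ^+ M = 1 -> w != 1 ->
  `|w| = 1 -> `|\sum_(i < n) w ^+ i| <= M%:R.
Proof.
move=> M0 wM w1 nw; elim/ltn_ind: n => n IH.
have [nM|Mn] := leqP n M.
  apply: le_trans (ler_norm_sum _ _ _) _.
  rewrite (eq_bigr (fun=> 1)) => [|i _]; last by rewrite normrX nw expr1n.
  by rewrite sumr_const card_ord ler_nat.
rewrite -(subnKC (ltnW Mn)) big_split_ord /=.
have -> : \sum_(i < M) w ^+ i = 0.
  apply: (mulfI (_ : w - 1 != 0)); first by rewrite subr_eq0.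
  by rewrite -subrX1 wM subrr mulr0.
rewrite add0r; under eq_bigr do rewrite exprD wM mul1r.
by apply: IH; rewrite ltn_subrL M0 (ltn_trans M0).
Qed.

Variables (p : nat) (z : algC).
Local Notation m := p.+2.
Local Notation Zm := 'I_p.+2.
Hypothesis zP : m.-primitive_root z.
Local Notation e := (@addchar p z).
Local Notation S := (@kloosterman p z).

Definition charsum n (h : Zm) : algC := \sum_(i < n) e (h * i%:R).

Lemma addchar_natr h n : e (h * n%:R) = e h ^+ n.
Proof.
elim: n => [|n IH]; first by rewrite mulr0.
by rewrite -natr1 mulrDr mulr1 addcharD // IH exprSr.
Qed.

Lemma sum_charsum_sqr n : (n <= m)%N ->
  \sum_h `|charsum n h| ^+ 2 = (m * n)%:R.
Proof.
move=> nm; rewrite /charsum (parseval zP xpredT (fun i : 'I_n => i%:R)) natrM.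
congr (_ * _); rewrite (eq_bigr (fun=> 1)) ?sumr_const ?card_ord // => i _.
rewrite (bigD1 i) //= eqxx big1 ?addr0 // => j ji.
suff /negPf -> : (i%:R : Zm) != j%:R by [].
apply: contra ji => /eqP/(congr1 (@nat_of_ord _)).
rewrite !Zp_nat /= !modn_small ?(leq_trans (ltn_ord _) nm) // => /val_inj ->.
exact: eqxx.
Qed.

(** By $2xy \le x^2+y^2$ and Parseval. This is the summability that the double smoothing of each
    coordinate provides. *)
Lemma sum_charsum_mul_le n1 n2 : (n1 <= m)%N -> (n2 <= m)%N ->
  \sum_h `|charsum n1 h| * `|charsum n2 h| <= (m ^ 2)%:R.
Proof.
move=> n1m n2m.
have two : (0 : algC) < 2 by [].
rewrite -(ler_pM2l two) mulr_sumr.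
apply: (@le_trans _ _ (\sum_h (`|charsum n1 h| ^+ 2 + `|charsum n2 h| ^+ 2))).
  apply: ler_sum => h _; rewrite -subr_ge0.
  have -> : `|charsum n1 h| ^+ 2 + `|charsum n2 h| ^+ 2 - 2 * (`|charsum n1 h| * `|charsum n2 h|)
    = (`|charsum n1 h| - `|charsum n2 h|) ^+ 2 by ring.
  by rewrite real_exprn_even_ge0 // rpredB // normr_real.
rewrite big_split /= !sum_charsum_sqr // -natrD -natrM ler_nat.
by nia.
Qed.

(** For nonzero [h], [e h] is a root of unity other than 1 whose order divides [m / gcd (h, m)]: the
    sum is geometric. *)
Lemma norm_charsum_le n h : h != 0 -> `|charsum n h| * (gcdn h m)%:R <= m%:R.
Proof.
move=> h0; set g := gcdn h m.
have g0 : (0 < g)%N by rewrite gcdn_gt0 orbT.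
have gm : (g %| m)%N := dvdn_gcdr _ _.
rewrite -[in leRHS](divnK gm) natrM ler_wpM2r //.
rewrite /charsum; under eq_bigr do rewrite addchar_natr.
apply: norm_sum_expr_le; rewrite ?norm_addchar ?addchar_eq1 //.
  by rewrite divn_gt0 // dvdn_leq.
rewrite /addchar -exprM; apply/eqP; rewrite -(prim_order_dvd zP).
by rewrite muln_divCA_gcd dvdn_mulr.
Qed.

(** The equation f g = -1 holds exactly when some unit [x] satisfies x = f and $-x^{-1} = g$, and
    then [x] is unique. Both equalities are detected by characters; the sum over [x] that remains is
    a Kloosterman sum. *)
Lemma hyperbola_fourier (I J : finType) (f : I -> Zm) (g : J -> Zm) :
  (m ^ 2)%:R * (\sum_i \sum_j (f i * g j == -1)%R)%:R =
  \sum_h \sum_k (\sum_i e (h * f i))^* * (\sum_j e (k * g j)) * S h k.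
Proof.
have H i j : (m ^ 2)%:R * (f i * g j == -1)%:R =
    \sum_h \sum_k (e (h * f i))^* * e (k * g j) * S h k :> algC.
  transitivity (\sum_(x | unitm x) \sum_h \sum_k e (h * (x - f i)) * e (k * (g j - - x^-1))); last first.
    rewrite exchange_big; apply: eq_bigr => h _.
    rewrite exchange_big; apply: eq_bigr => k _.
    rewrite /kloosterman mulr_sumr; apply: eq_bigr => x _.
    by rewrite conj_addchar // -!addcharD //; congr e; ring.
  have E x : \sum_h \sum_k e (h * (x - f i)) * e (k * (g j - - x^-1)) =
      (m ^ 2)%:R * ((x == f i) && (g j == - x^-1))%:R :> algC.
    under eq_bigr do rewrite -mulr_sumr sum_addcharl //.
    rewrite -mulr_suml sum_addcharl // !subr_eq0 -mulnb natrM natrX; ring.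
  rewrite (eq_bigr _ (fun x _ => E x)) -mulr_sumr; congr (_ * _).
  have [fg|fg] := eqVneq (f i * g j) (-1).
    have fu : unitm (f i).
      by apply/unitrPr; exists (- g j); rewrite mulrN fg opprK.
    have gf : g j = - (f i)^-1 by apply: (mulrI fu); rewrite fg mulrN mulrV.
    rewrite (bigD1 (f i)) //= eqxx gf eqxx big1 ?addr0 // => x /andP[_ /negPf ->].
    by [].
  rewrite big1 // => x ux; case: eqP => //= xf; case: eqP => //= gx.
  case/eqP: fg; rewrite -xf gx mulrN mulrV //.
rewrite natr_sum mulr_sumr.
under eq_bigr do rewrite natr_sum mulr_sumr.
under eq_bigr do under eq_bigr do rewrite H.
transitivity (\sum_i \sum_h \sum_k \sum_j (e (h * f i))^* * e (k * g j) * S h k).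
  apply: eq_bigr => i _; rewrite exchange_big; apply: eq_bigr => h _.
  by rewrite exchange_big.
rewrite exchange_big; apply: eq_bigr => h _.
rewrite exchange_big; apply: eq_bigr => k _.
rewrite rmorph_sum !mulr_suml; apply: eq_bigr => i _.
by rewrite [X in _ = X * _]mulr_sumr mulr_suml; apply: eq_bigr.
Qed.

(** The threshold is $\sqrt m$. Above it the two character sums, each at most m / gcd, have product
    at most [m] ([charsum_mul_large]); below it [kloosterman_bound] still saves a power of [m]. At h
    = 0 the character sums have no cancellation, so it is excluded. *)
Definition large_gcd (h : Zm) : bool := (h != 0) && (m < gcdn h m ^ 2)%N.

(** Markov's inequality for [sum_gcdn_le], squared so as to stay within the naturals. *)
Lemma sum_large_gcd_le : ((\sum_h large_gcd h) ^ 2 <= m * size (divisors m) ^ 2)%N.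
Proof.
rewrite -(@leq_pmul2r m) //.
apply: (@leq_trans ((\sum_(h < m) gcdn h m) ^ 2)); last first.
  apply: (@leq_trans ((m * size (divisors m)) ^ 2)); last by rewrite expnMn; nia.
  by rewrite leq_exp2r // sum_gcdn_le.
rewrite !expnS !expn0 !muln1 !big_distrlr /= big_distrl /=; apply: leq_sum => x _.
rewrite big_distrl; apply: leq_sum => y _ /=.
rewrite /large_gcd; case: eqP => //= _; case: eqP => //= _; rewrite ?muln0 //.
case: ltnP => //= hx; case: ltnP => //= hy; rewrite !mul1n.
rewrite -leq_sqr expnMn -[leqLHS]mulnn; exact: leq_mul (ltnW hx) (ltnW hy).
Qed.

Lemma charsum_mul_large n1 n2 h : large_gcd h ->
  `|charsum n1 h| * `|charsum n2 h| <= m%:R.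
Proof.
case/andP=> h0 hg; have m0 : (0 : algC) < m%:R by rewrite ltr0n.
rewrite -(ler_pM2r m0) -natrM.
apply: (@le_trans _ _ (`|charsum n1 h| * (gcdn h m)%:R * (`|charsum n2 h| * (gcdn h m)%:R))).
  rewrite mulrACA ler_wpM2l ?mulr_ge0 // -natrM ler_nat mulnn; exact: ltnW.
by rewrite natrM ler_pM ?mulr_ge0 // norm_charsum_le.
Qed.

Lemma kloosterman_small K (h k : Zm) :
  (forall g, (g ^ 2 <= m -> 2 * m ^ 3 * size (divisors m) ^ 3 * g * K ^ 4 <= m ^ 4)%N) ->
  (gcdn h m ^ 2 <= m)%N -> K%:R * `|S h k| <= m%:R.
Proof.
move=> HK hg; rewrite -(@ler_pXn2r _ 4) ?nnegrE ?mulr_ge0 //.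
rewrite exprMn -!natrX mulrC.
apply: le_trans (ler_wpM2r _ (kloosterman_bound zP h k)) _; first exact: ler0n.
by rewrite -natrM ler_nat HK.
Qed.

Lemma sum_addchar_box a n1 n2 (h : Zm) :
  \sum_(i : 'I_n1 * 'I_n2) e (h * (a + i.1 + i.2)%:R) =
  e (h * a%:R) * charsum n1 h * charsum n2 h.
Proof.
rewrite /charsum [X in _ = X * _]mulr_sumr mulr_suml.
under [RHS]eq_bigr do rewrite mulr_sumr.
rewrite pair_big /=; apply: eq_bigr => -[i j] _ /=.
by rewrite -!addcharD // !natrD !mulrDr.
Qed.

(* Each coordinate is summed over two indices: the Fourier transform of the smoothed
   interval is a product of two character sums, which is summable by Cauchy-Schwarz,
   with no logarithm.  The frequencies with a large gcd are few and are bounded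
   trivially. *)
Lemma hyperbola_box K a n1 n2 b n3 n4 :
  (forall g, (g ^ 2 <= m -> 2 * m ^ 3 * size (divisors m) ^ 3 * g * K ^ 4 <= m ^ 4)%N) ->
  (K * \sum_h large_gcd h <= m)%N ->
  (n1 <= m)%N -> (n2 <= m)%N -> (n3 <= m)%N -> (n4 <= m)%N ->
  (K * (totient m * n1 * n2 * n3 * n4) <=
   K * (m ^ 2 * \sum_(i : 'I_n1 * 'I_n2) \sum_(j : 'I_n3 * 'I_n4)
      ((a + i.1 + i.2)%:R * (b + j.1 + j.2)%:R == -1 :> Zm)%R) + 3 * m ^ 5)%N.
Proof.
move=> HK Hb l1 l2 l3 l4.
set T := (\sum_i _)%N.
have := @hyperbola_fourier _ _ (fun i : 'I_n1 * 'I_n2 => (a + i.1 + i.2)%:R)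
  (fun j : 'I_n3 * 'I_n4 => (b + j.1 + j.2)%:R).
rewrite -/T.
under eq_bigr do under eq_bigr do rewrite !sum_addchar_box.
pose A h := (e (h * a%:R) * charsum n1 h * charsum n2 h)^*.
pose B k := e (k * b%:R) * charsum n3 k * charsum n4 k.
pose ah h := `|charsum n1 h| * `|charsum n2 h|.
pose bk k := `|charsum n3 k| * `|charsum n4 k|.
have nA h : `|A h| = ah h by rewrite norm_conjC !normrM norm_addchar // mul1r.
have nB h : `|B h| = bk h by rewrite !normrM norm_addchar // mul1r.
have c0 n : charsum n 0 = n%:R.
  by rewrite /charsum (eq_bigr (fun=> 1)) ?sumr_const ?card_ord.
have A0 : A 0 = (n1 * n2)%:R.
  by rewrite /A mul0r addchar0 mul1r !c0 -natrM conjC_nat.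
have B0 : B 0 = (n3 * n4)%:R by rewrite /B mul0r addchar0 mul1r !c0 -natrM.
have -> : \sum_h \sum_k A h * B k * S h k = (totient m * n1 * n2 * n3 * n4)%:R +
    \sum_h \sum_k ((h != 0) || (k != 0))%:R * (A h * B k * S h k).
  have -> : (totient m * n1 * n2 * n3 * n4)%:R =
     \sum_h \sum_k (~~ ((h != 0) || (k != 0)))%:R * (A h * B k * S h k).
    rewrite (bigD1 0) //= [X in _ + X]big1 ?addr0 => [|h h0]; last first.
      by rewrite big1 // => k _; rewrite h0 mul0r.
    rewrite (bigD1 0) //= [X in _ + X]big1 ?addr0 => [|k k0]; last first.
      by rewrite k0 mul0r.
    by rewrite ?eqxx /= mul1r A0 B0 kloosterman00 // -!natrM; congr _%:R; nia.
  rewrite -big_split; apply: eq_bigr => h _; rewrite -big_split; apply: eq_bigr => k _ /=.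
  by rewrite -mulrDl -natrD; case: (_ || _); rewrite mul1r.
set X := \sum_h _; set N0 := (totient m * _ * _ * _ * _)%N => TE.
have XE : X = (m ^ 2)%:R * T%:R - N0%:R by rewrite TE addrC addKr.
rewrite -(@ler_nat algC) natrD !(natrM _ K) (natrM _ (m ^ 2)) TE mulrDr -addrA lerDl.
rewrite addrC -lerBlDr sub0r.
apply: le_trans (real_ler_norm _) _.
  by rewrite XE rpredN rpredM ?realn // rpredB ?rpredM ?realn.
rewrite normrN normrM normr_nat.
have aS : \sum_h ah h <= (m ^ 2)%:R by exact: sum_charsum_mul_le.
have bS : \sum_h bk h <= (m ^ 2)%:R by exact: sum_charsum_mul_le.
have a0 h : 0 <= ah h by rewrite mulr_ge0.
have b0 h : 0 <= bk h by rewrite mulr_ge0.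
apply: le_trans (ler_wpM2l (ler0n _ K) (ler_norm_sum _ _ _)) _.
rewrite mulr_sumr.
have mm : (m ^ 2)%:R = m%:R * m%:R :> algC by rewrite -natrM.
(* Each term with (h, k) nonzero is dominated by one of three. The first uses the Kloosterman bound,
   through [h] if it is nonzero and through [k] otherwise by symmetry; the other two cover a large
   gcd of [h] or of [k], with the trivial bound for the Kloosterman sum. Each of the three sums to
   at most [m ^ 5]. *)
apply: (@le_trans _ _ (\sum_h \sum_k (ah h * bk k * m%:R +
    K%:R * (large_gcd h)%:R * (m ^ 2)%:R * bk k +
    K%:R * (large_gcd k)%:R * (m ^ 2)%:R * ah h))).
  apply: ler_sum => h _; apply: le_trans (ler_wpM2l (ler0n _ K) (ler_norm_sum _ _ _)) _.
  rewrite mulr_sumr; apply: ler_sum => k _.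
  rewrite normrM normr_nat normrM (normrM (A h)) nA nB.
  have t1 : 0 <= ah h * bk k * m%:R by rewrite !mulr_ge0.
  have t2 : 0 <= K%:R * (large_gcd h)%:R * (m ^ 2)%:R * bk k by rewrite !mulr_ge0.
  have t3 : 0 <= K%:R * (large_gcd k)%:R * (m ^ 2)%:R * ah h by rewrite !mulr_ge0.
  have Sm := norm_kloosterman zP h k.
  have [h0|h0] /= := boolP (h != 0).
    have [hg|hg] := boolP (large_gcd h).
      apply: le_trans (_ : K%:R * 1 * (m ^ 2)%:R * bk k <= _); last first.
        by rewrite addrAC lerDr addr_ge0 // ?mulr_ge0.
      rewrite mul1r mulr1 mm -mulrA ler_wpM2l // mulrAC ler_wpM2r //.
      by rewrite ler_pM // charsum_mul_large.
    apply: le_trans (_ : ah h * bk k * m%:R <= _); last by rewrite -addrA lerDl addr_ge0 // ?mulr_ge0.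
    rewrite mul1r mulrCA ler_wpM2l ?mulr_ge0 // (kloosterman_small _ HK) //.
    by move: hg; rewrite /large_gcd h0 /= -leqNgt.
  have [k0|k0] /= := boolP (k != 0); last by rewrite mul0r mulr0 !addr_ge0.
  have [kg|kg] := boolP (large_gcd k).
    apply: le_trans (_ : K%:R * 1 * (m ^ 2)%:R * ah h <= _); last by rewrite lerDr addr_ge0 // ?mulr_ge0.
    rewrite mul1r mulr1 mm -mulrA ler_wpM2l // -mulrA mulrC ler_wpM2r //.
    by rewrite ler_pM // charsum_mul_large.
  apply: le_trans (_ : ah h * bk k * m%:R <= _); last by rewrite -addrA lerDl addr_ge0 // ?mulr_ge0.
  rewrite mul1r mulrCA ler_wpM2l ?mulr_ge0 // kloostermanC (kloosterman_small _ HK) //.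
  by move: kg; rewrite /large_gcd k0 /= -leqNgt.
set nb := (\sum_h large_gcd h)%N in Hb.
have E2 (F : Zm -> algC) : \sum_h \sum_k K%:R * (large_gcd h)%:R * (m ^ 2)%:R * F k =
    (K * nb)%:R * (m ^ 2)%:R * \sum_k F k.
  rewrite natrM /nb natr_sum [X in X * _ * _]mulr_sumr [X in X * _]mulr_suml mulr_suml; apply: eq_bigr => h _.
  by rewrite mulr_sumr.
have -> : \sum_h \sum_k (ah h * bk k * m%:R +
    K%:R * (large_gcd h)%:R * (m ^ 2)%:R * bk k +
    K%:R * (large_gcd k)%:R * (m ^ 2)%:R * ah h) =
  (\sum_h ah h) * (\sum_k bk k) * m%:R + (K * nb)%:R * (m ^ 2)%:R * (\sum_k bk k) +
    (K * nb)%:R * (m ^ 2)%:R * (\sum_h ah h).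
  under eq_bigr do rewrite 2!big_split.
  rewrite 2!big_split /= E2; congr (_ + _ + _); last by rewrite exchange_big -E2.
  by rewrite big_distrlr mulr_suml; apply: eq_bigr => h _; rewrite mulr_suml.
have KM : (K * nb)%:R <= m%:R :> algC by rewrite ler_nat.
have -> : (3 * m ^ 5)%:R = (m ^ 2)%:R * (m ^ 2)%:R * m%:R + m%:R * (m ^ 2)%:R * (m ^ 2)%:R +
   m%:R * (m ^ 2)%:R * (m ^ 2)%:R :> algC.
  by rewrite -!natrM -!natrD; congr _%:R; rewrite !expnS expn0; ring.
by rewrite !lerD // ?ler_wpM2r // !ler_pM ?mulr_ge0 // sumr_ge0.
Qed.
End Box.

(** * Unsmoothed counts in boxes of integers *)

Definition hyp_count m a l b l' :=
  \sum_(i < l) \sum_(j < l') (m %| (a + i) * (b + j) + 1).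

Lemma leq_sum_shift (F : nat -> nat) t n l : t + n <= l ->
  \sum_(i < n) F (t + i) <= \sum_(i < l) F i.
Proof.
move=> /subnKC <-; rewrite !big_split_ord /=.
by rewrite addnAC leq_addl.
Qed.

Lemma hyp_count_shift m a l b l' t s n n' : t + n <= l -> s + n' <= l' ->
  hyp_count m (a + t) n (b + s) n' <= hyp_count m a l b l'.
Proof.
move=> tn sn; rewrite /hyp_count.
under eq_bigr do under eq_bigr do rewrite -!addnA.
rewrite (leq_trans _ (leq_sum_shift (fun i => \sum_(j < l') (m %| (a + i) * (b + j) + 1)) tn)) //.
apply: leq_sum => i _.
exact: (leq_sum_shift (fun j => (m %| (a + (t + i)) * (b + j) + 1) : nat) sn).
Qed.

Lemma Zp_mul_eqN1 p x y :
  ((x%:R * y%:R == -1 :> 'I_p.+2) = (p.+2 %| x * y + 1)%N)%R.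
Proof.
rewrite -subr_eq0 opprK -natrM natr1 Zp_nat addn1 /dvdn; apply/eqP/eqP => [/(congr1 val)//|h].
by apply: (@ord_inj p.+2); rewrite /= h.
Qed.

(** The smoothed count is a sum over [e ^ 2] translates of a smaller box, all inside the box that
    [hyp_count] sees. This is where the estimate becomes one-sided. *)
Lemma sum_box_le p a l b l' e n n' : n + e <= l -> n' + e <= l' ->
  \sum_(i : 'I_n * 'I_e) \sum_(j : 'I_n' * 'I_e)
    ((a + i.1 + i.2)%:R * (b + j.1 + j.2)%:R == -1 :> 'I_p.+2)%R <=
  e ^ 2 * hyp_count p.+2 a l b l'.
Proof.
move=> nl nl'.
have -> : \sum_(i : 'I_n * 'I_e) \sum_(j : 'I_n' * 'I_e)
    ((a + i.1 + i.2)%:R * (b + j.1 + j.2)%:R == -1 :> 'I_p.+2)%R =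
  \sum_(t < e) \sum_(s < e) hyp_count p.+2 (a + t) n (b + s) n'.
  rewrite -(pair_bigA _ (fun (i : 'I_n) (t : 'I_e) => \sum_(j : 'I_n' * 'I_e)
    ((a + i + t)%:R * (b + j.1 + j.2)%:R == -1 :> 'I_p.+2)%R)) exchange_big.
  apply: eq_bigr => t _ /=; rewrite /hyp_count [RHS]exchange_big; apply: eq_bigr => i _.
  rewrite -(pair_bigA _ (fun (j : 'I_n') (s : 'I_e) =>
    ((a + i + t)%:R * (b + j + s)%:R == -1 :> 'I_p.+2)%R : nat)).
  rewrite exchange_big.
  apply: eq_bigr => s _; apply: eq_bigr => j _; rewrite Zp_mul_eqN1.
  by rewrite (addnAC a) (addnAC b).
have -> : e ^ 2 * hyp_count p.+2 a l b l' = \sum_(t < e) \sum_(s < e) hyp_count p.+2 a l b l'.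
  by rewrite !sum_nat_const !card_ord mulnA mulnn.
apply: leq_sum => t _; apply: leq_sum => s _.
apply: hyp_count_shift; rewrite addnC.
  by apply: leq_trans nl; rewrite leq_add2l ltnW.
by apply: leq_trans nl'; rewrite leq_add2l ltnW.
Qed.

(** Raised to the eighth power, so that $d(m)^8 \le C m$ applies, the left side is at most $2^8 C^3
    K^{32} m^{31}$: the Kloosterman bound saves $m^{1/32}$ when $\gcd \le \sqrt m$. *)
Lemma small_gcd_estimate C K m g : 0 < m -> size (divisors m) ^ 8 <= C * m ->
  2 ^ 8 * C ^ 3 * K ^ 32 <= m -> g ^ 2 <= m ->
  2 * m ^ 3 * size (divisors m) ^ 3 * g * K ^ 4 <= m ^ 4.
Proof.
set d := size _ => m0 hd hm hg.
rewrite -(@leq_exp2r _ _ 8) //.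
have -> : (2 * m ^ 3 * d ^ 3 * g * K ^ 4) ^ 8 =
    2 ^ 8 * m ^ 24 * (d ^ 8) ^ 3 * (g ^ 2) ^ 4 * K ^ 32.
  by rewrite !expnMn -!expnD.
apply: (@leq_trans (2 ^ 8 * m ^ 24 * (C * m) ^ 3 * m ^ 4 * K ^ 32)).
  apply: leq_mul => //; apply: leq_mul (leq_expr 4 hg).
  exact: leq_mul (leqnn _) (leq_expr 3 hd).
have -> : 2 ^ 8 * m ^ 24 * (C * m) ^ 3 * m ^ 4 * K ^ 32 =
    2 ^ 8 * C ^ 3 * K ^ 32 * m ^ 31.
  rewrite expnMn; have -> : m ^ 31 = m ^ 24 * m ^ 3 * m ^ 4 by rewrite -!expnD.
  by move: (2 ^ 8) (m ^ 24) (C ^ 3) (m ^ 3) (m ^ 4) (K ^ 32) => *; ring.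
by rewrite -expnM (expnS m 31) leq_mul2r hm orbT.
Qed.

(** In eighth powers again: $n^8 \le m^4 d(m)^8 \le C m^5$, so the exceptional frequencies number at
    most a constant times $m^{5/8}$. *)
Lemma large_gcd_estimate C K m n : 0 < m -> size (divisors m) ^ 8 <= C * m ->
  K ^ 8 * C <= m -> n ^ 2 <= m * size (divisors m) ^ 2 -> K * n <= m.
Proof.
set d := size _ => m0 hd hm hn.
rewrite -(@leq_exp2r _ _ 8) // expnMn.
have -> : n ^ 8 = (n ^ 2) ^ 4 by rewrite -expnM.
apply: (@leq_trans (K ^ 8 * (m * d ^ 2) ^ 4)); first exact: leq_mul (leqnn _) (leq_expr 4 hn).
rewrite expnMn -expnM; apply: (@leq_trans (K ^ 8 * (m ^ 4 * (C * m)))).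
  apply: leq_mul (leqnn _) _; exact: leq_mul (leqnn _) hd.
have -> : K ^ 8 * (m ^ 4 * (C * m)) = K ^ 8 * C * m ^ 5.
  by rewrite (expnSr m 4); move: (K ^ 8) (m ^ 4) => *; ring.
apply: (@leq_trans (m * m ^ 5)); first by rewrite leq_mul2r hm orbT.
by rewrite -expnS leq_pexp2l.
Qed.

Lemma hyp_count_lower q : 0 < q -> exists M, forall m, M <= m -> forall a l b l',
  l <= m -> l' <= m -> q * totient m * l * l' <= q * m ^ 2 * hyp_count m a l b l' + m ^ 3.
Proof.
move=> q0; have [C C0 hC] := divisors_bound.
(* This is [2 * q] times [192 * q ^ 2]. For a smoothing width [e >= m / (8 * q)] the error
   [3 * m ^ 5] is at most [192 * q ^ 2 * e ^ 2 * m ^ 3], and dividing by [192 * q ^ 2 * e ^ 2]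
   leaves [m ^ 3] beside main terms with factor [2 * q]. *)
pose K := 384 * q ^ 3.
have K0 : 0 < K by rewrite muln_gt0 expn_gt0 q0.
exists (2 + 8 * q + 2 ^ 8 * C ^ 3 * K ^ 32 + K ^ 8 * C) => m.
move: (2 ^ 8 * C ^ 3 * K ^ 32) (K ^ 8 * C) (@small_gcd_estimate C K m) (@large_gcd_estimate C K m).
move=> M1 M2 hM1 hM2 hm a l b l' lm l'm.
have m2 : 1 < m by lia. have m8 : 8 * q <= m by lia.
have {}hM1 g := hM1 g (ltnW m2) (hC m (ltnW m2)) ltac:(lia).
have {}hM2 g := hM2 g (ltnW m2) (hC m (ltnW m2)) ltac:(lia).
have [z zP] := C_prim_root_exists (ltnW m2).
have main e n n' : n + e <= l -> n' + e <= l' ->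
    K * (totient m * n * e * n' * e) <= K * (m ^ 2 * (e ^ 2 * hyp_count m a l b l')) + 3 * m ^ 5.
  case: m m2 {m8 hm} lm l'm hM1 hM2 zP => [|[|p]] // _ lm l'm hM1 hM2 zP nl nl'.
  apply: leq_trans (hyperbola_box (K := K) zP a b hM1 _ _ _ _ _) _; try by lia.
    exact: hM2 _ (sum_large_gcd_le zP).
  by rewrite leq_add2r leq_mul2l leq_mul2l sum_box_le ?orbT.
have tm : totient m <= m.
  rewrite totient_count_coprime -[leqRHS]card_ord -sum1_card big_mkord; apply: leq_sum => i _.
  exact: leq_b1.
(* The smoothing width. Shortening both sides of the box by [e] loses at most [2 * e * m ^ 2], and
   [4 * q * e <= m] keeps this within the error; a box with a side of length at most [e] satisfies
   the claim trivially. *)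
pose e := m %/ (4 * q).
have e1 : 4 * q * e <= m by rewrite mulnC leq_divM.
have e2 : m <= 8 * q * e.
  have : m < 4 * q * e.+1 by rewrite mulnC ltn_ceil // muln_gt0.
  have : 0 < e by rewrite divn_gt0 ?muln_gt0 //; lia.
  by nia.
have [el|/ltnW le] := leqP e l; last first.
  apply: leq_trans (leq_addl _ _); apply: (@leq_trans (q * m * e * m)).
    by rewrite !leq_mul.
  rewrite !expnS expn0 muln1; nia.
have [el'|/ltnW le'] := leqP e l'; last first.
  apply: leq_trans (leq_addl _ _); apply: (@leq_trans (q * m * m * e)).
    by rewrite !leq_mul.
  rewrite !expnS expn0 muln1; nia.
have := main e (l - e) (l' - e); rewrite !subnK // => /(_ (leqnn _) (leqnn _)).
set n := l - e; set n' := l' - e; set H := hyp_count _ _ _ _ _.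
have lE : l = n + e by rewrite subnK.
have l'E : l' = n' + e by rewrite subnK.
have e0 : 0 < e by rewrite divn_gt0 ?muln_gt0 //; lia.
move=> h.
have h1 : 2 * q * (totient m * n * n') <= 2 * q * (m ^ 2 * H) + m ^ 3.
  rewrite -(@leq_pmul2l (192 * q ^ 2 * e ^ 2)) ?muln_gt0 ?expn_gt0 ?q0 ?e0 //.
  have m5 : 3 * m ^ 5 <= 192 * q ^ 2 * e ^ 2 * m ^ 3.
    apply: (@leq_trans (3 * ((8 * q * e) ^ 2 * m ^ 3))).
      by rewrite leq_mul2l (expnD m 2 3) leq_mul2r leq_exp2r // e2 !orbT.
    by rewrite !expnMn; move: (m ^ 3) (q ^ 2) (e ^ 2) => *; lia.
  apply: leq_trans (leq_trans (_ : _ <= K * (totient m * n * e * n' * e)) h) _.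
    by rewrite /K expnSr -mulnn; move: (q ^ 2) (totient m) => *; nia.
  apply: leq_trans (leq_add (leqnn _) m5) _.
  by rewrite /K expnSr -(mulnn e); move: (q ^ 2) (m ^ 2) (m ^ 3) => *; nia.
have h2 : totient m * l * l' <= totient m * n * n' + 2 * e * m ^ 2.
  apply: (@leq_trans (totient m * n * n' + (totient m * e * l' + totient m * n * e))).
    by rewrite lE l'E; nia.
  rewrite leq_add2l -mulnn.
  have : totient m * e * l' <= m * e * m by rewrite !leq_mul.
  have : totient m * n * e <= m * m * e by rewrite !leq_mul // (leq_trans _ lm) // lE leq_addr.
  by nia.
have h3 : 4 * q * e * m ^ 2 <= m ^ 3 by rewrite (expnS m 2) leq_mul2r e1 orbT.
rewrite -(@leq_pmul2l 2) //.
move: h1 (leq_mul (leqnn (2 * q)) h2) h3; move: (m ^ 2) (m ^ 3) (totient m) => m2' m3' f.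
by clear; lia.
Qed.

Local Open Scope classical_set_scope.
Local Open Scope ring_scope.

(** * Coprime pairs and the mean of phi (m) / m *)

Definition coprime_count m a l := (\sum_(i < l) coprime m (a + i))%N.

Lemma coprime_count_add m a l l' :
  (coprime_count m a (l + l') = coprime_count m a l + coprime_count m (a + l) l')%N.
Proof.
rewrite /coprime_count big_split_ord /=; congr (_ + _)%N.
by apply: eq_bigr => i _; rewrite addnA.
Qed.

Lemma coprime_count0 m : coprime_count m 0 m = totient m.
Proof. by rewrite totient_count_coprime big_mkord; apply: eq_bigr. Qed.

Lemma coprime_count_shift m a l : coprime_count m (a + m) l = coprime_count m a l.
Proof. by apply: eq_bigr => i _; rewrite addnAC -coprime_modr modnDr coprime_modr. Qed.

Lemma coprime_count_period m a : coprime_count m a m = totient m.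
Proof.
elim: a => [|a IH]; first exact: coprime_count0.
have E := coprime_count_add m a m 1; have := coprime_count_add m a 1 m.
rewrite addnC E coprime_count_shift IH addn1 [RHS]addnC => /eqP.
by rewrite eqn_add2r => /eqP.
Qed.

Lemma coprime_count_mul m a k : coprime_count m a (k * m) = (k * totient m)%N.
Proof.
elim: k a => [|k IH] a; first by rewrite /coprime_count big_ord0.
by rewrite mulSn coprime_count_add coprime_count_period IH mulSn.
Qed.

Lemma leq_coprime_count m a l : (coprime_count m a l <= l)%N.
Proof.
rewrite -[leqRHS]card_ord -sum1_card; apply: leq_sum => i _; exact: leq_b1.
Qed.

(** Over a full period of [k], the congruence n k = -1 has at most one solution if [n] is a unit and
    none otherwise. Hence lower bounds on the hyperbola are also lower bounds for coprime counts. *)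
Lemma leq_hyp_count_coprime_count m a l : (0 < m)%N ->
  (hyp_count m a l 0 m <= coprime_count m a l)%N.
Proof.
move=> m0; apply: leq_sum => i _; set x := (a + i)%N.
have [cx|cx] := boolP (coprime m x); last first.
  rewrite big1 // => j _; case: (boolP (_ %| _)%N) => //= h; case/negP: cx.
  rewrite /coprime -dvdn1; have := dvdn_trans (dvdn_gcdl m x) h.
  by rewrite dvdn_addr // dvdn_mulr // dvdn_gcdr.
rewrite (sum_bool_card (fun j : 'I_m => m %| x * (0 + j) + 1)%N).
have [/eqP ->//|] := boolP (#|(fun j : 'I_m => m %| x * (0 + j) + 1)%N| == 0)%N.
rewrite -lt0n => /card_gt0P[j0 hj0].
have := card_mul_eq_modn x (x * j0)%N m0; rewrite gcdnC (eqP cx); apply: leq_trans.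
apply: subset_leq_card; apply/fintype.subsetP => j hj; rewrite inE -(eqn_modDr 1).
by move: hj hj0; rewrite !unfold_in !add0n /dvdn => /eqP -> /eqP ->.
Qed.

Section RealBounds.
Variable R : realType.

Definition totient_density m : R := (totient m)%:R / m%:R.
Local Notation w := totient_density.

Lemma totient_density_ge0 m : 0 <= w m.
Proof. by rewrite divr_ge0. Qed.

Lemma totient_density_le1 m : w m <= 1.
Proof.
case: m => [|m]; first by rewrite /w invr0 mulr0.
rewrite ler_pdivrMr ?ltr0n // mul1r ler_nat -(coprime_count0 m.+1); exact: leq_coprime_count.
Qed.

Lemma hyp_count_lower_real (eps : R) : 0 < eps -> exists M, forall m, (M <= m)%N ->
  forall a l b l', (l <= m)%N -> (l' <= m)%N ->
  w m * l%:R * (l'%:R / m%:R) <= (hyp_count m a l b l')%:R + eps * m%:R.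
Proof.
move=> e0; pose q := (Num.truncn eps^-1).+1.
have qe : eps^-1 < q%:R by rewrite truncnS_gt // invr_ge0 ltW.
have [M hM] := hyp_count_lower (isT : 0 < q)%N.
exists M.+1 => m Mm a l b l' lm l'm.
have h : q%:R * (totient m)%:R * l%:R * l'%:R <=
    q%:R * m%:R ^+ 2 * (hyp_count m a l b l')%:R + m%:R ^+ 3 :> R.
  by rewrite -!natrX -!natrM -natrD ler_nat hM // ltnW.
have m0 : 0 < m%:R :> R by rewrite ltr0n (leq_trans _ Mm).
have q0 : 0 < q%:R :> R by rewrite ltr0n.
have qm0 : 0 < q%:R * m%:R ^+ 2 :> R by rewrite mulr_gt0 // exprn_gt0.
rewrite -(ler_pM2l qm0) /w.
have -> : q%:R * m%:R ^+ 2 * ((totient m)%:R / m%:R * l%:R * (l'%:R / m%:R)) =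
  q%:R * (totient m)%:R * l%:R * l'%:R :> R by field; rewrite gt_eqF.
apply: le_trans h _; rewrite mulrDr lerD2l.
have -> : q%:R * m%:R ^+ 2 * (eps * m%:R) = (q%:R * eps) * m%:R ^+ 3 by ring.
rewrite ler_peMl ?exprn_ge0 // ltW // -ltr_pdivrMr // mul1r //.
Qed.

(** The upper estimate is the lower estimate on the complementary part of the period, because a full
    period contains exactly $\phi(m)$ coprime residues. *)
Lemma coprime_count_short (eps : R) : 0 < eps -> exists M, forall m, (M <= m)%N ->
  forall a l, (l <= m)%N -> `|(coprime_count m a l)%:R - w m * l%:R| <= eps * m%:R.
Proof.
move=> e0; have [M hM] := hyp_count_lower_real e0.
exists M.+1 => m Mm.
have m0 : (0 < m)%N by rewrite (leq_trans _ Mm).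
have m0' : m%:R != 0 :> R by rewrite pnatr_eq0 -lt0n.
have low a l : (l <= m)%N -> w m * l%:R <= (coprime_count m a l)%:R + eps * m%:R.
  move=> lm; have := hM m (ltnW Mm) a l 0%N m lm (leqnn m).
  rewrite divff // mulr1 => /le_trans; apply.
  by rewrite lerD2r ler_nat leq_hyp_count_coprime_count.
move=> a l lm; rewrite ler_norml; apply/andP; split; first by have := low a l lm; lra.
have := low (a + l)%N (m - l)%N (leq_subr _ _).
have := coprime_count_add m a l (m - l); rewrite subnKC // coprime_count_period.
move/(congr1 (fun n => n%:R : R)); rewrite natrD natrB // mulrBr => E.
have -> : w m * m%:R = (totient m)%:R by rewrite /w divfK.
by rewrite E; lra.
Qed.

(** Full periods are exact, which leaves an interval shorter than [m]. For [m] below the threshold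
    of [coprime_count_short] the trivial bound applies and is absorbed by [M]. The error does not
    depend on [l]. *)
Lemma coprime_count_approx (eps : R) : 0 < eps -> exists M, forall m, (0 < m)%N ->
  forall a l, `|(coprime_count m a l)%:R - w m * l%:R| <= eps * m%:R + M%:R.
Proof.
move=> e0; have [M hM] := coprime_count_short e0.
exists M => m m0 a l.
have m0' : m%:R != 0 :> R by rewrite pnatr_eq0 -lt0n.
rewrite (divn_eq l m) coprime_count_add coprime_count_mul.
set k := (l %/ m)%N; set r := (l %% m)%N.
have rm : (r <= m)%N by rewrite ltnW // ltn_pmod.
have -> : ((k * totient m + coprime_count m (a + k * m) r)%N%:R - w m * (k * m + r)%N%:R =
    (coprime_count m (a + k * m) r)%:R - w m * r%:R).
  rewrite !natrD !natrM mulrDr.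
  have -> : w m * (k%:R * m%:R) = k%:R * (totient m)%:R by rewrite mulrCA /w divfK.
  by ring.
have [Mm|mM] := leqP M m; first by rewrite ler_wpDr // hM.
apply: ler_wpDl; first by rewrite mulr_ge0 // ltW.
have rM : r%:R <= M%:R :> R by rewrite ler_nat (leq_trans rm) // ltnW.
have c1 : (coprime_count m (a + k * m) r)%:R <= r%:R :> R by rewrite ler_nat leq_coprime_count.
have w0 : 0 <= w m * r%:R by rewrite mulr_ge0 // totient_density_ge0.
have w1 : w m * r%:R <= r%:R by rewrite ler_piMl // totient_density_le1.
have c0 : 0 <= (coprime_count m (a + k * m) r)%:R :> R by [].
by rewrite ler_norml; apply/andP; split; lra.
Qed.

Definition totient_sum a l : R := \sum_(i < l) w (a + i).

Definition totient_mean T : R := totient_sum 1 T / T%:R.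

(* Both sides count the coprime pairs in ]a, a + l] x [1, T], by rows and by columns. *)
Lemma totient_mean_interval (eps : R) (K : nat) : 0 < eps ->
  exists T0, forall T, (T0 <= T)%N -> forall a l, (a + l <= K * T)%N ->
  `|totient_sum a.+1 l - totient_mean T * l%:R| <= eps * T%:R.
Proof.
move=> e0; set K' : R := K%:R + 1.
have K0 : 0 < K' by rewrite /K' ltr_wpDl.
(* Four error terms arise, two from the rows and two from the columns; with this [e1] and the
   threshold on [T] each is at most $eps T^2 / 4$. *)
pose e1 := eps / (4 * K' ^+ 2).
have e10 : 0 < e1 by rewrite divr_gt0 // mulr_gt0 // exprn_gt0.
have [M hM] := coprime_count_approx e10.
exists (Num.truncn (4 * K' * M%:R / eps)).+1 => T TT a l alK.
have T1 : 4 * K' * M%:R / eps < T%:R.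
  apply: lt_le_trans (truncnS_gt _) _; last by rewrite ler_nat.
have T0 : 0 < T%:R :> R by rewrite ltr0n (leq_trans _ TT).
pose C := (\sum_(i < l) \sum_(j < T) coprime (a.+1 + i) (1 + j))%N.
have alR : a%:R + l%:R <= K%:R * T%:R :> R by rewrite -natrD -natrM ler_nat.
have a0 : 0 <= a%:R :> R by [].
have l0 : 0 <= l%:R :> R by [].
have C1 : `|C%:R - T%:R * totient_sum a.+1 l| <= l%:R * (e1 * (K' * T%:R) + M%:R).
  rewrite natr_sum mulr_sumr -sumrB.
  apply: le_trans (ler_norm_sum _ _ _) _.
  apply: (@le_trans _ _ (\sum_(i < l) (e1 * (K' * T%:R) + M%:R))); last first.
    by rewrite sumr_const card_ord mulr_natl.
  apply: ler_sum => i _; rewrite [T%:R * _]mulrC.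
  apply: le_trans (hM _ _ _ _) _ => //.
  rewrite lerD2r ler_wpM2l ?(ltW e10) //.
  have : (a.+1 + i)%:R <= (a + l)%:R :> R by rewrite ler_nat addSnnS leq_add2l.
  by rewrite natrD /K'; nra.
have C2 : `|C%:R - l%:R * totient_sum 1 T| <= T%:R * (e1 * T%:R + M%:R).
  rewrite /C exchange_big natr_sum mulr_sumr -sumrB.
  apply: le_trans (ler_norm_sum _ _ _) _.
  apply: (@le_trans _ _ (\sum_(i < T) (e1 * T%:R + M%:R))); last first.
    by rewrite sumr_const card_ord mulr_natl.
  apply: ler_sum => i _; rewrite [l%:R * _]mulrC.
  have -> : (\sum_(i0 < l) coprime (a.+1 + i0) (1 + i) = coprime_count (1 + i) a.+1 l)%N.
    by apply: eq_bigr => j _; rewrite coprime_sym.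
  apply: le_trans (hM _ _ _ _) _ => //.
  by rewrite lerD2r ler_wpM2l ?(ltW e10) // ler_nat.
rewrite -(ler_pM2l T0) -[T%:R in X in X * _ <= _](ger0_norm (ltW T0)) -normrM.
have -> : T%:R * (totient_sum a.+1 l - totient_mean T * l%:R) =
  (C%:R - l%:R * totient_sum 1 T) - (C%:R - T%:R * totient_sum a.+1 l).
  by rewrite /totient_mean; field; rewrite gt_eqF.
apply: le_trans (ler_normB _ _) _; apply: le_trans (lerD C2 C1) _.
have lT : l%:R <= K' * T%:R by rewrite /K'; nra.
apply: (@le_trans _ _ (T%:R * (e1 * T%:R + M%:R) + K' * T%:R * (e1 * (K' * T%:R) + M%:R))).
  by rewrite lerD2l ler_wpM2r // addr_ge0 // mulr_ge0 ?(ltW e10) // mulr_ge0 ?(ltW K0).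
have Me : 4 * K' * M%:R <= eps * T%:R by rewrite ltW // [ltRHS]mulrC -ltr_pdivrMr.
have K1 : 1 <= K' by rewrite /K' lerDr.
have e1E : 4 * (e1 * K' ^+ 2) = eps by rewrite /e1; field; rewrite gt_eqF.
have M0 : 0 <= M%:R :> R by [].
have -> : T%:R * (e1 * T%:R + M%:R) + K' * T%:R * (e1 * (K' * T%:R) + M%:R) =
  T%:R * (e1 * T%:R + M%:R + K' * (e1 * (K' * T%:R) + M%:R)) by ring.
rewrite ler_wpM2l //.
have h1 : 4 * (e1 * T%:R) <= eps * T%:R.
  have eK : e1 <= e1 * K' ^+ 2 by rewrite ler_peMr ?(ltW e10) // exprn_ege1.
  by rewrite -e1E mulrA ler_wpM2r // ler_wpM2l.
have h2 : 4 * (K' * (e1 * (K' * T%:R))) = eps * T%:R by rewrite -e1E; ring.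
have h3 : M%:R <= K' * M%:R by rewrite ler_peMl.
rewrite mulrDr; lra.
Qed.

(** Telescoping with $1/d^2 \le 1/(d-1) - 1/d$ from d = 3 on. The term 1/4 at d = 2 is kept exact:
    telescoping it too would give the bound 1, which leaves nothing for the coprime pairs. *)
Lemma sum_inv_sqr_le n : \sum_(2 <= d < n.+3) (d%:R ^+ 2)^-1 <= 3 / 4 - n.+2%:R^-1 :> R.
Proof.
elim: n => [|n IH]; first by rewrite big_nat1; lra.
rewrite big_nat_recr //=; apply: le_trans (lerD IH (lexx _)) _.
have x0 : 0 < n%:R + 2 :> R by rewrite ltr_wpDl.
have -> : n.+2%:R = n%:R + 2 :> R by rewrite -addn2 natrD.
have -> : n.+3%:R = n%:R + 3 :> R by rewrite -addn3 natrD.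
rewrite -lerBrDl -subr_ge0; set x := n%:R in x0 *.
have -> : 3 / 4 - (x + 3)^-1 - (3 / 4 - (x + 2)^-1) - ((x + 3) ^+ 2)^-1 =
  ((x + 2) * (x + 3) ^+ 2)^-1.
  by field; rewrite !gt_eqF //; lra.
by rewrite invr_ge0 mulr_ge0 ?(ltW x0) // exprn_ge0 //; lra.
Qed.

(* A pair that is not coprime has a common divisor d >= 2, and the sum of 1 / d ^ 2 over
   d >= 2 is at most 3 / 4. *)
Lemma coprime_pairs_lower T :
  T%:R ^+ 2 / 4 <= (\sum_(i < T) \sum_(j < T) coprime (1 + i) (1 + j))%N%:R :> R.
Proof.
have dvd_count d : (\sum_(i < T) (d %| 1 + i) = T %/ d)%N.
  by rewrite divn_count_dvd big_add1 big_mkord; apply: eq_bigr.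
have H : (T ^ 2 <= \sum_(i < T) \sum_(j < T) coprime (1 + i) (1 + j) +
    \sum_(2 <= d < T.+1) (T %/ d) ^ 2)%N.
  have -> : (\sum_(2 <= d < T.+1) (T %/ d) ^ 2 =
      \sum_(i < T) \sum_(j < T) \sum_(2 <= d < T.+1) (d %| 1 + i) * (d %| 1 + j))%N.
    under [RHS]eq_bigr do rewrite exchange_big.
    rewrite exchange_big; apply: eq_bigr => d _.
    by rewrite -mulnn -{1}dvd_count big_distrl; apply: eq_bigr => i _; rewrite -dvd_count big_distrr.
  rewrite -mulnn -{1 2}[T]card_ord -sum_nat_const -big_split; apply: leq_sum => i _ /=.
  rewrite -sum1_card -big_split; apply: leq_sum => j _ /=.
  have [//|cij] := boolP (coprime _ _).
  set g := gcdn (1 + i) (1 + j).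
  have g0 : (0 < g)%N by rewrite gcdn_gt0.
  have gT : (g <= T)%N by apply: leq_trans (dvdn_leq _ (dvdn_gcdl _ _)) _.
  rewrite (big_cat_nat (n := g)) //=; last 2 first.
  - by rewrite ltn_neqAle eq_sym cij.
  - exact: leqW.
  have gi : (g %| 1 + i)%N := dvdn_gcdl _ _; have gj : (g %| 1 + j)%N := dvdn_gcdr _ _.
  by rewrite (@big_ltn _ _ _ g) // gi gj add0n addnCA leq_addr.
have {}H : T%:R ^+ 2 <= (\sum_(i < T) \sum_(j < T) coprime (1 + i) (1 + j))%N%:R +
    \sum_(2 <= d < T.+1) (T %/ d)%:R ^+ 2 :> R.
  rewrite -natrX; apply: le_trans (_ : _ <= (_ + _)%N%:R) _; first by rewrite ler_nat; exact: H.
  by rewrite natrD lerD2l natr_sum; under eq_bigr do rewrite natrX.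
suff : \sum_(2 <= d < T.+1) (T %/ d)%:R ^+ 2 <= T%:R ^+ 2 * (3 / 4) :> R by lra.
apply: (@le_trans _ _ (T%:R ^+ 2 * \sum_(2 <= d < T.+1) (d%:R ^+ 2)^-1)).
  rewrite mulr_sumr big_nat [leRHS]big_nat; apply: ler_sum => d /andP[d2 _].
  have d0 : 0 < d%:R :> R by rewrite ltr0n (leq_trans _ d2).
  by rewrite -exprVn -exprMn lerXn2r ?nnegrE ?divr_ge0 // ler_pdivlMr // -natrM ler_nat leq_divM.
rewrite ler_wpM2l ?exprn_ge0 //.
case: T {H dvd_count} => [|[|T]]; [rewrite big_geq //; lra|rewrite big_geq //; lra|].
apply: le_trans (sum_inv_sqr_le T) _.
by rewrite lerBlDr lerDl invr_ge0.
Qed.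

(** The proportion 1/4 of coprime pairs, less 1/16 for the relative error and 1/16 for [M / T]. *)
Lemma totient_mean_lower : exists T0, forall T, (T0 <= T)%N -> 1 / 8 <= totient_mean T.
Proof.
have [M hM] := coprime_count_approx (ltac:(lra) : 0 < 1 / 16 :> R).
exists (16 * M).+1 => T MT.
have T0 : 0 < T%:R :> R by rewrite ltr0n (leq_trans _ MT).
have MT' : 16 * M%:R <= T%:R :> R by rewrite -natrM ler_nat ltnW.
have C1 := coprime_pairs_lower T.
have C2 : (\sum_(i < T) \sum_(j < T) coprime (1 + i) (1 + j))%N%:R <=
    T%:R * totient_sum 1 T + T%:R * (1 / 16 * T%:R + M%:R) :> R.
  rewrite natr_sum mulr_sumr.
  apply: (@le_trans _ _ (\sum_(i < T) (T%:R * w (1 + i) + (1 / 16 * T%:R + M%:R)))); last first.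
    by rewrite big_split /= sumr_const card_ord (mulr_natl _ T).
  apply: ler_sum => i _.
  have := ler_normlW (hM (1 + i)%N isT 1%N T).
  rewrite -/(coprime_count (1 + i) 1 T) [T%:R * _]mulrC.
  have : (1 + i)%:R <= T%:R :> R by rewrite ler_nat.
  by lra.
rewrite /totient_mean ler_pdivlMr // -(ler_pM2l T0).
by nra.
Qed.
End RealBounds.

(** * Farey successors *)

Section Lattice.
Variable R : realType.
Implicit Types (u v w : R * R) (L : set (R * R)).

Lemma pair_mulrz v (n : int) : v *~ n = (n%:~R * v.1, n%:~R * v.2).
Proof.
have E k : v *+ k = (k%:R * v.1, k%:R * v.2).
  elim: k => [|k IH]; first by rewrite !mul0r mulr0n.
  by rewrite mulrS IH -!natr1 !mulrDl !mul1r addrC /=; case: v {IH}.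
case: n => k; first by rewrite -pmulrn E.
by rewrite NegzE mulrNz -!pmulrn E mulrNz -!pmulrn !mulNr.
Qed.

Lemma det2D v w w' : det2 v (w + w') = det2 v w + det2 v w'.
Proof. by rewrite /det2 /=; ring. Qed.

Lemma det2C v w : det2 w v = - det2 v w.
Proof. by rewrite /det2; ring. Qed.

Lemma det2vv v : det2 v v = 0.
Proof. by rewrite /det2; ring. Qed.

Lemma det2Z v w (n : int) : det2 v (w *~ n) = n%:~R * det2 v w.
Proof. by rewrite pair_mulrz /det2 /=; ring. Qed.

Lemma det2_expand u w v : det2 u w = 1 ->
  v.1 = det2 v w * u.1 + det2 u v * w.1 /\ v.2 = det2 v w * u.2 + det2 u v * w.2.
Proof. by rewrite /det2 => h; split; rewrite -[LHS]mul1r -h; ring. Qed.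

Section Unimodular.
Variables (L : set (R * R)) (hL : unimodular_lattice L).

Lemma lattice_basis : exists u w, det2 u w = 1 /\ L = lattice_span u w.
Proof.
have [u [w [d LE]]] := hL.
have [d0|d0] := lerP 0 (det2 u w).
  by exists u, w; split => //; rewrite -d ger0_norm.
exists w, u; split => //; first by rewrite det2C -d ltr0_norm.
by rewrite LE; apply/seteqP; split => v [m [n ->]]; exists n, m; rewrite addrC.
Qed.

Lemma lattice_comb v w (m n : int) : L v -> L w -> L (v *~ m + w *~ n).
Proof.
have [u [u' [_ ->]]] := hL => -[a [b ->]] [c [d ->]].
exists (a * m + c * n), (b * m + d * n).
by rewrite !pair_mulrz; congr pair; rewrite /= !intrD !intrM; ring.
Qed.

Lemma lattice_det2 v w : L v -> L w -> exists n : int, det2 v w = n%:~R.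
Proof.
have [u [u' [d ->]]] := lattice_basis => -[a [b ->]] [c [e ->]].
exists (a * e - b * c); rewrite !pair_mulrz intrB !intrM -[RHS]mulr1 -d /det2 /=; ring.
Qed.

(** If r v lies in the lattice then r = det (r v, w) is an integer, hence 0 when it lies in [0,
    1). *)
Lemma primitive_of_det2 v w : L v -> L w -> det2 v w = 1 -> primitive_points L v.
Proof.
move=> Lv Lw d; split => //.
  by apply/eqP => v0; move: d; rewrite v0 /det2 /= !mul0r subr0 => /esym/eqP; rewrite oner_eq0.
move=> r /andP[r0 r1] /lattice_det2 /(_ Lw)[n].
have -> : det2 (r * v.1, r * v.2) w = r by rewrite -[RHS]mulr1 -d /det2 /=; ring.
move=> rn; suff -> : r = 0 by rewrite !mul0r.
rewrite rn in r0 r1 *; rewrite (_ : n = 0) //; apply/eqP.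
by move: r0 r1; rewrite ler0z (ltrz1 _ n); lia.
Qed.

(** The coordinates of [v] in a basis are coprime: otherwise v divided by their gcd would be a
    lattice point on the segment. A Bezout relation then gives the coordinates of [w]. *)
Lemma primitive_complement v : primitive_points L v -> exists2 w, L w & det2 v w = 1.
Proof.
have [u [u' [d LE]]] := lattice_basis; case; rewrite {1}LE => -[x [y vE]] v0 vp.
have Lu : L u by rewrite LE; exists 1, 0; rewrite mulr1z mulr0z addr0.
have Lu' : L u' by rewrite LE; exists 0, 1; rewrite mulr1z mulr0z add0r.
have [a [b ab]] := Bezoutz x y.
have g0 : gcdz x y != 0.
  apply: contra v0; rewrite gcdz_eq0 => /andP[/eqP x0 /eqP y0].
  by rewrite vE x0 y0 !mulr0z addr0.
suff g1 : gcdz x y = 1.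
  exists (u *~ (- b) + u' *~ a); first exact: lattice_comb.
  have : a%:~R * x%:~R + b%:~R * y%:~R = 1 :> R by rewrite -!intrM -intrD ab g1.
  move=> h; transitivity ((a%:~R * x%:~R + b%:~R * y%:~R) * det2 u u').
    by rewrite vE !pair_mulrz /det2 /= mulrNz; ring.
  by rewrite h d mulr1.
have /dvdzP[x' xE] := dvdz_gcdl x y; have /dvdzP[y' yE] := dvdz_gcdr x y.
set g := gcdz x y in g0 xE yE *.
have gge0 : 0 <= g by [].
apply/eqP; apply: contraT => g1; case/eqP: v0.
have g2 : 1 < g by lia.
have gR : 1 < g%:~R :> R by rewrite ltr1z.
have gn0 : g%:~R != 0 :> R by rewrite intr_eq0.
have rE : (g%:~R^-1 * v.1, g%:~R^-1 * v.2) = u *~ x' + u' *~ y'.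
  rewrite vE xE yE !pair_mulrz; congr pair; rewrite /= !intrM; field; exact: gn0.
have := vp g%:~R^-1; rewrite rE LE invr_ge0 invf_lt1 ?(lt_trans ltr01) // gR ler0z gge0.
move=> /(_ isT) h; have {h} : u *~ x' + u' *~ y' = 0 by apply: h; exists x', y'.
rewrite -rE => -[/eqP + /eqP]; rewrite !mulf_eq0 invr_eq0 (negPf gn0) /= => /eqP v1 /eqP v2.
by rewrite [LHS]surjective_pairing v1 v2.
Qed.

Lemma slope_diff v w : v.1 != 0 -> w.1 != 0 -> slope w - slope v = det2 v w / (v.1 * w.1).
Proof. by move=> v0 w0; rewrite /slope /det2; field; rewrite v0 w0. Qed.

Lemma slope_lt v w : 0 < v.1 -> 0 < w.1 -> (slope v < slope w) = (0 < det2 v w).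
Proof.
move=> v0 w0; rewrite -subr_gt0 slope_diff ?gt_eqF // pmulr_lgt0 //.
by rewrite invr_gt0 mulr_gt0.
Qed.

Lemma slope_le v w : 0 < v.1 -> 0 < w.1 -> (slope v <= slope w) = (0 <= det2 v w).
Proof.
move=> v0 w0; rewrite -subr_ge0 slope_diff ?gt_eqF // pmulr_lge0 //.
by rewrite invr_gt0 mulr_gt0.
Qed.

(** Parallel primitive vectors are integer multiples of each other; the two multipliers have product
    1, and positive abscissas exclude -1. *)
Lemma primitive_slope_inj v w : primitive_points L v -> primitive_points L w ->
  0 < v.1 -> 0 < w.1 -> slope v = slope w -> v = w.
Proof.
move=> pv pw v0 w0 svw.
have d0 : det2 v w = 0.
  by apply/eqP; rewrite eq_le -slope_le // -oppr_ge0 -det2C -slope_le // svw lexx.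
have [z Lz dz] := primitive_complement pv; have [z' Lz' dz'] := primitive_complement pw.
have [Lv _ _] := pv; have [Lw _ _] := pw.
have [n nE] := lattice_det2 Lw Lz; have [n' nE'] := lattice_det2 Lv Lz'.
have [w1 w2] := det2_expand w dz; have [v1 v2] := det2_expand v dz'.
rewrite d0 !mul0r !addr0 nE in w1 w2.
rewrite (det2C v w) d0 oppr0 !mul0r !addr0 nE' in v1 v2.
have nn : n' * n = 1.
  apply/eqP; rewrite -(eqr_int R) intrM; apply/eqP.
  by apply: (mulIf (lt0r_neq0 v0)); rewrite mul1r -mulrA -w1 -v1.
have npos : 0 < n by rewrite -(ltr0z R) -(pmulr_lgt0 _ v0) -w1.
have n1 : n = 1.
  have : (n %| 1)%Z by apply/dvdzP; exists n'.
  by rewrite dvdz1; lia.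
rewrite n1 mulr1z mul1r in w1; rewrite n1 mulr1z mul1r in w2.
by rewrite [LHS]surjective_pairing -w1 -w2 -surjective_pairing.
Qed.

Section Next.
Variable tau : R.

(** A lattice vector [u] of slope strictly between is u = det (u, w) v + det (v, u) w with both
    coefficients at least 1, so its abscissa is at least v.1 + w.1, which exceeds [tau]. *)
Lemma farey_next_eq v w : farey L tau v -> L w -> det2 v w = 1 ->
  tau - v.1 < w.1 <= tau -> farey_next L tau v = w.
Proof.
move=> [pv /andP[v0 vt]] Lw d /andP[wt wle].
have [Lv _ _] := pv.
have w0 : 0 < w.1 by apply: le_lt_trans wt; rewrite subr_ge0.
have pw : primitive_points L w.
  apply: (@primitive_of_det2 w (v *~ (- 1) + w *~ 0)) => //; first exact: lattice_comb.
  by rewrite mulr0z addr0 det2Z det2C d mulrNz mulr1z mulN1r opprK.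
have svw : slope v < slope w by rewrite slope_lt // d ltr01.
have wmin u : farey L tau u -> slope v < slope u -> slope w <= slope u.
  move=> [[Lu _ _] /andP[u0 ut]]; rewrite slope_lt // => du.
  rewrite leNgt slope_lt //; apply/negP => duw.
  have [u1 _] := det2_expand u d.
  have [n nE] := lattice_det2 Lv Lu; have [n' nE'] := lattice_det2 Lu Lw.
  have n1 : 1 <= det2 v u by rewrite nE ler1z -gtz0_ge1 -(ltr0z R) -nE.
  have n1' : 1 <= det2 u w by rewrite nE' ler1z -gtz0_ge1 -(ltr0z R) -nE'.
  have : v.1 + w.1 <= u.1.
    by rewrite u1 lerD // ler_peMl // ltW.
  by move: wt ut; lra.
rewrite /farey_next; apply: xget_unique => [|y [[py /andP[y0 yt]] svy ymin]].
  by split => //; split => //; rewrite w0.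
have [w1 _ _ ] := pw.
apply: primitive_slope_inj => //; apply/eqP; rewrite eq_le ymin ?wmin //.
  by split => //; rewrite y0.
by split => //; rewrite w0.
Qed.

Lemma farey_nextP v (w := farey_next L tau v) : farey L tau v ->
  [/\ farey L tau w, det2 v w = 1 & tau - v.1 < w.1].
Proof.
move=> fv; have [pv /andP[v0 vt]] := fv; have [Lv _ _] := pv.
have [z Lz dz] := primitive_complement pv.
(* The translates of [z] by multiples of [v] keep determinant 1 with [v], and exactly one of them
   has its abscissa in the window ]tau - v.1, tau]. *)
pose k := Num.floor ((tau - z.1) / v.1).
pose x := z *~ 1 + v *~ k.
have Lx : L x by exact: lattice_comb.
have dx : det2 v x = 1 by rewrite det2D !det2Z det2vv dz mulr0 addr0 mulr1z mulr1.
have x1 : x.1 = z.1 + k%:~R * v.1 by rewrite /x !pair_mulrz /= mul1r.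
have /andP[k1 k2] := floor_itv ((tau - z.1) / v.1).
have xle : x.1 <= tau.
  by rewrite x1 -lerBrDl -ler_pdivlMr.
have xgt : tau - v.1 < x.1.
  move: k2; rewrite ltr_pdivrMr // intrD mulrDl mul1r -/k x1; lra.
have wE : w = x by apply: farey_next_eq => //; rewrite xgt.
have x0 : 0 < x.1 by apply: le_lt_trans xgt; rewrite subr_ge0.
rewrite wE; split => //; split; last by rewrite x0.
apply: (@primitive_of_det2 x (v *~ (- 1) + x *~ 0)) => //; first exact: lattice_comb.
by rewrite mulr0z addr0 det2Z det2C dx mulrNz mulr1z mulN1r opprK.
Qed.

Definition farey_pair v : R * R := (v.1 / tau, (farey_next L tau v).1 / tau).

(** Since det (v, w) = det (w, w') = 1, one has w' = c w - v with c = det (v, w') an integer. The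
    window for w'.1 has length w.1, so it determines [c], and [c] is the floor in the BCZ map. *)
Lemma BCZ_farey_pair v : 0 < tau -> farey L tau v ->
  BCZ (farey_pair v) = farey_pair (farey_next L tau v).
Proof.
move=> t0 fv; rewrite /farey_pair /BCZ /=; set w := farey_next L tau v; set w' := farey_next _ _ w.
have [fw dvw wgt] := farey_nextP fv; rewrite -/w in fw dvw wgt.
have [fw' dww' wgt'] := farey_nextP fw; rewrite -/w' in fw' dww' wgt'.
have [[Lv _ _] /andP[v0 vt]] := fv; have [[Lw _ _] /andP[w0 wt]] := fw.
have [[Lw' _ _] /andP[w0' wt']] := fw'.
have [c cE] := lattice_det2 Lv Lw'.
have e : w'.1 = c%:~R * w.1 - v.1.
  by rewrite -cE; have [-> _] := det2_expand w' dvw; rewrite (det2C w w') dww'; ring.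
congr pair; have -> : Num.floor ((1 + v.1 / tau) / (w.1 / tau)) = c.
  apply: floor_def; have -> : (1 + v.1 / tau) / (w.1 / tau) = (tau + v.1) / w.1.
    by field; rewrite !gt_eqF.
  rewrite ler_pdivlMr // ltr_pdivrMr // intrD mulrDl mul1r.
  by apply/andP; split; lra.
by rewrite e; ring.
Qed.

End Next.
End Unimodular.
End Lattice.

(** * The measures rho as counting measures *)

Lemma absz_shift (x : int) (B : nat) : - B%:Z < x < B%:Z ->
  (absz (x + B%:Z)%R < B.*2)%N /\ (absz (x + B%:Z))%:Z - B%:Z = x.
Proof. by lia. Qed.

Section FareySeq.
Variables (R : realType) (L : set (R * R)) (hL : unimodular_lattice L).
Implicit Types (u v w : R * R) (I : set R).

(** Bounded slope and bounded abscissa bound the vector, hence its integer coordinates det (v, w)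
    and det (u, v). These are shifted by [B] to become indices below [B.*2]. *)
Lemma farey_in_finite I a b tau : I `<=` `[a, b] -> finite_set (farey_in L I tau).
Proof.
move=> Iab; have [u [w [d LE]]] := lattice_basis hL.
pose S := `|a| + `|b|.
pose B := (Num.truncn (tau * (S * (`|u.1| + `|w.1|) + (`|u.2| + `|w.2|)))).+1.
pose g (p : nat * nat) := u *~ (p.1%:Z - B%:Z) + w *~ (p.2%:Z - B%:Z).
apply: (@sub_finite_set _ _ (g @` (`I_(B.*2) `*` `I_(B.*2)))); last first.
  by apply: finite_image; apply: finite_setX; apply: finite_II.
move=> v [[[Lv _ _] /andP[v0 vt]] /Iab]; rewrite /= in_itv /= => /andP[sa sb].
have t0 : 0 < tau by exact: lt_le_trans vt.
have v2E : v.2 = slope v * v.1 by rewrite /slope divfK ?gt_eqF.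
have sS : `|slope v| <= S.
  have := ler_norm b; have := ler_norm (- a); rewrite normrN /S => h1 h2.
  have ha := normr_ge0 a; have hb := normr_ge0 b.
  by rewrite ler_norml; apply/andP; split; lra.
have v1B : `|v.1| <= tau by rewrite gtr0_norm.
have v2B : `|v.2| <= tau * S.
  by rewrite v2E normrM mulrC ler_pM.
have Lu : L u by rewrite LE; exists 1, 0; rewrite mulr1z mulr0z addr0.
have Lw : L w by rewrite LE; exists 0, 1; rewrite mulr1z mulr0z add0r.
have [x xE] := lattice_det2 hL Lv Lw; have [y yE] := lattice_det2 hL Lu Lv.
have BT : tau * (S * (`|u.1| + `|w.1|) + (`|u.2| + `|w.2|)) < B%:R by exact: truncnS_gt.
have S0 : 0 <= S by rewrite addr_ge0.
have bnd (z : R * R) : `|z.1| <= `|u.1| + `|w.1| -> `|z.2| <= `|u.2| + `|w.2| ->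
    `|det2 v z| < B%:R.
  move=> z1 z2; apply: le_lt_trans BT; rewrite /det2 -[v.1 * _ - _]addrC.
  apply: le_trans (ler_normD _ _) _; rewrite normrN !normrM mulrDr mulrA.
  by apply: lerD; apply: ler_pM.
have bz (z : int) : `|z%:~R : R| < B%:R -> (- B%:Z < z < B%:Z).
  by rewrite -intr_norm -[B%:R]/(B%:Z%:~R) ltr_int ltr_norml.
have /bz/absz_shift[xB xE'] : `|x%:~R : R| < B%:R.
  by rewrite -xE; apply: bnd; rewrite lerDr.
have /bz/absz_shift[yB yE'] : `|y%:~R : R| < B%:R.
  by rewrite -yE det2C normrN; apply: bnd; rewrite lerDl.
exists (absz (x + B%:Z), absz (y + B%:Z)).
  by split.
have [v1 v2] := det2_expand v d.
rewrite /g /= xE' yE'.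
by rewrite [RHS]surjective_pairing v1 v2 xE yE !pair_mulrz.
Qed.

Lemma mem_farey_seq I a b tau v : I `<=` `[a, b] ->
  (v \in farey_seq L I tau) = `[< farey_in L I tau v >].
Proof.
by move=> /(farey_in_finite tau) fI; rewrite mem_sort in_fset_set.
Qed.

Lemma farey_seq_uniq I tau : uniq (farey_seq L I tau).
Proof. by rewrite sort_uniq fset_uniq. Qed.

Lemma farey_seq_sorted I tau : sorted (fun u v => slope u <= slope v) (farey_seq L I tau).
Proof. by apply: sort_sorted => u v; exact: le_total. Qed.

Lemma farey_pt_succ a b tau i (s := farey_seq L `[a, b] tau) : (i < size s)%N ->
  farey_pt L `[a, b] tau i.+1 = farey_next L tau (nth 0 s i).
Proof.
move=> iN; rewrite /farey_pt -/s.
have memP v : (v \in s) = `[< farey_in L `[a, b] tau v >] by by rewrite (@mem_farey_seq `[a, b] a b).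
have [iN'|iN'] := ltnP i.+1 (size s); last first.
  (* At the last index the point is the default value of [nth], which is by definition the successor
     of the last element. *)
  rewrite nth_default //; congr farey_next.
  by rewrite -nth_last (_ : (size s).-1 = i) //; lia.
rewrite (set_nth_default 0) //; symmetry.
set v := nth 0 s i; set w := nth 0 s i.+1.
have vs : v \in s by rewrite mem_nth.
have ws : w \in s by rewrite mem_nth.
have mono j k : (j <= k)%N -> (k < size s)%N -> slope (nth 0 s j) <= slope (nth 0 s k).
  move=> jk ks; have tr : transitive (fun u v : R * R => slope u <= slope v).
    by move=> ? ? ?; exact: le_trans.
  apply: (sorted_leq_nth tr) => //; first exact: farey_seq_sorted.
  by rewrite inE (leq_ltn_trans jk).
have /asboolP[[pv /andP[v0 vt]] Iv] : `[< farey_in L `[a, b] tau v >] by rewrite -memP.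
have /asboolP[[pw /andP[w0 wt]] Iw] : `[< farey_in L `[a, b] tau w >] by rewrite -memP.
have vw : slope v < slope w.
  rewrite lt_neqAle mono // andbT; apply/eqP => /(primitive_slope_inj hL pv pw v0 w0)/eqP.
  by rewrite /v /w nth_uniq ?farey_seq_uniq // ltn_eqF.
have wmin u : farey L tau u -> slope v < slope u -> slope w <= slope u.
  move=> fu vu; rewrite leNgt; apply/negP => uw.
  have us : u \in s.
    rewrite memP; apply/asboolP; split => //=; move: Iv Iw; rewrite /= !in_itv /=.
    by move=> /andP[av _] /andP[_ wb]; rewrite (le_trans av (ltW vu)) (le_trans (ltW uw) wb).
  move: vu uw; rewrite -(nth_index 0 us).
  have js : (index u s < size s)%N by rewrite index_mem.
  have [ji|ij] := leqP (index u s) i.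
    by move=> h; have := mono _ _ ji (ltnW iN'); rewrite leNgt h.
  by move=> _ h; have := mono _ _ ij js; rewrite leNgt h.
apply: xget_unique => [|y [fy vy ymin]]; first by split => //; split => //; rewrite w0.
have [fw fy'] : farey L tau w /\ farey L tau y by split => //; split => //; rewrite w0.
have [py /andP[y0 _]] := fy.
by apply: (primitive_slope_inj hL) => //; apply/eqP; rewrite eq_le ymin ?wmin.
Qed.

Lemma iter_BCZ_farey a b tau i (s := farey_seq L `[a, b] tau) : 0 < tau -> (i < size s)%N ->
  iter i (@BCZ R) ((farey_pt L `[a, b] tau 0).1 / tau, (farey_pt L `[a, b] tau 1).1 / tau) =
  farey_pair L tau (nth 0 s i).
Proof.
move=> t0; elim: i => [|i IH] iN.
  by rewrite /= farey_pt_succ // /farey_pair /farey_pt -/s (set_nth_default 0).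
rewrite iterS IH 1?ltnW // BCZ_farey_pair //; last first.
  have si : nth 0 s i \in s by rewrite mem_nth // ltnW.
  have /asboolP[//] : `[< farey_in L `[a, b] tau (nth 0 s i) >].
  by rewrite -(@mem_farey_seq `[a, b] a b).
by rewrite -farey_pt_succ 1?ltnW // /farey_pt -/s (set_nth_default 0).
Qed.

(** From here on the orbit of the BCZ map is replaced by a count over the Farey vectors. *)
Lemma rhoE a b tau (A : set (R * R)) (s := farey_seq L `[a, b] tau) : 0 < tau ->
  rho L `[a, b] tau A =
  (((size s)%:R^-1)%:E * (count (fun v => `[< A (farey_pair L tau v) >]) s)%:R%:E)%E.
Proof.
move=> t0; rewrite /rho /mscale /= /msum /=; congr (_ * _)%E.
rewrite -sum1_count big_mkcond (big_nth 0) big_mkord natr_sum -sumEFin.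
apply: eq_bigr => i _; rewrite iter_BCZ_farey // diracE.
Qed.

End FareySeq.

(** * Local counts *)

Lemma big_iota_ord (a l : nat) (F : nat -> nat) :
  (\sum_(m <- iota a l) F m = \sum_(i < l) F (a + i))%N.
Proof.
rewrite -[a in iota a]addn0 iotaDl big_map -(big_mkord xpredT (fun i => F (a + i)%N)).
by rewrite /index_iota subn0.
Qed.

Lemma size_filter_iota (a l : nat) (P : pred nat) :
  size [seq n <- iota a l | P n] = (\sum_(i < l) P (a + i))%N.
Proof.
rewrite size_filter -sum1_count big_mkcond big_iota_ord.
by apply: eq_bigr => i _; case: (P _).
Qed.

Section Counting.
Variables (R : realType) (L : set (R * R)) (hL : unimodular_lattice L).
Implicit Types (u v w : R * R) (I : set R).

(** The line of slope [s] must pass strictly between [u] and [w]. A quarter turn (u, w) -> (w, -u)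
    moves [w] off the line, a change of both signs puts it above, and subtracting a large multiple
    of [w] from [u] puts [u] below. *)
Lemma lattice_cone (s : R) : exists u w,
  [/\ L u, L w, det2 u w = 1, 0 < w.2 - w.1 * s & 0 < u.1 * s - u.2].
Proof.
have [u0 [w0 [d0 LE]]] := lattice_basis hL.
have Lu0 : L u0 by rewrite LE; exists 1, 0; rewrite mulr1z mulr0z addr0.
have Lw0 : L w0 by rewrite LE; exists 0, 1; rewrite mulr1z mulr0z add0r.
have neg v : L v -> L (- v.1, - v.2).
  move=> Lv; have := lattice_comb hL (-1) 0 Lv Lv.
  by rewrite mulr0z addr0 pair_mulrz mulrN1z !mulN1r.
have [u1 [w1 [Lu1 Lw1 d1 m1]]] : exists u w, [/\ L u, L w, det2 u w = 1 & w.2 - w.1 * s != 0].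
  have [m0|] := eqVneq (w0.2 - w0.1 * s) 0; last by exists u0, w0.
  exists w0, (- u0.1, - u0.2); split => //=; first exact: neg.
    by rewrite -d0 /det2 /=; ring.
  apply/eqP => n0; have : det2 u0 w0 = 0.
    have -> : det2 u0 w0 = u0.1 * (w0.2 - w0.1 * s) + w0.1 * (- u0.2 - - u0.1 * s).
      by rewrite /det2; ring.
    by rewrite m0 n0 !mulr0 addr0.
  by rewrite d0 => /eqP; rewrite oner_eq0.
have [u2 [w2 [Lu2 Lw2 d2 m2]]] : exists u w, [/\ L u, L w, det2 u w = 1 & 0 < w.2 - w.1 * s].
  have [m0|m0|m0] := ltgtP 0 (w1.2 - w1.1 * s); first by exists u1, w1.
    exists (- u1.1, - u1.2), (- w1.1, - w1.2); split; try exact: neg.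
      by rewrite -d1 /det2 /=; ring.
    by rewrite /=; lra.
  by move: m1; rewrite -m0 eqxx.
set mu := w2.2 - w2.1 * s in m2.
pose k := (Num.truncn ((1 + `|u2.1 * s - u2.2|) / mu)).+1.
have hk : (1 + `|u2.1 * s - u2.2|) < k%:R * mu.
  by rewrite -ltr_pdivrMr // truncnS_gt.
exists (u2 *~ 1 + w2 *~ (- k%:Z)), w2; split => //.
- exact: lattice_comb.
- by rewrite det2C det2D !det2Z det2vv mulr0 addr0 mulr1z mul1r -det2C.
- rewrite !pair_mulrz /= !mul1r mulrNz -pmulrn.
  have -> : (u2.1 + - k%:R * w2.1) * s - (u2.2 + - k%:R * w2.2) =
    (u2.1 * s - u2.2) + k%:R * mu by rewrite /mu; ring.
  by have := ler_norm (- (u2.1 * s - u2.2)); rewrite normrN; lra.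
Qed.

Definition farey_count I tau (P : R * R -> Prop) : nat :=
  count (fun v => `[< P v >]) (farey_seq L I tau).

Lemma farey_count_le_size I a b tau P (T : eqType) (f : R * R -> T) (s : seq T) :
  I `<=` `[a, b] ->
  (forall v v', farey_in L I tau v -> farey_in L I tau v' -> f v = f v' -> v = v') ->
  (forall v, farey_in L I tau v -> P v -> f v \in s) ->
  (farey_count I tau P <= size s)%N.
Proof.
move=> Iab fi fs; rewrite /farey_count -size_filter -(size_map f).
have mE v : v \in [seq v <- farey_seq L I tau | `[< P v >]] -> farey_in L I tau v /\ P v.
  by rewrite mem_filter (mem_farey_seq hL _ _ Iab) => /andP[/asboolP ? /asboolP ?].
apply: uniq_leq_size => [|x /mapP[v /mE[vI vP] ->]]; last exact: fs.
rewrite map_inj_in_uniq ?filter_uniq ?farey_seq_uniq // => v v' /mE[h _] /mE[h' _].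
exact: fi.
Qed.

Lemma size_le_farey_count I a b tau P (T : eqType) (f : T -> R * R) (s : seq T) :
  I `<=` `[a, b] -> uniq s -> {in s &, injective f} ->
  (forall x, x \in s -> farey_in L I tau (f x) /\ P (f x)) ->
  (size s <= farey_count I tau P)%N.
Proof.
move=> Iab us fi fs; rewrite /farey_count -size_filter -(size_map f).
apply: uniq_leq_size => [|v /mapP[x /fs[xI xP] ->]]; first by rewrite map_inj_in_uniq.
rewrite mem_filter (mem_farey_seq hL _ _ Iab).
by apply/andP; split; apply/asboolP.
Qed.

End Counting.

Lemma quadratic_dominates (R : realType) (A B e : R) : 0 < e ->
  exists2 tau0, 0 < tau0 & forall tau, tau0 <= tau -> A * tau + B <= e * tau ^+ 2.
Proof.
move=> e0; exists (1 + (`|A| + `|B|) / e) => [|tau ht].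
  by rewrite ltr_pwDl // divr_ge0 ?addr_ge0 // ltW.
have t1 : 1 <= tau by apply: le_trans ht; rewrite lerDl divr_ge0 ?addr_ge0 // ltW.
have h : `|A| + `|B| <= e * tau.
  by rewrite mulrC -ler_pdivrMr // (le_trans _ ht) // lerDr.
have hA := ler_norm A; have hB := ler_norm B; have B0 := normr_ge0 B; have A0 := normr_ge0 A.
apply: (@le_trans _ _ ((`|A| + `|B|) * tau)).
  rewrite mulrDl lerD //; first by rewrite ler_wpM2r // (le_trans _ t1).
  by rewrite (le_trans hB) // ler_peMr.
by rewrite expr2 mulrA ler_wpM2r // (le_trans _ t1).
Qed.

Definition hyp_list m a l b l' : seq (nat * nat) :=
  [seq p <- [seq (n, k) | n <- iota a l, k <- iota b l'] | (m %| p.1 * p.2 + 1)%N].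

Lemma size_hyp_list m a l b l' : size (hyp_list m a l b l') = hyp_count m a l b l'.
Proof.
rewrite size_filter -sum1_count big_mkcond big_allpairs big_iota_ord.
apply: eq_bigr => i _; rewrite big_iota_ord; apply: eq_bigr => j _ /=.
by case: (_ %| _)%N.
Qed.

Lemma uniq_pairs_dep (T1 T2 : eqType) (s : seq T1) (g : T1 -> seq T2) :
  uniq s -> (forall x, uniq (g x)) -> uniq [seq (x, y) | x <- s, y <- g x].
Proof.
move=> us ug; apply: allpairs_uniq_dep => //.
by move=> [x y] [x' y'] _ _ /= [-> ->].
Qed.

Lemma iota_bound (a b m : nat) : (a < m)%N -> (m < a.+1 + (b - a))%N -> (m <= b)%N.
Proof. lia. Qed.

Lemma truncn_diff (R : realType) (x y : R) : 0 <= x -> x <= y ->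
  y - x - 1 <= (Num.truncn y - Num.truncn x)%N%:R <= y - x + 1.
Proof.
move=> x0 xy; have /andP[a b] := truncn_itv x0.
have /andP[c d] := truncn_itv (le_trans x0 xy).
rewrite natrB; last by rewrite le_truncn.
rewrite -natr1 in b; rewrite -natr1 in d.
by apply/andP; split; lra.
Qed.

(** One modulus [m]: [n] takes [l], about m D, values. Losing 1 in this number costs at most d l' /
    m, hence at most 1. *)
Lemma cell_term_lower (R : realType) (d D l l' m H e X : R) :
  0 <= d <= 1 -> m * D - 1 <= l -> 0 <= l' <= m -> 0 < m ->
  d * l * (l' / m) <= H + e * m -> m <= X -> 0 <= e ->
  D * l' * d - (1 + e * X) <= H.
Proof.
move=> /andP[d0 d1] mD /andP[l'0 l'm] m0 h mX e0.
have f0 : 0 <= l' / m by rewrite divr_ge0 // ltW.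
have f1 : l' / m <= 1 by rewrite ler_pdivrMr // mul1r.
have g1 : d * (m * D - 1) * (l' / m) <= d * l * (l' / m).
  by rewrite ler_wpM2r // ler_wpM2l.
have g2 : d * (m * D - 1) * (l' / m) = D * l' * d - d * (l' / m).
  by field; rewrite gt_eqF.
have g3 : d * (l' / m) <= 1 by rewrite mulr_ile1.
have g4 : e * m <= e * X by rewrite ler_wpM2l.
by lra.
Qed.

(** Bookkeeping for [farey_count_cell_lower]: [k] is the mean of phi (m) / m, [S] its sum over the
    range of [m], [a * t] and [b * t] are the lengths of the ranges of [m] and of det (v', w), and
    [c * t] bounds [m]. The error is spread over portions e / 4. *)
Lemma cell_sum_lower (R : realType) (k a b c D e e1 e2 l l' S H t : R) :
  0 <= k <= 1 -> 0 <= D -> 0 < a -> 0 < b -> 0 < c -> 0 < t -> 0 < e -> 0 < e1 -> 0 < e2 ->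
  3 <= b * t -> 1 <= a * t -> a * t - 1 <= l -> l <= c * t -> b * t - 3 <= l' -> l' <= b * t ->
  k * l - e2 * t <= S -> D * l' * S - l * (1 + e1 * (c * t)) <= H ->
  D * b * e2 <= e / 4 -> e1 * c ^+ 2 <= e / 4 ->
  (D * (3 * a + b) + c) * t <= e / 4 * t ^+ 2 ->
  (k * (D * a * b) - e) * t ^+ 2 <= H.
Proof.
move=> /andP[k0 k1] D0 a0 b0 c0 t0 e0 e10 e20 bt at1 llo lup l'lo l'up hS hH h2 h1 hq.
have l'0 : 0 <= l' by apply: le_trans l'lo; rewrite subr_ge0.
have f1 : D * l' * (k * l - e2 * t) <= D * l' * S by rewrite ler_wpM2l // mulr_ge0.
have f2 : l * (1 + e1 * (c * t)) <= c * t * (1 + e1 * (c * t)).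
  by rewrite ler_wpM2r // addr_ge0 // !mulr_ge0 // ltW.
have f3 : D * k * ((b * t - 3) * (a * t - 1)) <= D * k * (l' * l).
  by rewrite ler_wpM2l ?(mulr_ge0 D0 k0) // ler_pM // subr_ge0.
have f4 : D * l' * (e2 * t) <= D * (b * t) * (e2 * t).
  by rewrite ler_wpM2r ?(mulr_ge0 (ltW e20) (ltW t0)) // ler_wpM2l.
have sq0 : 0 <= t ^+ 2 by rewrite exprn_ge0 // ltW.
have f6 : D * b * e2 * t ^+ 2 <= e / 4 * t ^+ 2 by rewrite ler_wpM2r.
have f7 : e1 * c ^+ 2 * t ^+ 2 <= e / 4 * t ^+ 2 by rewrite ler_wpM2r.
have f8 : k * (D * (3 * a + b) * t) <= D * (3 * a + b) * t.
  by rewrite ler_piMl // mulr_ge0 ?(ltW t0) // mulr_ge0 // addr_ge0 ?(ltW b0) // mulr_ge0 // ltW.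
have f9 : 0 <= D * k * 3 by rewrite !mulr_ge0.
have i7 : 0 <= e / 4 * t ^+ 2 by rewrite mulr_ge0 // divr_ge0 // ltW.
have {f1 f3 f4 hH} : k * (D * a * b) * t ^+ 2 - k * (D * (3 * a + b) * t) + D * k * 3
    - D * b * e2 * t ^+ 2 - c * t * (1 + e1 * (c * t)) <= H.
  have -> : k * (D * a * b) * t ^+ 2 - k * (D * (3 * a + b) * t) + D * k * 3 =
     D * k * ((b * t - 3) * (a * t - 1)) by ring.
  have -> : D * b * e2 * t ^+ 2 = D * (b * t) * (e2 * t) by ring.
  have i1 : D * l' * (k * l - e2 * t) = D * k * (l' * l) - D * l' * (e2 * t) by ring.
  by rewrite i1 in f1; move: f1 f2 f3 f4 hH; clear; lra.
have -> : c * t * (1 + e1 * (c * t)) = c * t + e1 * c ^+ 2 * t ^+ 2 by ring.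
have -> : (k * (D * a * b) - e) * t ^+ 2 = k * (D * a * b) * t ^+ 2 -
  (e / 4 * t ^+ 2 + e / 4 * t ^+ 2 + e / 4 * t ^+ 2 + e / 4 * t ^+ 2) by field.
have i5 : (D * (3 * a + b) + c) * t = D * (3 * a + b) * t + c * t by ring.
rewrite i5 in hq.
by move: f6 f7 f8 f9 i7 hq; clear; lra.
Qed.

Section Counting.
Variables (R : realType) (L : set (R * R)) (hL : unimodular_lattice L).
Implicit Types (u v w : R * R) (I : set R).

Definition mean_at (tau : R) : R := totient_mean R (Num.truncn tau).

Lemma totient_mean_le1 T : totient_mean R T <= 1.
Proof.
rewrite /totient_mean; have [->|T0] := posnP T; first by rewrite invr0 mulr0.
rewrite ler_pdivrMr ?ltr0n // mul1r /totient_sum.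
apply: (@le_trans _ _ (\sum_(i < T) 1)); last by rewrite sumr_const card_ord.
by apply: ler_sum => i _; apply: totient_density_le1.
Qed.

Lemma totient_mean_ge0 T : 0 <= totient_mean R T.
Proof.
rewrite /totient_mean divr_ge0 // sumr_ge0 // => i _; exact: totient_density_ge0.
Qed.

Lemma mean_at_interval (c e : R) : 0 <= c -> 0 < e -> exists tau0, forall tau, tau0 <= tau ->
  forall a l, (a + l)%:R <= c * tau -> `|totient_sum R a.+1 l - mean_at tau * l%:R| <= e * tau.
Proof.
(* The factor 2 pays for the truncation: [tau] is at most twice its integer part. *)
move=> c0 e0; pose K := (Num.truncn (2 * c)).+1.
have [T0 hT] := totient_mean_interval K e0.
exists (T0.+1%:R + 1) => tau ht a l alc.
have t0 : 0 <= tau by rewrite (le_trans _ ht) // addr_ge0.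
have /andP[T1 T2] := truncn_itv t0.
have TT : T0.+1%:R < (Num.truncn tau).+1%:R :> R by lra.
rewrite ltr_nat ltnS in TT.
apply: le_trans (hT _ (ltnW TT) _ _ _) _; last by rewrite ler_wpM2l ?(ltW e0).
rewrite -(ler_nat R); apply: le_trans alc _; rewrite natrM.
have hK : 2 * c < K%:R by exact: truncnS_gt.
have T11 : 1 <= (Num.truncn tau)%:R :> R by rewrite ler1n (leq_trans _ TT).
rewrite -natr1 in T2; apply: (@le_trans _ _ (c * (2 * (Num.truncn tau)%:R))).
  by rewrite ler_wpM2l //; lra.
by rewrite mulrA [c * 2]mulrC ler_wpM2r // ltW.
Qed.

Lemma mean_at_lower : exists tau0, forall tau, tau0 <= tau -> 1 / 8 <= mean_at tau.
Proof.
have [T0 hT] := totient_mean_lower R; exists T0%:R => tau ht; apply: hT.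
by rewrite truncn_ge_nat // (le_trans _ ht).
Qed.

(** * Counts over one short slope interval *)

Section Cell.
Variables (u w : R * R) (M eta s1 s2 : R).
Hypotheses (Lu : L u) (Lw : L w) (duw : det2 u w = 1).
Hypotheses (M0 : 0 < M) (eta0 : 0 < eta) (eta1 : eta <= 1 / 4) (s12 : s1 < s2).
(** A vector [v] of slope [s] has det (v, w) = v.1 * mu s and det (u, v) = v.1 * nu s; hence [t]
    gives the ratio n / m as a function of the slope. On the interval [mu] equals [M] up to a factor
    1 ± eta. *)
Let mu s := w.2 - w.1 * s.
Let nu s := u.1 * s - u.2.
Hypothesis muM : forall s, s1 <= s <= s2 -> (1 - eta) * M <= mu s <= (1 + eta) * M.
Hypothesis nu0 : forall s, s1 <= s <= s2 -> 0 < nu s.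
Let t s := nu s / mu s.

Let mu0 s : s1 <= s <= s2 -> 0 < mu s.
Proof. move=> /muM/andP[+ _]; apply: lt_le_trans; rewrite mulr_gt0 //; have := eta1; lra. Qed.

Let s1i : s1 <= s1 <= s2. Proof. by rewrite lexx ltW. Qed.
Let s2i : s1 <= s2 <= s2. Proof. by rewrite lexx ltW. Qed.

Let t_le s s' : s1 <= s <= s2 -> s1 <= s' <= s2 -> s <= s' -> t s <= t s'.
Proof.
move=> hs hs' ss'; rewrite -subr_ge0.
(* [t] is a Moebius map of determinant 1. *)
have -> : t s' - t s = (s' - s) / (mu s * mu s').
  rewrite -[X in X / _]mul1r -duw /t /det2 /nu /mu; field.
  by rewrite !gt_eqF // ?mu0.
by rewrite divr_ge0 ?subr_ge0 // mulr_ge0 ?ltW ?mu0.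
Qed.

(** [v] is determined by (m, n). The abscissa confines [m] to a range widened by [eta], the slope
    confines n / m to [t s1, t s2], and primitivity makes [m] and [n] coprime. *)
Lemma farey_count_cell_le tau x1 x2
    (A := Num.truncn (x1 * (1 - eta) * M * tau))
    (B := Num.truncn (x2 * (1 + eta) * M * tau)) :
  0 < tau -> 0 <= x1 -> x1 <= x2 ->
  (farey_count L `[s1, s2] tau (fun v => (x1 * tau < v.1 <= x2 * tau)%R) <=
   \sum_(i < B - A) coprime_count (A.+1 + i) (Num.truncn ((A.+1 + i)%:R * t s1))
     (Num.truncn ((A.+1 + i)%:R * t s2) - Num.truncn ((A.+1 + i)%:R * t s1)).+1)%N.
Proof.
move=> t0 x10 x12.
pose a m := Num.truncn (m%:R * t s1).
pose l m := (Num.truncn (m%:R * t s2) - Num.truncn (m%:R * t s1)).+1.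
pose s := [seq (m, n) | m <- iota A.+1 (B - A), n <- [seq n <- iota (a m) (l m) | coprime m n]].
have <- : size s = (\sum_(i < B - A) coprime_count (A.+1 + i) (a (A.+1 + i)) (l (A.+1 + i)))%N.
  rewrite size_allpairs_dep sumnE big_map big_iota_ord; apply: eq_bigr => i _.
  by rewrite size_filter_iota.
pose f v : nat * nat := (Num.truncn (det2 v w), Num.truncn (det2 u v)).
have coord v : farey_in L `[s1, s2] tau v ->
    [/\ det2 v w = (f v).1%:R, det2 u v = (f v).2%:R, 0 < v.1, det2 v w = v.1 * mu (slope v) &
       det2 u v = v.1 * nu (slope v)].
  move=> [[[Lv _ _] /andP[v0 _]]]; rewrite /= in_itv /= => sI.
  have v2E : v.2 = slope v * v.1 by rewrite /slope divfK ?gt_eqF.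
  have e1 : det2 v w = v.1 * mu (slope v) by rewrite /det2 /mu v2E; ring.
  have e2 : det2 u v = v.1 * nu (slope v) by rewrite /det2 /nu v2E; ring.
  have p1 : 0 < det2 v w by rewrite e1 mulr_gt0 // mu0.
  have p2 : 0 < det2 u v by rewrite e2 mulr_gt0 // nu0.
  have nat_of x : 0 < x -> (exists n : int, x = n%:~R) -> x = (Num.truncn x)%:R.
    move=> x0 [[n|n] xE]; first by rewrite xE natrK.
    by move: x0; rewrite xE ltr0z.
  by split => //=; apply: nat_of => //; exact: (lattice_det2 hL).
apply: (@farey_count_le_size _ _ hL _ s1 s2 _ _ _ f) => // [v v' hv hv' fE|v hv hx].
  have [c1 c2 _ _ _] := coord v hv; have [c1' c2' _ _ _] := coord v' hv'.
  have [v1 v2] := det2_expand v duw; have [v1' v2'] := det2_expand v' duw.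
  by rewrite [LHS]surjective_pairing [RHS]surjective_pairing v1 v2 v1' v2' c1 c2 c1' c2' fE.
have [c1 c2 v0 e1 e2] := coord v hv.
have [pv sv] := hv; have {}sv : s1 <= slope v <= s2 by move: sv; rewrite /= in_itv.
have /andP[hx1 hx2] := hx.
have /andP[m1 m2] := muM sv.
set m := (f v).1 in c1; set n := (f v).2 in c2.
have mR1 : x1 * (1 - eta) * M * tau < m%:R.
  have -> : x1 * (1 - eta) * M * tau = x1 * tau * ((1 - eta) * M) by ring.
  rewrite -c1 e1; apply: (@lt_le_trans _ _ (v.1 * ((1 - eta) * M))).
    by rewrite ltr_pM2r // mulr_gt0 //; have := eta1; lra.
  by rewrite ler_wpM2l // ltW.
have mR2 : m%:R <= x2 * (1 + eta) * M * tau.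
  have -> : x2 * (1 + eta) * M * tau = x2 * tau * ((1 + eta) * M) by ring.
  rewrite -c1 e1; apply: (@le_trans _ _ (v.1 * ((1 + eta) * M))).
    by rewrite ler_wpM2l // ltW.
  by rewrite ler_wpM2r // mulr_ge0 ?(ltW M0) //; have := eta0; lra.
have nm : n%:R = m%:R * t (slope v).
  by rewrite -c1 -c2 e1 e2 /t; field; rewrite gt_eqF // mu0.
have m0 : 0 <= m%:R :> R by [].
have t1 : m%:R * t s1 <= n%:R by rewrite nm ler_wpM2l // t_le //; case/andP: sv.
have t2 : n%:R <= m%:R * t s2 by rewrite nm ler_wpM2l // t_le //; case/andP: sv.
have tpos x : s1 <= x <= s2 -> 0 <= m%:R * t x.
  by move=> hx'; rewrite mulr_ge0 // divr_ge0 // ltW ?nu0 ?mu0.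
have X1 : 0 <= x1 * (1 - eta) * M * tau.
  by rewrite !mulr_ge0 ?(ltW M0) ?(ltW t0) //; have := eta1; lra.
have n1 : (Num.truncn (m%:R * t s1) <= n)%N.
  by rewrite -(ler_nat R) (le_trans _ t1) // truncn_le tpos.
have n2 : (n <= Num.truncn (m%:R * t s2))%N by rewrite truncn_ge_nat // tpos.
have m1' : (A < m)%N by rewrite truncn_lt_nat.
have m2' : (m <= B)%N.
  by rewrite truncn_ge_nat // (le_trans _ mR2).
apply/allpairsPdep; exists m, n; split => //.
  by rewrite mem_iota m1' addSn subnKC ?ltnS // (leq_trans (ltnW m1') m2').
rewrite mem_filter mem_iota; apply/andP; split; last first.
  by rewrite /a /l n1 /= addnS ltnS subnKC // (leq_trans n1 n2).
(* Written in the basis (u, w), det (v, g) = 1 is a Bezout relation between [m] and [n]. *)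
have [g Lg dg] := primitive_complement hL pv.1.
have [p pE] := lattice_det2 hL Lu Lg; have [q qE] := lattice_det2 hL Lw Lg.
rewrite -[m]/(absz m) -[n]/(absz n); apply/coprimezP; exists (p, q) => /=.
apply/eqP; rewrite -(eqr_int R) intrD !intrM -pE -qE; apply/eqP.
rewrite -[RHS]dg; have [v1 v2] := det2_expand v duw.
by rewrite /det2 v1 v2 c1 c2 /det2 -!pmulrn; ring.
Qed.

(** The number of [n] for one [m] is about phi (m) times the length of the range of [t]. Bounding
    the factor [m] by its maximum [c2 * tau] loses little, because the bound is later applied to
    thin slabs of abscissas. *)
Lemma farey_count_cell_upper x1 x2 e
    (c1 := x1 * (1 - eta) * M) (c2 := x2 * (1 + eta) * M) :
  0 <= x1 -> x1 <= x2 -> 0 < e -> exists tau0, forall tau, tau0 <= tau ->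
  (farey_count L `[s1, s2] tau (fun v => (x1 * tau < v.1 <= x2 * tau)%R))%:R <=
    (mean_at tau * (c2 * (c2 - c1) * (t s2 - t s1)) + e) * tau ^+ 2.
Proof.
move=> x10 x12 e0; set D := t s2 - t s1.
have D0 : 0 <= D by rewrite subr_ge0 t_le // ltW.
have c10 : 0 <= c1 by rewrite !mulr_ge0 ?(ltW M0) //; have := eta1; lra.
have c12 : c1 <= c2.
  by rewrite ler_pM2r // ler_pM //; have := eta0; have := eta1; lra.
have c20 := le_trans c10 c12.
pose e1 := e / 3 / (c2 ^+ 2 + 1).
have e10 : 0 < e1 by rewrite !divr_gt0 // ltr_wpDl // exprn_ge0.
have e1c : e1 * c2 ^+ 2 <= e / 3.
  have : e1 * (c2 ^+ 2 + 1) = e / 3 by rewrite divfK // gt_eqF // ltr_wpDl // exprn_ge0.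
  by rewrite mulrDr; lra.
pose e2 := e / 3 / (c2 * D + 1).
have e20 : 0 < e2 by rewrite !divr_gt0 // ltr_wpDl // mulr_ge0.
have e2c : c2 * D * e2 <= e / 3.
  have : e2 * (c2 * D + 1) = e / 3 by rewrite divfK // gt_eqF // ltr_wpDl // mulr_ge0.
  by rewrite mulrDr mulrC; lra.
have [N hN] := coprime_count_approx e10.
have [T1 hT1] := mean_at_interval c20 e20.
have e30 : 0 < e / 3 by rewrite divr_gt0.
have [T2 T20 hT2] := quadratic_dominates (c2 * D + c2 * (2 + N%:R) + e1 * c2) (2 + N%:R) e30.
exists (Num.max T1 T2) => tau; rewrite ge_max => /andP[tT1 tT2].
have t0 : 0 < tau by apply: lt_le_trans tT2.
have := farey_count_cell_le t0 x10 x12; rewrite -/c1 -/c2.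
set A := Num.truncn (c1 * tau); set B := Num.truncn (c2 * tau); set l := (B - A)%N => le1.
have c1t : 0 <= c1 * tau by rewrite mulr_ge0 // ltW.
have c2t : 0 <= c2 * tau by rewrite mulr_ge0 // ltW.
have /andP[A1 A2] := truncn_itv c1t; have /andP[B1 B2] := truncn_itv c2t.
rewrite -/A -/B -natr1 in A1 A2 B1 B2.
have AB : (A <= B)%N by rewrite le_truncn // ler_wpM2r // ltW.
have lE : l%:R = B%:R - A%:R :> R by rewrite natrB.
have llt : l%:R <= (c2 - c1) * tau + 1 by rewrite lE; lra.
have k0 := totient_mean_ge0 (Num.truncn tau); have k1 := totient_mean_le1 (Num.truncn tau).
rewrite -/(mean_at tau) in k0 k1.
have S1 : totient_sum R A.+1 l <= mean_at tau * l%:R + e2 * tau.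
  have := hT1 _ tT1 A l; rewrite subnKC // => /(_ B1); rewrite ler_norml => /andP[_]; lra.
have S0 : 0 <= totient_sum R A.+1 l by rewrite sumr_ge0 // => i _; apply: totient_density_ge0.
have term i : (i < l)%N -> (coprime_count (A.+1 + i) (Num.truncn ((A.+1 + i)%:R * t s1))
     (Num.truncn ((A.+1 + i)%:R * t s2) - Num.truncn ((A.+1 + i)%:R * t s1)).+1)%:R <=
    c2 * D * tau * totient_density R (A.+1 + i) + (2 + N%:R + e1 * (c2 * tau)).
  move=> il; set m := (A.+1 + i)%N.
  have mB : m%:R <= c2 * tau.
    by apply: le_trans B1; rewrite ler_nat /m addSn -ltn_subRL.
  have m0 : 0 <= m%:R :> R by [].
  have tp x : s1 <= x <= s2 -> 0 <= m%:R * t x.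
    by move=> hx; rewrite mulr_ge0 // divr_ge0 // ltW ?nu0 ?mu0.
  have /andP[a1 a2] := truncn_itv (tp _ s1i); have /andP[b1 b2] := truncn_itv (tp _ s2i).
  rewrite -natr1 in a2.
  set a := Num.truncn _ in a1 a2 *; set b := Num.truncn _ in b1 b2 *.
  have ab : (a <= b)%N by rewrite le_truncn // ler_wpM2l // t_le // ltW.
  have := ler_normlW (hN m isT a (b - a).+1).
  have w0 := totient_density_ge0 R m; have w1 := totient_density_le1 R m.
  have lm : (b - a).+1%:R <= m%:R * D + 2.
    by rewrite -natr1 natrB // /D mulrBr; lra.
  have h1 : totient_density R m * (b - a).+1%:R <= totient_density R m * (m%:R * D + 2).
    by rewrite ler_wpM2l.
  have h2 : totient_density R m * (m%:R * D) <= c2 * D * tau * totient_density R m.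
    rewrite [leRHS]mulrC ler_wpM2l // -mulrA [D * _]mulrC mulrA ler_wpM2r //.
  have h3 : e1 * m%:R <= e1 * (c2 * tau) by rewrite ler_wpM2l // ltW.
  by rewrite mulrDr in h1; lra.
have total : (\sum_(i < l) coprime_count (A.+1 + i) (Num.truncn ((A.+1 + i)%:R * t s1))
     (Num.truncn ((A.+1 + i)%:R * t s2) - Num.truncn ((A.+1 + i)%:R * t s1)).+1)%N%:R <=
    c2 * D * tau * totient_sum R A.+1 l + l%:R * (2 + N%:R + e1 * (c2 * tau)).
  rewrite natr_sum /totient_sum mulr_sumr mulr_natl -[X in _ *+ X]card_ord.
  rewrite -sumr_const -big_split /=; apply: ler_sum => i _; exact: term.
rewrite -(ler_nat R) in le1; apply: le_trans le1 _; apply: le_trans total _.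
have Dt0 : 0 <= c2 * D * tau by rewrite mulr_ge0 ?(ltW t0) // mulr_ge0.
apply: (@le_trans _ _ (c2 * D * tau * (mean_at tau * ((c2 - c1) * tau + 1) + e2 * tau) +
   (c2 * tau + 1) * (2 + N%:R + e1 * (c2 * tau)))).
  apply: lerD.
    by rewrite ler_wpM2l // (le_trans S1) // lerD2r ler_wpM2l.
  rewrite ler_wpM2r //; first by rewrite addr_ge0 // mulr_ge0 // ltW.
  by apply: le_trans llt _; rewrite lerD2r ler_wpM2r ?(ltW t0) // lerBlDr lerDl.
have h0 := hT2 _ tT2.
have h1 : c2 * D * tau * mean_at tau <= c2 * D * tau by rewrite ler_piMr.
have h2 : c2 * D * e2 * tau ^+ 2 <= e / 3 * tau ^+ 2 by rewrite ler_wpM2r // exprn_ge0 // ltW.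
have h3 : e1 * c2 ^+ 2 * tau ^+ 2 <= e / 3 * tau ^+ 2 by rewrite ler_wpM2r // exprn_ge0 // ltW.
have -> : c2 * D * tau * (mean_at tau * ((c2 - c1) * tau + 1) + e2 * tau) +
   (c2 * tau + 1) * (2 + N%:R + e1 * (c2 * tau)) =
   mean_at tau * (c2 * (c2 - c1) * D) * tau ^+ 2 + c2 * D * tau * mean_at tau +
   c2 * D * e2 * tau ^+ 2 + e1 * c2 ^+ 2 * tau ^+ 2 +
   (c2 * (2 + N%:R) + e1 * c2) * tau + (2 + N%:R) by ring.
rewrite [leRHS]mulrDl.
have -> : e * tau ^+ 2 = e / 3 * tau ^+ 2 + e / 3 * tau ^+ 2 + e / 3 * tau ^+ 2 by field.
have h4 : (c2 * D + c2 * (2 + N%:R) + e1 * c2) * tau =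
  c2 * D * tau + (c2 * (2 + N%:R) + e1 * c2) * tau by ring.
rewrite h4 in h0.
by lra.
Qed.

(** From n k + 1 = n' m the vector v' = k u + n' w has determinant 1 with [v], and v'.1 * mu (slope
    v) = k + w.1 / v.1. The last fraction is at most 1 in absolute value, whence the margins ± 1 for
    [k]. The condition [1 <= x1 + y1] gives v.1 + v'.1 > tau, which makes v' the successor. *)
Lemma farey_vector_cell tau x1 x2 y1 y2 (m n k : nat) (v := u *~ m + w *~ n) :
  0 < tau -> 0 < x1 -> x2 <= 1 -> 0 < y1 -> y2 <= 1 -> 1 <= x1 + y1 ->
  `|w.1| <= x1 * tau ->
  x1 * (1 + eta) * M * tau < m%:R -> m%:R <= x2 * (1 - eta) * M * tau ->
  m%:R * t s1 < n%:R -> n%:R <= m%:R * t s2 ->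
  y1 * (1 + eta) * M * tau + 1 < k%:R -> k%:R <= y2 * (1 - eta) * M * tau - 1 ->
  (m %| n * k + 1)%N ->
  [/\ farey_in L `]s1, s2] tau v,
      det2 v w = m%:R, det2 u v = n%:R, det2 (farey_next L tau v) w = k%:R &
      x1 * tau < v.1 <= x2 * tau /\ y1 * tau < (farey_next L tau v).1 <= y2 * tau].
Proof.
move=> t0 x10 x21 y10 y21 xy wx m1 m2 n1 n2 k1 k2 mnk.
have m0 : 0 < m%:R :> R.
  by apply: le_lt_trans m1; rewrite !mulr_ge0 ?(ltW t0) ?(ltW x10) ?(ltW M0) //; have := eta0; lra.
have vE1 : v.1 = m%:R * u.1 + n%:R * w.1 by rewrite /v !pair_mulrz.
have vE2 : v.2 = m%:R * u.2 + n%:R * w.2 by rewrite /v !pair_mulrz.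
have dvw : det2 v w = m%:R.
  by rewrite /det2 vE1 vE2 -[RHS]mulr1 -duw /det2; ring.
have duv : det2 u v = n%:R.
  by rewrite /det2 vE1 vE2 -[RHS]mulr1 -duw /det2; ring.
have Lv : L v by exact: lattice_comb.
have p1 := mu0 s1i; have p2 := mu0 s2i.
have A1 : 0 < v.2 - s1 * v.1.
  have -> : v.2 - s1 * v.1 = n%:R * mu s1 - m%:R * nu s1 by rewrite vE1 vE2 /mu /nu; ring.
  by rewrite subr_gt0 -ltr_pdivrMr // -mulrA.
have A2 : 0 <= s2 * v.1 - v.2.
  have -> : s2 * v.1 - v.2 = m%:R * nu s2 - n%:R * mu s2 by rewrite vE1 vE2 /mu /nu; ring.
  by rewrite subr_ge0 -ler_pdivlMr // -mulrA.
have v0 : 0 < v.1.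
  have : 0 < (s2 - s1) * v.1 by lra.
  by rewrite pmulr_rgt0 // subr_gt0.
have sl1 : s1 < slope v by rewrite /slope ltr_pdivlMr //; lra.
have sl2 : slope v <= s2 by rewrite /slope ler_pdivrMr //; lra.
have sI : s1 <= slope v <= s2 by rewrite sl2 ltW.
have v2E : v.2 = slope v * v.1 by rewrite /slope divfK ?gt_eqF.
have mE : m%:R = v.1 * mu (slope v) by rewrite -dvw /det2 /mu v2E; ring.
have mu1 := mu0 sI.
have /andP[muA muB] := muM sI.
have eM0 : 0 < (1 - eta) * M by rewrite mulr_gt0 //; have := eta1; lra.
have pM0 : 0 < (1 + eta) * M by rewrite mulr_gt0 //; have := eta0; lra.
have hx1 : x1 * tau < v.1.
  rewrite -(ltr_pM2r pM0); apply: (@lt_le_trans _ _ m%:R); last by rewrite mE ler_wpM2l // ltW.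
  by move: m1; rewrite (_ : _ * tau = x1 * tau * ((1 + eta) * M)) //; ring.
have hx2 : v.1 <= x2 * tau.
  rewrite -(ler_pM2r eM0); apply: (@le_trans _ _ m%:R); first by rewrite mE ler_wpM2l // ltW.
  by move: m2; rewrite (_ : _ * tau = x2 * tau * ((1 - eta) * M)) //; ring.
have [n' n'E] : exists n' : nat, (n * k + 1 = n' * m)%N by apply/dvdnP.
pose v' := u *~ k + w *~ n'.
have v'E1 : v'.1 = k%:R * u.1 + n'%:R * w.1 by rewrite /v' !pair_mulrz.
have v'E2 : v'.2 = k%:R * u.2 + n'%:R * w.2 by rewrite /v' !pair_mulrz.
have Lv' : L v' by exact: lattice_comb.
have n'R : n%:R * k%:R + 1 = n'%:R * m%:R :> R by rewrite -!natrM natr1 -n'E addn1.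
have dvv' : det2 v v' = 1.
  have -> : det2 v v' = (n'%:R * m%:R - n%:R * k%:R) * det2 u w.
    by rewrite /det2 vE1 vE2 v'E1 v'E2; ring.
  by rewrite duw mulr1 -n'R; ring.
have dv'w : det2 v' w = k%:R.
  by rewrite /det2 v'E1 v'E2 -[RHS]mulr1 -duw /det2; ring.
have qE : v'.1 * m%:R = k%:R * v.1 + w.1.
  rewrite v'E1 vE1 mulrDl [n'%:R * _ * _]mulrAC -n'R; ring.
have qE' : v'.1 * mu (slope v) = k%:R + w.1 / v.1.
  apply: (mulfI (lt0r_neq0 v0)); rewrite mulrCA -mE qE; field; exact: lt0r_neq0.
have /andP[wv1 wv2] : - 1 <= w.1 / v.1 <= 1.
  rewrite -ler_norml normrM normrV ?unitfE ?lt0r_neq0 // (gtr0_norm v0).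
  by rewrite ler_pdivrMr // mul1r (le_trans wx) // ltW.
have k1' : y1 * tau * ((1 + eta) * M) < v'.1 * mu (slope v).
  have e : y1 * (1 + eta) * M * tau = y1 * tau * ((1 + eta) * M) by ring.
  by rewrite qE' -e; lra.
have v'0 : 0 < v'.1.
  rewrite -(pmulr_lgt0 _ mu1); apply: le_lt_trans k1'.
  by rewrite !mulr_ge0 ?(ltW t0) ?(ltW y10) ?(ltW M0) //; have := eta0; lra.
have hy1 : y1 * tau < v'.1.
  rewrite -(ltr_pM2r pM0); apply: lt_le_trans k1' _; first by rewrite ler_wpM2l // ltW.
have hy2 : v'.1 <= y2 * tau.
  rewrite -(ler_pM2r eM0); apply: (@le_trans _ _ (v'.1 * mu (slope v))).
    by rewrite ler_wpM2l // ltW.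
  have e : y2 * (1 - eta) * M * tau = y2 * tau * ((1 - eta) * M) by ring.
  by rewrite qE' -e; lra.
have fv : farey L tau v.
  split; first exact: primitive_of_det2 Lv' dvv'.
  by rewrite v0 (le_trans hx2) // ler_piMl // ltW.
have nE : farey_next L tau v = v'.
  apply: farey_next_eq => //; apply/andP; split; last by rewrite (le_trans hy2) // ler_piMl // ltW.
  have : 1 * tau <= (x1 + y1) * tau by rewrite ler_wpM2r // ltW.
  by rewrite mul1r mulrDl; lra.
split; rewrite ?nE ?hx1 ?hy1 //; split => //=; rewrite in_itv /= sl1 sl2 //.
Qed.

Definition farey_box (x1 x2 y1 y2 : R) : set (R * R) :=
  [set p | x1 < p.1 <= x2 /\ y1 < p.2 <= y2].

Lemma farey_count_cell_ge tau x1 x2 y1 y2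
    (A := Num.truncn (x1 * (1 + eta) * M * tau))
    (B := Num.truncn (x2 * (1 - eta) * M * tau))
    (C := Num.truncn (y1 * (1 + eta) * M * tau + 1))
    (D := Num.truncn (y2 * (1 - eta) * M * tau - 1)) :
  0 < tau -> 0 < x1 -> x2 <= 1 -> 0 < y1 -> y2 <= 1 -> 1 <= x1 + y1 ->
  0 <= x2 -> 0 <= y2 * (1 - eta) * M * tau - 1 ->
  `|w.1| <= x1 * tau ->
  (\sum_(i < B - A) hyp_count (A.+1 + i) (Num.truncn ((A.+1 + i)%:R * t s1)).+1
     (Num.truncn ((A.+1 + i)%:R * t s2) - Num.truncn ((A.+1 + i)%:R * t s1))
     C.+1 (D - C) <=
   farey_count L `]s1, s2] tau (fun v => farey_box x1 x2 y1 y2 (farey_pair L tau v)))%N.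
Proof.
move=> t0 x10 x21 y10 y21 xy x20 y2t wx.
pose a m := Num.truncn (m%:R * t s1).
pose l m := (Num.truncn (m%:R * t s2) - Num.truncn (m%:R * t s1))%N.
pose s := [seq (m, p) | m <- iota A.+1 (B - A), p <- hyp_list m (a m).+1 (l m) C.+1 (D - C)].
have <- : size s = (\sum_(i < B - A) hyp_count (A.+1 + i) (a (A.+1 + i)).+1
    (l (A.+1 + i)) C.+1 (D - C))%N.
  rewrite size_allpairs_dep sumnE big_map big_iota_ord; apply: eq_bigr => i _.
  by rewrite size_hyp_list.
pose f (x : nat * (nat * nat)) := u *~ x.1 + w *~ x.2.1.
have spec x : x \in s -> [/\ farey_in L `]s1, s2] tau (f x),
      det2 (f x) w = x.1%:R, det2 u (f x) = x.2.1%:R, det2 (farey_next L tau (f x)) w = x.2.2%:R &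
      x1 * tau < (f x).1 <= x2 * tau /\ y1 * tau < (farey_next L tau (f x)).1 <= y2 * tau].
  case/allpairsPdep=> m [p [/[!mem_iota] /andP[Am mB]]].
  rewrite mem_filter => /andP[mp /allpairsP[[n k] [/= /[!mem_iota] /andP[an nl] /andP[Ck kD] pE]]] ->.
  move: mp; rewrite pE /= => mp.
  have m0 : 0 <= m%:R :> R by [].
  have eM0 : 0 < (1 - eta) by have := eta1; lra.
  have pM0 : 0 < (1 + eta) by have := eta0; lra.
  have tp x' : s1 <= x' <= s2 -> 0 <= m%:R * t x'.
    by move=> hx; rewrite mulr_ge0 // divr_ge0 // ltW ?nu0 ?mu0.
  have /andP[_ a2] := truncn_itv (tp _ s1i); have /andP[b1 _] := truncn_itv (tp _ s2i).
  have ge0A : 0 <= x1 * (1 + eta) * M * tau.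
    by rewrite !mulr_ge0 ?(ltW t0) ?(ltW M0) ?(ltW eM0) ?(ltW pM0) ?(ltW x10) ?(ltW y10).
  have ge0B : 0 <= x2 * (1 - eta) * M * tau.
    by rewrite !mulr_ge0 ?(ltW t0) ?(ltW M0) ?(ltW eM0) ?(ltW pM0) ?(ltW x10) ?(ltW y10).
  have ge0C : 0 <= y1 * (1 + eta) * M * tau + 1.
    by rewrite addr_ge0 // !mulr_ge0 ?(ltW t0) ?(ltW M0) ?(ltW eM0) ?(ltW pM0) ?(ltW x10) ?(ltW y10).
  have /andP[_ A2] := truncn_itv ge0A; have /andP[B1 _] := truncn_itv ge0B.
  have /andP[_ C2] := truncn_itv ge0C; have /andP[D1 _] := truncn_itv y2t.
  apply: farey_vector_cell => //.
  - by apply: lt_le_trans A2 _; rewrite ler_nat.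
  - apply: le_trans B1; rewrite ler_nat; exact: iota_bound Am mB.
  - by apply: lt_le_trans a2 _; rewrite ler_nat.
  - apply: le_trans b1; rewrite ler_nat; exact: iota_bound an nl.
  - by apply: lt_le_trans C2 _; rewrite ler_nat.
  - apply: le_trans D1; rewrite ler_nat; exact: iota_bound Ck kD.
apply: (@size_le_farey_count _ _ hL _ s1 s2 _ _ _ f) => [v|||x xs].
- by rewrite /= !in_itv /= => /andP[/ltW -> ->].
- apply: uniq_pairs_dep => [|m]; first exact: iota_uniq.
  rewrite filter_uniq // allpairs_uniq ?iota_uniq // => -[n k] [n' k'] _ _ /= [-> ->] //.
- move=> [m [n k]] [m' [n' k']] /spec[_ /= e1 e2 e3 _] /spec[_ /= e1' e2' e3' _] ff.
  have /eqP : m%:R = m'%:R :> R by rewrite -e1 -e1' ff.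
  have /eqP : n%:R = n'%:R :> R by rewrite -e2 -e2' ff.
  have /eqP : k%:R = k'%:R :> R by rewrite -e3 -e3' ff.
  by rewrite !eqr_nat => /eqP -> /eqP -> /eqP ->.
have [fI _ _ _ [h1 h2]] := spec x xs; split => //.
by rewrite /farey_box /farey_pair /= !ler_pdivrMr // !ltr_pdivlMr.
Qed.

Lemma farey_count_cell_lower x1 x2 y1 y2 e
    (a' := (x2 * (1 - eta) - x1 * (1 + eta)) * M)
    (b' := (y2 * (1 - eta) - y1 * (1 + eta)) * M) (D := t s2 - t s1) :
  0 < x1 -> x2 <= 1 -> 0 < y1 -> y2 <= 1 -> 1 <= x1 + y1 ->
  0 < a' -> 0 < b' -> D <= 1 / 2 -> 0 < e -> exists tau0, forall tau, tau0 <= tau ->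
  (mean_at tau * (D * a' * b') - e) * tau ^+ 2 <=
  (farey_count L `]s1, s2] tau (fun v => farey_box x1 x2 y1 y2 (farey_pair L tau v)))%:R.
Proof.
have shift_bounds (x y : R) : 3 <= x - y -> 0 <= y -> 0 <= x - 1 /\ y + 1 <= x - 1 by split; lra.
have sub1_le (x y : R) : x - 1 - (y + 1) + 1 <= x - y by lra.
have le_sub1 (x y : R) : x - y - 3 <= x - 1 - (y + 1) - 1 by lra.
have half_le (q p m : R) : q <= m * (1 / 2) -> p <= q + 1 -> 2 <= m -> p <= m by lra.
move=> x10 x21 y10 y21 xy a0 b0 Dhalf e0.
have h1 := eta1; have h0 := eta0; have hM := M0.
pose c1 := x1 * (1 + eta) * M; pose c2 := x2 * (1 - eta) * M.
pose d1 := y1 * (1 + eta) * M; pose d2 := y2 * (1 - eta) * M.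
have aE : a' = c2 - c1 by rewrite /a' /c1 /c2; ring.
have bE : b' = d2 - d1 by rewrite /b' /d1 /d2; ring.
have c10 : 0 < c1 by rewrite !mulr_gt0 //; lra.
have d10 : 0 < d1 by rewrite !mulr_gt0 //; lra.
have c20 : 0 < c2 by lra.
have x20 : 0 <= x2 by move: c20; rewrite /c2 -mulrA pmulr_lgt0 ?mulr_gt0 //; lra.
have d20 : 0 < d2 by lra.
have y20 : 0 < y2 by move: d20; rewrite /d2 -mulrA pmulr_lgt0 ?mulr_gt0 //; lra.
have D0 : 0 <= D.
  rewrite /D -[X in 0 <= X]mulr1 -duw /t /nu /mu.
  have -> : ((u.1 * s2 - u.2) / (w.2 - w.1 * s2) - (u.1 * s1 - u.2) / (w.2 - w.1 * s1)) *
    det2 u w = det2 u w ^+ 2 * (s2 - s1) / ((w.2 - w.1 * s1) * (w.2 - w.1 * s2)).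
    by rewrite /det2; field; rewrite !gt_eqF // ?(mu0 s1i) ?(mu0 s2i).
  by rewrite duw expr1n mul1r divr_ge0 ?subr_ge0 ?(ltW s12) // mulr_ge0 // ltW ?(mu0 s1i) ?(mu0 s2i).
(* The box estimate needs ranges no longer than [m]. For [k] this holds because $y_2 - y_1 \le 1 -
   y_1 \le x_1$; for [n] it is ensured by [D <= 1 / 2]. *)
have bc : b' <= c1.
  rewrite /b' /c1 ler_pM2r //.
  have : y2 * (1 - eta) <= y2 by rewrite ler_piMr ?(ltW y20) //; lra.
  have : y1 <= y1 * (1 + eta) by rewrite ler_peMr ?(ltW y10) //; lra.
  have : x1 <= x1 * (1 + eta) by rewrite ler_peMr ?(ltW x10) //; lra.
  by lra.
pose e1 := e / 4 / (c2 ^+ 2 + 1).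
have e10 : 0 < e1 by rewrite !divr_gt0 // ltr_wpDl // exprn_ge0 // ltW.
have e1c : e1 * c2 ^+ 2 <= e / 4.
  have : e1 * (c2 ^+ 2 + 1) = e / 4 by rewrite divfK // gt_eqF // ltr_wpDl // exprn_ge0 // ltW.
  by rewrite mulrDr; lra.
pose e2 := e / 4 / (D * b' + 1).
have Db0 : 0 <= D * b' by rewrite mulr_ge0 // ltW.
have e20 : 0 < e2 by rewrite !divr_gt0 // ltr_wpDl.
have e2c : D * b' * e2 <= e / 4.
  have : e2 * (D * b' + 1) = e / 4 by rewrite divfK // gt_eqF // ltr_wpDl.
  by rewrite mulrDr mulrC; lra.
have [N hN] := hyp_count_lower_real e10.
have [T1 hT1] := mean_at_interval (ltW c20) e20.
have e40 : 0 < e / 4 by rewrite divr_gt0.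
have [T2 T20 hT2] := quadratic_dominates (D * (3 * a' + b') + c2) 0 e40.
(* In turn: linear errors are absorbed, |w.1| is at most x1 tau, [m] passes the threshold [N], [m]
   is at least 2, the range of [k] survives its margins, and the range of [m] has length at least
   1. *)
exists (\big[Num.max/T1]_(x <- [:: T2; `|w.1| / x1; N%:R / c1; 2 / c1; 3 / b'; 1 / a']) x).
rewrite unlock /= => tau; rewrite !ge_max.
case/and5P=> tT2 tw tN t2 /and3P[t3 t4 tT1].
have t0 : 0 < tau by apply: lt_le_trans tT2.
have z1 : `|w.1| <= x1 * tau by rewrite mulrC -ler_pdivrMr.
have z2 : N%:R <= c1 * tau by rewrite mulrC -ler_pdivrMr.
have z3 : 2 <= c1 * tau by rewrite mulrC -ler_pdivrMr.
have z4 : 3 <= b' * tau by rewrite mulrC -ler_pdivrMr.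
have z5 : 1 <= a' * tau by rewrite mulrC -ler_pdivrMr.
have z4' : b' * tau = d2 * tau - d1 * tau by rewrite -mulrBl -bE.
have z6 : 0 <= d1 * tau by rewrite mulr_ge0 // ltW.
have [z7 z8] : 0 <= d2 * tau - 1 /\ d1 * tau + 1 <= d2 * tau - 1.
  by apply: shift_bounds; rewrite // -z4'.
have c1t : 0 <= c1 * tau by rewrite mulr_ge0 // ltW.
have c2t : 0 <= c2 * tau by rewrite mulr_ge0 // ltW.
have c12 : c1 * tau <= c2 * tau.
  by rewrite ler_wpM2r ?(ltW t0) // -subr_ge0 -aE ltW.
have := farey_count_cell_ge t0 x10 x21 y10 y21 xy x20 z7 z1; rewrite -/c1 -/c2 -/d1 -/d2.
have /andP[l1 l2] := truncn_diff c1t c12.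
have /andP[l'1 l'2] := truncn_diff (addr_ge0 z6 ler01) z8.
have /andP[B1 _] := truncn_itv c2t; have /andP[_ A2] := truncn_itv c1t.
have AB : (Num.truncn (c1 * tau) <= Num.truncn (c2 * tau))%N by rewrite le_truncn.
set A := Num.truncn (c1 * tau) in l1 l2 AB A2 *; set B := Num.truncn (c2 * tau) in l1 l2 B1 AB *.
set C := Num.truncn (d1 * tau + 1) in l'1 l'2 *.
set E := Num.truncn (d2 * tau - 1) in l'1 l'2 *.
set l := (B - A)%N in l1 l2 *; set l' := (E - C)%N in l'1 l'2 * => le1.
have l'up : l'%:R <= b' * tau.
  by apply: le_trans l'2 _; rewrite z4'; exact: sub1_le.
have term i : (i < l)%N ->
    D * l'%:R * totient_density R (A.+1 + i) - (1 + e1 * (c2 * tau)) <=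
    (hyp_count (A.+1 + i) (Num.truncn ((A.+1 + i)%:R * t s1)).+1
     (Num.truncn ((A.+1 + i)%:R * t s2) - Num.truncn ((A.+1 + i)%:R * t s1))
     C.+1 l')%:R.
  move=> il; set m := (A.+1 + i)%N.
  have mB : m%:R <= c2 * tau.
    by apply: le_trans B1; rewrite ler_nat /m addSn -ltn_subRL.
  have Am : c1 * tau < m%:R.
    by apply: lt_le_trans A2 _; rewrite ler_nat /m addSn ltnS leq_addr.
  have m2 : 2 <= m%:R :> R by rewrite (le_trans z3) // ltW.
  have m0 : 0 < m%:R :> R by rewrite (lt_le_trans _ m2).
  have tp x : s1 <= x <= s2 -> 0 <= m%:R * t x.
    by move=> hx; rewrite mulr_ge0 // divr_ge0 // ltW ?nu0 ?mu0.
  have tt : m%:R * t s1 <= m%:R * t s2 by rewrite ler_wpM2l // -subr_ge0.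
  have /andP[] := truncn_diff (tp _ s1i) tt.
  set p := (_ - _)%N; rewrite -mulrBr -/D => p1 p2.
  have pm : (p <= m)%N.
    have mD2 : m%:R * D <= m%:R * (1 / 2) by rewrite ler_wpM2l.
    by rewrite -(ler_nat R); exact: half_le mD2 p2 m2.
  have l'm : (l' <= m)%N.
    rewrite -(ler_nat R) (le_trans l'up) //; apply: le_trans (ltW Am).
    by rewrite ler_wpM2r // ltW.
  have Nm : (N <= m)%N by rewrite -(ler_nat R) (le_trans z2) // ltW.
  have := hN m Nm (Num.truncn (m%:R * t s1)).+1 p C.+1 l' pm l'm.
  move=> h; apply: (cell_term_lower _ p1 _ m0 h mB (ltW e10)).
    by rewrite totient_density_ge0 totient_density_le1.
  by rewrite ler0n ler_nat.
rewrite -(ler_nat R) natr_sum in le1; apply: le_trans le1.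
apply: (@cell_sum_lower _ (mean_at tau) a' b' c2 D e e1 e2 l%:R l'%:R (totient_sum R A.+1 l)) => //.
- by rewrite totient_mean_ge0 totient_mean_le1.
- by apply: le_trans l1; rewrite aE mulrBl.
- by apply: le_trans B1; rewrite ler_nat leq_subr.
- by apply: le_trans l'1; rewrite z4'; exact: le_sub1.
- have := hT1 _ tT1 A l; rewrite subnKC // => /(_ B1); rewrite ler_norml => /andP[+ _].
  by rewrite lerBrDl.
- have -> : l%:R * (1 + e1 * (c2 * tau)) = \sum_(i < l) (1 + e1 * (c2 * tau)).
    by rewrite sumr_const card_ord mulr_natl.
  rewrite /totient_sum mulr_sumr -sumrB; apply: ler_sum => i _; exact: term.
by have := hT2 _ tT2; rewrite addr0.
Qed.

End Cell.
End Counting.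

(** * From short slope intervals to all of them *)

(** Real induction: the supremum of the points [c] with P a c cannot lie before [b], as [P] holds
    across a neighbourhood of it. The admissible cell length depends on the point, and this combines
    only finitely many thresholds. *)
Lemma interval_induction (R : realType) (P : R -> R -> Prop) (a b : R) : a < b ->
  (forall x y z, x < y -> y < z -> P x y -> P y z -> P x z) ->
  (forall s, exists2 d, 0 < d & forall x y, s - d < x -> x < y -> y < s + d -> P x y) ->
  P a b.
Proof.
move=> ab Padd Ploc.
pose S := [set c | a < c <= b /\ P a c].
have [d d0 hd] := Ploc a.
have S0 : S (Num.min b (a + d / 2)).
  split; first by rewrite lt_min ab ge_min lexx ltrDl divr_gt0.
  by apply: hd; rewrite ?lt_min ?ab ?gt_min; [lra|rewrite ltrDl divr_gt0|apply/orP; right; lra].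
have Sb : ubound S b by move=> c [/andP[]].
have hS : has_sup S by split; [exists (Num.min b (a + d / 2))|exists b].
have [e e0 he] := Ploc (sup S).
have [c [/andP[ac cb] Pc] sc] := sup_adherent e0 hS.
have cs : c <= sup S by apply: sup_upper_bound => //; split; rewrite ?ac.
pose y := Num.min b (sup S + e / 2).
have [yc|cy] := leP y c.
  move: yc; rewrite /y ge_min => /orP[bc|]; last by lra.
  by rewrite (_ : b = c) //; apply/eqP; rewrite eq_le bc cb.
have Sy : S y.
  split; first by rewrite (lt_trans ac cy) /y ge_min lexx.
  apply: (Padd _ c) => //; apply: he => //.
  by rewrite /y gt_min; apply/orP; right; lra.
have := sup_upper_bound hS Sy; rewrite {1}/y ge_min => /orP[bs|]; last by lra.
suff yb : y = b by move: Sy => []; rewrite yb.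
by rewrite /y; apply/min_idPl; lra.
Qed.

(** The cost of replacing [mu] by (1 ± h) M. With 14 h in place of e / 2 the difference is [h] times
    a sum of terms that are nonnegative once P <= 1 and h <= 1 / 4. *)
Lemma cell_coef_upper (R : realType) (x1 x2 h e : R) : 0 <= x1 -> x1 <= x2 -> x2 <= 1 ->
  0 < h -> h <= 1 / 4 -> 28 * h <= e ->
  x2 * (1 + h) * (x2 * (1 + h) - x1 * (1 - h)) <= (x2 * (x2 - x1) + e / 2) * (1 - h) ^+ 2.
Proof.
move=> x10 x12 x21 h0 h1 he; set P := x2 * (x2 - x1).
have P0 : 0 <= P by rewrite mulr_ge0 ?subr_ge0 // (le_trans x10).
have P1 : P <= 1 by rewrite /P; apply: mulr_ile1; lra.
have e1 : x2 * (1 + h) * (x2 * (1 + h) - x1 * (1 - h)) = (1 + h) * (P + x2 * (x1 + x2) * h).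
  by rewrite /P; ring.
have e2 : x2 * (x1 + x2) <= 2 by nra.
have e3 : (P + 14 * h) * (1 - h) ^+ 2 <= (P + e / 2) * (1 - h) ^+ 2.
  by rewrite ler_wpM2r ?sqr_ge0 //; lra.
apply: le_trans e3; rewrite e1.
apply: (@le_trans _ _ ((1 + h) * (P + 2 * h))).
  by rewrite ler_wpM2l //; [lra|rewrite lerD2l ler_wpM2r // ltW].
rewrite -subr_ge0.
have -> : (P + 14 * h) * (1 - h) ^+ 2 - (1 + h) * (P + 2 * h) =
  h * (3 * (1 - P) + (9 - 30 * h) + (P * h + 14 * h ^+ 2)) by ring.
apply: mulr_ge0; first exact: ltW.
have Ph : 0 <= P * h by rewrite mulr_ge0 // ltW.
have hh := sqr_ge0 h; lra.
Qed.

Lemma cell_coef_lower (R : realType) (x1 x2 y1 y2 h e : R) :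
  0 <= x1 -> x2 <= 1 -> 0 <= y1 -> y2 <= 1 ->
  0 < h -> h <= 1 / 4 -> 14 * h <= e -> 2 * h < x2 - x1 -> 2 * h < y2 - y1 ->
  ((x2 - x1) * (y2 - y1) - e / 2) * (1 + h) ^+ 2 <=
  (x2 * (1 - h) - x1 * (1 + h)) * (y2 * (1 - h) - y1 * (1 + h)).
Proof.
move=> x10 x21 y10 y21 h0 h1 he hx hy.
set P := x2 - x1; set Q := y2 - y1.
have PQ : P * Q <= 1 by rewrite /P /Q; apply: mulr_ile1; lra.
have e1 : (P - 2 * h) * (Q - 2 * h) <= (x2 * (1 - h) - x1 * (1 + h)) * (y2 * (1 - h) - y1 * (1 + h)).
  by apply: ler_pM; rewrite /P /Q; nra.
apply: le_trans e1.
have e2 : (P * Q - e / 2) * (1 + h) ^+ 2 <= (P * Q - 7 * h) * (1 + h) ^+ 2.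
  by rewrite ler_wpM2r ?sqr_ge0 //; lra.
apply: le_trans e2 _.
have p1 : P <= 1 by rewrite /P; lra.
have q1 : Q <= 1 by rewrite /Q; lra.
by nra.
Qed.

Section Global.
Variables (R : realType) (L : set (R * R)) (hL : unimodular_lattice L).

Lemma lattice_cell (s0 h : R) : 0 < h -> h <= 1 / 4 -> exists u w M d,
  [/\ L u, L w, det2 u w = 1, 0 < M & 0 < d] /\
  [/\ forall s, s0 - d < s < s0 + d -> (1 - h) * M <= w.2 - w.1 * s <= (1 + h) * M,
      forall s, s0 - d < s < s0 + d -> 0 < u.1 * s - u.2 & d <= M ^+ 2 / 8].
Proof.
move=> h0 h1; have [u [w [Lu Lw duw m0 n0]]] := lattice_cone hL s0.
set M := w.2 - w.1 * s0 in m0; set N := u.1 * s0 - u.2 in n0.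
(* The three bounds keep [mu] within h M of [M], keep [nu] positive, and limit the range of [t]:
   with h <= 1 / 4 its length is at most $2d / (9M^2/16) \le 4/9$. *)
pose d := Num.min (Num.min (h * M / (`|w.1| + 1)) (N / (`|u.1| + 1))) (M ^+ 2 / 8).
have w1 : 0 < `|w.1| + 1 by rewrite ltr_wpDl.
have u1 : 0 < `|u.1| + 1 by rewrite ltr_wpDl.
have d0 : 0 < d.
  rewrite !lt_min -andbA; apply/and3P.
  by split; apply: divr_gt0; rewrite ?mulr_gt0 ?exprn_gt0.
have dw : `|w.1| * d <= h * M.
  apply: (@le_trans _ _ ((`|w.1| + 1) * d)); first by rewrite ler_wpM2r ?(ltW d0) // lerDl.
  by rewrite mulrC -ler_pdivlMr ?ltr_wpDl // /d !ge_min lexx.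
have du : `|u.1| * d < N.
  apply: (@lt_le_trans _ _ ((`|u.1| + 1) * d)); first by rewrite ltr_pM2r // ltrDl.
  by rewrite mulrC -ler_pdivlMr ?ltr_wpDl // /d !ge_min lexx orbT.
exists u, w, M, d; split => //; split.
- move=> s hs; have hs' : `|s - s0| <= d by rewrite ler_norml; apply/andP; split; lra.
  have : `|w.1 * (s - s0)| <= h * M.
    by rewrite normrM; apply: le_trans dw; rewrite ler_wpM2l.
  have -> : w.2 - w.1 * s = M - w.1 * (s - s0) by rewrite /M; ring.
  by rewrite ler_norml => /andP[a b]; rewrite mulrBl mulrDl mul1r; apply/andP; split; lra.
- move=> s hs; have hs' : `|s - s0| <= d by rewrite ler_norml; apply/andP; split; lra.
  have : `|u.1 * (s - s0)| < N.
    by rewrite normrM; apply: le_lt_trans du; rewrite ler_wpM2l.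
  have -> : u.1 * s - u.2 = N + u.1 * (s - s0) by rewrite /N; ring.
  by rewrite ltr_norml => /andP[a b]; lra.
by rewrite /d ge_min lexx orbT.
Qed.

Lemma cone_coord_diff (u w : R * R) (s1 s2 : R) : det2 u w = 1 ->
  0 < w.2 - w.1 * s1 -> 0 < w.2 - w.1 * s2 ->
  (u.1 * s2 - u.2) / (w.2 - w.1 * s2) - (u.1 * s1 - u.2) / (w.2 - w.1 * s1) =
  (s2 - s1) / ((w.2 - w.1 * s1) * (w.2 - w.1 * s2)).
Proof.
move=> duw m1 m2; rewrite -[X in _ = X / _]mul1r -duw /det2; field.
by rewrite !gt_eqF.
Qed.

Lemma farey_count_subadd I J K a b tau (P : R * R -> Prop) :
  I `<=` `[a, b] -> J `<=` `[a, b] -> K `<=` `[a, b] -> K `<=` I `|` J ->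
  (farey_count L K tau P <= farey_count L I tau P + farey_count L J tau P)%N.
Proof.
move=> Ia Ja Ka KIJ; rewrite /farey_count -!size_filter -size_cat.
apply: uniq_leq_size => [|v]; first by rewrite filter_uniq // farey_seq_uniq.
rewrite mem_cat !mem_filter (mem_farey_seq hL _ _ Ia) (mem_farey_seq hL _ _ Ja)
  (mem_farey_seq hL _ _ Ka) => /andP[-> /asboolP[fv /KIJ[Iv|Jv]]] /=.
  by apply/orP; left; apply/asboolP.
by apply/orP; right; apply/asboolP.
Qed.

(** Lower bounds use half-open slope intervals so that adjacent pieces are disjoint; the closed
    intervals of the upper bounds may share an endpoint. *)
Lemma farey_count_superadd I J K a b tau (P : R * R -> Prop) :
  I `<=` K -> J `<=` K -> K `<=` `[a, b] -> I `&` J `<=` set0 ->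
  (farey_count L I tau P + farey_count L J tau P <= farey_count L K tau P)%N.
Proof.
move=> IK JK Ka IJ.
have Ia := subset_trans IK Ka; have Ja := subset_trans JK Ka.
rewrite /farey_count -!size_filter -size_cat.
apply: uniq_leq_size => [|v].
  rewrite cat_uniq !filter_uniq ?farey_seq_uniq // andbT /=; apply/hasPn => v.
  rewrite !mem_filter (mem_farey_seq hL _ _ Ia) (mem_farey_seq hL _ _ Ja).
  move=> /andP[_ /asboolP[fv Jv]]; apply/negP => /andP[_ /asboolP[_ Iv]].
  exact: (IJ (slope v)).
rewrite mem_cat !mem_filter (mem_farey_seq hL _ _ Ia) (mem_farey_seq hL _ _ Ja)
  (mem_farey_seq hL _ _ Ka) => /orP[] /andP[-> /asboolP[fv Xv]] /=; apply/asboolP.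
  by split => //; apply: IK.
by split => //; apply: JK.
Qed.

(** The error is proportional to the length of the slope interval, so the estimate is additive and
    [interval_induction] applies without loss. *)
Lemma farey_count_upper (a b x1 x2 e : R) : a < b -> 0 <= x1 -> x1 <= x2 -> x2 <= 1 -> 0 < e ->
  exists tau0, forall tau, tau0 <= tau ->
  (farey_count L `[a, b] tau (fun v => (x1 * tau < v.1 <= x2 * tau)%R))%:R <=
    (mean_at tau * (x2 * (x2 - x1)) + e) * (b - a) * tau ^+ 2.
Proof.
move=> ab x10 x12 x21 e0.
pose Q (s1 s2 : R) := exists tau0, forall tau, tau0 <= tau ->
  (farey_count L `[s1, s2] tau (fun v => (x1 * tau < v.1 <= x2 * tau)%R))%:R <=
    (mean_at tau * (x2 * (x2 - x1)) + e) * (s2 - s1) * tau ^+ 2.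
apply: (@interval_induction _ Q) => // [x y z xy yz [T1 h1] [T2 h2]|s].
  exists (Num.max T1 T2) => tau; rewrite ge_max => /andP[/h1 {}h1 /h2 {}h2].
  have := @farey_count_subadd `[x, y] `[y, z] `[x, z] x z tau
    (fun v => (x1 * tau < v.1 <= x2 * tau)%R).
  rewrite -(ler_nat R) natrD => h; apply: le_trans (h _ _ _ _) _.
  - by move=> t /=; rewrite !in_itv /= => /andP[-> /le_trans->] //; rewrite ltW.
  - by move=> t /=; rewrite !in_itv /= => /andP[yt ->]; rewrite (le_trans (ltW xy)).
  - by [].
  - move=> t /=; rewrite !in_itv /= => /andP[xt tz].
    by have [ty|yt] := leP t y; [left|right]; rewrite ?xt ?ty ?tz ?(ltW yt).
  have -> : z - x = (y - x) + (z - y) by ring.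
  by rewrite mulrDr mulrDl lerD.
pose h := Num.min (1 / 4) (e / 28).
have h0 : 0 < h by rewrite lt_min !divr_gt0.
have h1 : h <= 1 / 4 by rewrite ge_min lexx.
have he : 28 * h <= e by rewrite mulrC -ler_pdivlMr // ge_min lexx orbT.
have [u [w [M [d [[Lu Lw duw M0 d0] [hmu hnu _]]]]]] := lattice_cell s h0 h1.
exists d => // s1 s2 ds1 s12 ds2.
have inI t : s1 <= t <= s2 -> s - d < t < s + d.
  by case/andP=> st1 st2; rewrite (lt_le_trans ds1 st1) (le_lt_trans st2 ds2).
have mu' t (st : s1 <= t <= s2) := hmu t (inI t st).
have nu' t (st : s1 <= t <= s2) := hnu t (inI t st).
have s21 : 0 < s2 - s1 by rewrite subr_gt0.
have e2 : 0 < e / 2 * (s2 - s1) by rewrite mulr_gt0 // divr_gt0.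
have [T hT] := farey_count_cell_upper hL Lu Lw duw M0 h0 h1 s12 mu' nu' x10 x12 e2.
exists T => tau /hT /le_trans; apply; rewrite ler_wpM2r ?sqr_ge0 //.
have eM0 : 0 < (1 - h) * M by rewrite mulr_gt0 //; lra.
have /andP[m1 _] : (1 - h) * M <= w.2 - w.1 * s1 <= (1 + h) * M.
  by apply: mu'; rewrite lexx ltW.
have /andP[m2 _] : (1 - h) * M <= w.2 - w.1 * s2 <= (1 + h) * M.
  by apply: mu'; rewrite lexx ltW.
rewrite cone_coord_diff // ?(lt_le_trans eM0) //.
set m := ((w.2 - w.1 * s1) * (w.2 - w.1 * s2)).
have mm : ((1 - h) * M) ^+ 2 <= m.
  by rewrite expr2 ler_pM // ltW.
have coef : x2 * (1 + h) * M * (x2 * (1 + h) * M - x1 * (1 - h) * M) * ((s2 - s1) / m) <=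
    (x2 * (x2 - x1) + e / 2) * (s2 - s1).
  rewrite mulrA ler_pdivrMr ?(lt_le_trans _ mm) ?exprn_gt0 //.
  rewrite [leRHS]mulrAC ler_wpM2r ?(ltW s21) //.
  apply: (@le_trans _ _ ((x2 * (x2 - x1) + e / 2) * ((1 - h) * M) ^+ 2)).
    rewrite exprMn mulrA.
    have -> : x2 * (1 + h) * M * (x2 * (1 + h) * M - x1 * (1 - h) * M) =
      x2 * (1 + h) * (x2 * (1 + h) - x1 * (1 - h)) * M ^+ 2 by ring.
    by rewrite ler_wpM2r ?sqr_ge0 // cell_coef_upper.
  rewrite ler_wpM2l // addr_ge0 ?divr_ge0 ?(ltW e0) // mulr_ge0 ?subr_ge0 //.
  exact: le_trans x12.
have k0 := totient_mean_ge0 R (Num.truncn tau); have k1 := totient_mean_le1 R (Num.truncn tau).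
rewrite -/(mean_at tau) in k0 k1.
have h3 := ler_wpM2l k0 coef.
have h4 : mean_at tau * (e / 2 * (s2 - s1)) <= e / 2 * (s2 - s1) by rewrite ler_piMl // ltW.
have -> : (mean_at tau * (x2 * (x2 - x1)) + e) * (s2 - s1) =
  mean_at tau * (x2 * (x2 - x1)) * (s2 - s1) + e / 2 * (s2 - s1) + e / 2 * (s2 - s1) by field.
rewrite lerD2r; apply: le_trans h3 _.
have -> : mean_at tau * ((x2 * (x2 - x1) + e / 2) * (s2 - s1)) =
  mean_at tau * (x2 * (x2 - x1)) * (s2 - s1) + mean_at tau * (e / 2 * (s2 - s1)) by ring.
by rewrite lerD2l.
Qed.

Lemma farey_count_lower (a b x1 x2 y1 y2 e : R) : a < b ->
  0 < x1 -> x1 < x2 -> x2 <= 1 -> 0 < y1 -> y1 < y2 -> y2 <= 1 -> 1 <= x1 + y1 -> 0 < e ->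
  exists tau0, forall tau, tau0 <= tau ->
  (mean_at tau * ((x2 - x1) * (y2 - y1)) - e) * (b - a) * tau ^+ 2 <=
  (farey_count L `]a, b] tau (fun v => farey_box x1 x2 y1 y2 (farey_pair L tau v)))%:R.
Proof.
move=> ab x10 x12 x21 y10 y12 y21 xy e0.
pose Q (s1 s2 : R) := exists tau0, forall tau, tau0 <= tau ->
  (mean_at tau * ((x2 - x1) * (y2 - y1)) - e) * (s2 - s1) * tau ^+ 2 <=
  (farey_count L `]s1, s2] tau (fun v => farey_box x1 x2 y1 y2 (farey_pair L tau v)))%:R.
apply: (@interval_induction _ Q) => // [x y z xy' yz [T1 h1] [T2 h2]|s].
  exists (Num.max T1 T2) => tau; rewrite ge_max => /andP[/h1 {}h1 /h2 {}h2].
  have := @farey_count_superadd `]x, y] `]y, z] `]x, z] x z tau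
    (fun v => farey_box x1 x2 y1 y2 (farey_pair L tau v)).
  rewrite -(ler_nat R) natrD => h; apply: le_trans (h _ _ _ _).
  - have -> : z - x = (y - x) + (z - y) by ring.
    by rewrite mulrDr mulrDl lerD.
  - by move=> t /=; rewrite !in_itv /= => /andP[-> /le_trans->] //; rewrite ltW.
  - by move=> t /=; rewrite !in_itv /= => /andP[yt ->]; rewrite (lt_trans xy').
  - by move=> t /=; rewrite !in_itv /= => /andP[/ltW -> ->].
  by move=> t [] /=; rewrite !in_itv /= => /andP[_ ty] /andP[]; rewrite ltNge ty.
(* The last two bounds keep the box nondegenerate after each of its sides is shrunk by up to 2 h. *)
pose h := Num.min (Num.min (1 / 4) (e / 14)) (Num.min ((x2 - x1) / 3) ((y2 - y1) / 3)).
have dx : 0 < x2 - x1 by rewrite subr_gt0.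
have dy : 0 < y2 - y1 by rewrite subr_gt0.
have h0 : 0 < h by rewrite !lt_min !divr_gt0.
have h1 : h <= 1 / 4 by rewrite !ge_min lexx.
have he : 14 * h <= e by rewrite mulrC -ler_pdivlMr // !ge_min lexx !orbT.
have hx : 3 * h <= x2 - x1 by rewrite mulrC -ler_pdivlMr // !ge_min lexx !orbT.
have hy : 3 * h <= y2 - y1 by rewrite mulrC -ler_pdivlMr // !ge_min lexx !orbT.
have hx' : 2 * h < x2 - x1 by lra.
have hy' : 2 * h < y2 - y1 by lra.
have [u [w [M [d [[Lu Lw duw M0 d0] [hmu hnu hd]]]]]] := lattice_cell s h0 h1.
exists d => // s1 s2 ds1 s12 ds2.
have inI t : s1 <= t <= s2 -> s - d < t < s + d.
  by case/andP=> st1 st2; rewrite (lt_le_trans ds1 st1) (le_lt_trans st2 ds2).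
have mu' t (st : s1 <= t <= s2) := hmu t (inI t st).
have nu' t (st : s1 <= t <= s2) := hnu t (inI t st).
have s21 : 0 < s2 - s1 by rewrite subr_gt0.
have e2 : 0 < e / 2 * (s2 - s1) by rewrite mulr_gt0 // divr_gt0.
have eM0 : 0 < (1 - h) * M by rewrite mulr_gt0 //; lra.
have pM0 : 0 < (1 + h) * M by rewrite mulr_gt0 // addr_gt0.
have /andP[m1 m1'] : (1 - h) * M <= w.2 - w.1 * s1 <= (1 + h) * M.
  by apply: mu'; rewrite lexx ltW.
have /andP[m2 m2'] : (1 - h) * M <= w.2 - w.1 * s2 <= (1 + h) * M.
  by apply: mu'; rewrite lexx ltW.
have p1 := lt_le_trans eM0 m1; have p2 := lt_le_trans eM0 m2.
have a0 : 0 < (x2 * (1 - h) - x1 * (1 + h)) * M by rewrite mulr_gt0 //; nra.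
have b0 : 0 < (y2 * (1 - h) - y1 * (1 + h)) * M by rewrite mulr_gt0 //; nra.
have mm : ((1 - h) * M) ^+ 2 <= (w.2 - w.1 * s1) * (w.2 - w.1 * s2).
  by rewrite expr2 ler_pM // ltW.
have mm' : (w.2 - w.1 * s1) * (w.2 - w.1 * s2) <= ((1 + h) * M) ^+ 2.
  by rewrite expr2 ler_pM // ltW.
have Dhalf : (u.1 * s2 - u.2) / (w.2 - w.1 * s2) - (u.1 * s1 - u.2) / (w.2 - w.1 * s1) <= 1 / 2.
  rewrite cone_coord_diff // ler_pdivrMr ?mulr_gt0 //.
  apply: (@le_trans _ _ (1 / 2 * ((1 - h) * M) ^+ 2)); last by rewrite ler_wpM2l.
  apply: (@le_trans _ _ (2 * d)); first by lra.
  rewrite exprMn; have : (3 / 4) ^+ 2 * M ^+ 2 <= (1 - h) ^+ 2 * M ^+ 2.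
    by rewrite ler_wpM2r ?sqr_ge0 // lerXn2r ?nnegrE //; lra.
  by lra.
have [T hT] := farey_count_cell_lower hL Lu Lw duw M0 h0 h1 s12 mu' nu' x10 x21 y10 y21 xy a0 b0 Dhalf e2.
exists T => tau /hT; apply: le_trans; rewrite ler_wpM2r ?sqr_ge0 //.
rewrite cone_coord_diff //.
set m := ((w.2 - w.1 * s1) * (w.2 - w.1 * s2)).
have coef : ((x2 - x1) * (y2 - y1) - e / 2) * (s2 - s1) <=
  (s2 - s1) / m * ((x2 * (1 - h) - x1 * (1 + h)) * M) * ((y2 * (1 - h) - y1 * (1 + h)) * M).
  have -> : (s2 - s1) / m * ((x2 * (1 - h) - x1 * (1 + h)) * M) * ((y2 * (1 - h) - y1 * (1 + h)) * M)
    = (x2 * (1 - h) - x1 * (1 + h)) * (y2 * (1 - h) - y1 * (1 + h)) * M ^+ 2 * (s2 - s1) / m.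
    by field; rewrite gt_eqF // mulr_gt0.
  rewrite ler_pdivlMr ?mulr_gt0 // mulrAC ler_wpM2r ?(ltW s21) //.
  have cl := cell_coef_lower (ltW x10) x21 (ltW y10) y21 h0 h1 he hx' hy'.
  (* A nonpositive left factor would reverse the comparison of the denominators, but then the claim
     is trivial. *)
  have [neg|pos] := leP ((x2 - x1) * (y2 - y1) - e / 2) 0.
    apply: (@le_trans _ _ 0); first by rewrite mulr_le0_ge0 // mulr_ge0 // ltW.
    by rewrite mulr_ge0 ?sqr_ge0 // mulr_ge0 // ltW // -(pmulr_lgt0 _ M0).
  apply: (@le_trans _ _ (((x2 - x1) * (y2 - y1) - e / 2) * ((1 + h) * M) ^+ 2)).
    by rewrite ler_wpM2l // ltW.
  by rewrite exprMn mulrA ler_wpM2r ?sqr_ge0.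
have k0 := totient_mean_ge0 R (Num.truncn tau); have k1 := totient_mean_le1 R (Num.truncn tau).
rewrite -/(mean_at tau) in k0 k1.
have h3 := ler_wpM2l k0 coef.
have h4 : mean_at tau * (e / 2 * (s2 - s1)) <= e / 2 * (s2 - s1) by rewrite ler_piMl // ltW.
have -> : (mean_at tau * ((x2 - x1) * (y2 - y1)) - e) * (s2 - s1) =
  mean_at tau * ((x2 - x1) * (y2 - y1)) * (s2 - s1) - e / 2 * (s2 - s1) - e / 2 * (s2 - s1) by field.
rewrite lerD2r; apply: le_trans h3.
have -> : mean_at tau * (((x2 - x1) * (y2 - y1) - e / 2) * (s2 - s1)) =
  mean_at tau * ((x2 - x1) * (y2 - y1)) * (s2 - s1) - mean_at tau * (e / 2 * (s2 - s1)) by ring.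
by rewrite lerD2l lerN2.
Qed.

End Global.

(** * Frequencies of boxes *)

Lemma grid_index (R : realType) (n : nat) (x : R) : 0 < x -> x <= 1 ->
  exists i : 'I_n.+1, i%:R / n.+1%:R < x <= i.+1%:R / n.+1%:R.
Proof.
move=> x0 x1; have n0 : 0 < n.+1%:R :> R by [].
have y0 : 0 < x * n.+1%:R by rewrite mulr_gt0.
have /andP[c1 c2] := ceil_itv (x * n.+1%:R).
have cz : 0 < Num.ceil (x * n.+1%:R) by rewrite -(ltr0z R) (lt_le_trans y0).
have [i iE] : exists i : nat, Num.ceil (x * n.+1%:R) = i.+1.
  by exists (absz (Num.ceil (x * n.+1%:R))).-1; move: cz; clear; lia.
rewrite iE in c1 c2.
have e1 : (i.+1%:Z - 1)%:~R = i%:R :> R by rewrite intrB -[_%:~R]/(i.+1%:R) -natr1 addrK.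
rewrite e1 in c1.
have iy : (i < n.+1)%N by rewrite -(ltr_nat R) (lt_le_trans c1) // ler_piMl.
by exists (Ordinal iy); rewrite ltr_pdivrMr // ler_pdivlMr // c1.
Qed.

Lemma sum_succ_natr (R : realType) (n : nat) : \sum_(i < n) i.+1%:R = n%:R * (n%:R + 1) / 2 :> R.
Proof.
elim: n => [|n IH]; first by rewrite big_ord0 !mul0r.
by rewrite big_ord_recr /= IH -[n.+1%:R]natr1; field.
Qed.

Lemma common_threshold (R : realType) (I : finType) (T : I -> R) :
  exists2 t0, 0 < t0 & forall tau, t0 <= tau -> forall i, T i <= tau.
Proof.
exists (1 + \sum_i `|T i|) => [|tau ht i]; first by rewrite ltr_wpDr // sumr_ge0.
apply: le_trans ht; rewrite (bigD1 i) //=; apply: le_trans (ler_norm _) _.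
by rewrite addrCA lerDl addr_ge0 // sumr_ge0.
Qed.

Section Ratio.
Variables (R : realType) (L : set (R * R)) (hL : unimodular_lattice L).

Lemma farey_num_slabs (a b tau : R) (n : nat) : 0 < tau ->
  (farey_num L `[a, b] tau <= \sum_(i < n.+1)
    farey_count L `[a, b] tau
      (fun v => (i%:R / n.+1%:R * tau < v.1 <= i.+1%:R / n.+1%:R * tau)%R))%N.
Proof.
move=> t0; rewrite /farey_num /farey_count.
under eq_bigr do rewrite -sum1_count big_mkcond.
rewrite exchange_big -sum1_size big_seq [leqRHS]big_seq; apply: leq_sum => v.
rewrite (@mem_farey_seq _ _ hL _ a b) // => /asboolP[[_ /andP[v0 vt]] _].
have [|| i hi] := @grid_index R n (v.1 / tau); first by rewrite divr_gt0.
  by rewrite ler_pdivrMr // mul1r.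
rewrite (bigD1 i) //= ifT ?leq_addr //; apply/asboolP.
by rewrite -ltr_pdivlMr // -ler_pdivrMr.
Qed.

(** Over slabs of width 1 / (n + 1) the bounds of [farey_count_upper] form an upper Riemann sum of
    $\int_0^1 x\,dx = 1/2$, the area of the triangle, with excess 1 / (2 (n + 1)). *)
Lemma farey_num_upper (a b e : R) : a < b -> 0 < e ->
  exists tau0, forall tau, tau0 <= tau ->
  (farey_num L `[a, b] tau)%:R <= (mean_at tau / 2 + e) * (b - a) * tau ^+ 2.
Proof.
move=> ab e0; pose n := Num.truncn e^-1.
have n0 : 0 < n.+1%:R :> R by [].
have ne : n.+1%:R^-1 <= e.
  by rewrite -[leRHS]invrK lef_pV2 ?posrE ?invr_gt0 // ltW // truncnS_gt.
pose e1 := e / (2 * n.+1%:R).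
have e10 : 0 < e1 by rewrite divr_gt0 // mulr_gt0.
have H (i : 'I_n.+1) : exists tau0, forall tau, tau0 <= tau ->
  (farey_count L `[a, b] tau
    (fun v => (i%:R / n.+1%:R * tau < v.1 <= i.+1%:R / n.+1%:R * tau)%R))%:R <=
  (mean_at tau * (i.+1%:R / n.+1%:R * n.+1%:R^-1) + e1) * (b - a) * tau ^+ 2.
  have := @farey_count_upper _ _ hL a b (i%:R / n.+1%:R) (i.+1%:R / n.+1%:R) e1 ab.
  rewrite -mulrBl -natrB // subSnn mul1r; apply => //.
  - by rewrite ler_pM2r ?invr_gt0 // ler_nat.
  - by rewrite ler_pdivrMr // mul1r ler_nat.
have [T hT] := choice H.
have [tau0 tau00 htau0] := common_threshold T; exists tau0 => tau ht.
have Ti := htau0 tau ht; have t0 := lt_le_trans tau00 ht.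
have := farey_num_slabs a b n t0; rewrite -(ler_nat R) natr_sum => /le_trans; apply.
apply: le_trans (ler_sum _ (fun i _ => hT i tau (Ti i))) _.
rewrite -!mulr_suml big_split /= -mulr_sumr.
rewrite ler_wpM2r ?sqr_ge0 // ler_wpM2r ?subr_ge0 ?(ltW ab) //.
rewrite sumr_const card_ord -[e1 *+ _]mulr_natr.
have -> : e1 * n.+1%:R = e / 2 by rewrite /e1; field; rewrite gt_eqF.
have -> : \sum_(i < n.+1) (i.+1%:R / n.+1%:R * n.+1%:R^-1) = 1 / 2 + n.+1%:R^-1 / 2 :> R.
  by rewrite -!mulr_suml sum_succ_natr; field; rewrite gt_eqF.
have k0 := totient_mean_ge0 R (Num.truncn tau); have k1 := totient_mean_le1 R (Num.truncn tau).
rewrite -/(mean_at tau) in k0 k1.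
have h : mean_at tau * (n.+1%:R^-1 / 2) <= n.+1%:R^-1 / 2.
  by rewrite ler_piMl // divr_ge0 // invr_ge0.
move: ne h; set r := n.+1%:R^-1 => ne h; rewrite mulrDr; lra.
Qed.

Lemma farey_ratio_lower (a b x1 x2 y1 y2 e : R) : a < b ->
  0 < x1 -> x1 < x2 -> x2 <= 1 -> 0 < y1 -> y1 < y2 -> y2 <= 1 -> 1 <= x1 + y1 -> 0 < e ->
  exists2 tau0, 0 < tau0 & forall tau, tau0 <= tau ->
  2 * ((x2 - x1) * (y2 - y1)) - e <=
  (farey_count L `[a, b] tau (fun v => farey_box x1 x2 y1 y2 (farey_pair L tau v)))%:R /
    (farey_num L `[a, b] tau)%:R.
Proof.
move=> ab x10 x12 x21 y10 y12 y21 xy e0.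
set q := (x2 - x1) * (y2 - y1).
(* As the box area [q] is at most 1, the errors amount to at most 3 e1; as the mean is at least 1/8,
   the available slack is at least e / 16. *)
pose e1 := e / 48.
have e10 : 0 < e1 by rewrite divr_gt0.
have [T1 h1] := farey_num_upper ab e10.
have [T2 h2] := farey_count_lower hL ab x10 x12 x21 y10 y12 y21 xy e10.
have [T3 h3] := mean_at_lower R.
exists (Num.max 1 (Num.max T1 (Num.max T2 T3))) => [|tau].
  by rewrite lt_max ltr01.
rewrite !ge_max => /and4P[t1 /h1 {}h1 /h2 {}h2 /h3 {}h3].
set N := (farey_num _ _ _)%:R in h1 *.
set K := (farey_count L `[a, b] _ _)%:R.
have N0 : 0 <= N by [].
have [neg|pos] := leP (2 * q - e) 0.
  by apply: le_trans neg _; rewrite divr_ge0.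
have K1 : (mean_at tau * q - e1) * (b - a) * tau ^+ 2 <= K.
  apply: le_trans h2 _; rewrite ler_nat.
  have := @farey_count_superadd _ _ hL `]a, b] set0 `[a, b] a b tau
    (fun v => farey_box x1 x2 y1 y2 (farey_pair L tau v)).
  move=> h; apply: leq_trans (leq_addr _ _) (h _ _ _ _) => //.
  by move=> t /=; rewrite !in_itv /= => /andP[/ltW -> ->].
have KN : K <= N.
  rewrite ler_nat /farey_count /farey_num; exact: count_size.
have A0 : 0 < (b - a) * tau ^+ 2.
  by rewrite mulr_gt0 ?subr_gt0 // exprn_gt0 // (lt_le_trans ltr01).
rewrite -mulrA in K1; rewrite -mulrA in h1.
have q1 : q <= 1 by rewrite /q; apply: mulr_ile1; lra.
have main : (2 * q - e) * (mean_at tau / 2 + e1) <= mean_at tau * q - e1.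
  by rewrite /e1; nra.
have c0 : 0 < mean_at tau * q - e1.
  by apply: lt_le_trans main; rewrite mulr_gt0 // addr_gt0 // divr_gt0 //; lra.
have Npos : 0 < N by apply: lt_le_trans KN; apply: lt_le_trans K1; rewrite mulr_gt0.
rewrite ler_pdivlMr //; apply: le_trans K1.
apply: (@le_trans _ _ ((2 * q - e) * ((mean_at tau / 2 + e1) * ((b - a) * tau ^+ 2)))).
  by rewrite ler_wpM2l // ltW.
by rewrite mulrA ler_wpM2r // ltW.
Qed.

End Ratio.

(** * Continuous functions and step functions *)

Lemma within_continuous_square (R : realType) (X : set (R * R)) (f : R * R -> R) :
  {within X, continuous f} -> forall x e, X x -> 0 < e ->
  exists2 d, 0 < d & forall y, X y -> `|y.1 - x.1| < d -> `|y.2 - x.2| < d -> `|f y - f x| < e.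
Proof.
move=> /subspace_continuousP cf x e Xx e0.
have /cvgrPdist_lt /(_ e e0) := cf x Xx.
rewrite near_withinE => /nbhs_ballP[d /= d0 hd]; exists d => // y Xy y1 y2.
rewrite distrC; apply: hd => //.
by split; rewrite /ball /= distrC.
Qed.

(* The preimage of an open ray is the trace on X of the union of the rational boxes
   whose trace it contains. *)
Lemma measurable_fun_within_continuous (R : realType)
  (X : set (measurableTypeR R * measurableTypeR R)) (f : R * R -> R) :
  measurable X -> {within (X : set (R * R)), continuous f} ->
  measurable_fun X (f : measurableTypeR R * measurableTypeR R -> R).
Proof.
move=> mX cf.
apply: (measurability _ (RGenOInfty.measurableE R)).
move=> _ [_ [r ->] <-].
pose box (p : rat * rat * rat * rat) : set (measurableTypeR R * measurableTypeR R) :=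
  (`]ratr p.1.1.1, ratr p.1.1.2[ `*` `]ratr p.1.2, ratr p.2[).
pose good p := X `&` box p `<=` f @^-1` `]r, +oo[.
pose O := \bigcup_n (if (choice.unpickle n : option (rat * rat * rat * rat)) is Some p
  then (if `[< good p >] then box p else set0) else set0).
have -> : X `&` f @^-1` `]r, +oo[ = X `&` O.
  apply/seteqP; split => x [Xx]; last first.
    move=> [n _]; case: choice.unpickle => // p; case: ifPn => // /asboolP gp bx.
    by split => //; apply: gp.
  move=> /= frx; split => //.
  have rx : 0 < f x - r by move: frx; rewrite in_itv /= andbT subr_gt0.
  have [d d0 hd] := within_continuous_square cf Xx rx.
  have rat1 (y : R) : exists p q : rat, y - d < ratr p < y /\ y < ratr q < y + d.
    have /rat_in_itvoo[p hp] : y - d < y by rewrite ltrBlDr ltrDl.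
    have /rat_in_itvoo[q hq] : y < y + d by rewrite ltrDl.
    by exists p, q; move: hp hq; rewrite !in_itv.
  have [p1 [q1 [/andP[a1 a2] /andP[a3 a4]]]] := rat1 x.1.
  have [p2 [q2 [/andP[b1 b2] /andP[b3 b4]]]] := rat1 x.2.
  have [k kE] : exists k, choice.unpickle k = Some (p1, q1, p2, q2).
    by eexists; apply: choice.pickleK.
  exists k => //; rewrite kE ifT.
    by split => /=; rewrite in_itv /= ?a2 ?a3 ?b2 ?b3.
  apply/asboolP => y [Xy [/= y1 y2]]; rewrite in_itv /= andbT.
  move: y1 y2; rewrite !in_itv /= => /andP[c1 c2] /andP[c3 c4].
  have : `|f y - f x| < f x - r.
    by apply: hd => //; rewrite ltr_norml; apply/andP; split; lra.
  by rewrite ltr_norml => /andP[+ _]; lra.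
apply: measurableI => //; apply: bigcupT_measurable => n.
case: choice.unpickle => // p; case: ifP => // _.
by apply: measurableX; exact: measurable_itv.
Qed.

Lemma uniformly_continuous_compact (R : realType) (X K : set (R * R)) (f : R * R -> R) (e : R) :
  compact K -> K `<=` X -> {within X, continuous f} -> 0 < e ->
  exists n : nat, forall x y, K x -> X y ->
    `|y.1 - x.1| <= n.+1%:R^-1 -> `|y.2 - x.2| <= n.+1%:R^-1 -> `|f y - f x| <= e.
Proof.
move=> /compact_near_coveringP cK KX cf e0.
pose P (n : nat) (x : R * R) := K x -> forall y, X y ->
  `|y.1 - x.1| <= n.+1%:R^-1 -> `|y.2 - x.2| <= n.+1%:R^-1 -> `|f y - f x| <= e.
have [|n _ hn] := cK nat \oo P _.
  move=> x Kx; have e20 : 0 < e / 2 by rewrite divr_gt0.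
  have [d d0 hd] := within_continuous_square cf (KX _ Kx) e20.
  have d20 : 0 < d / 2 by rewrite divr_gt0.
  have dd : d / 2 < d by lra.
  near=> x' n => /= Kx' y Xy y1 y2.
  have nd : n.+1%:R^-1 < d / 2.
    near: n; exact: near_infty_natSinv_lt (PosNum d20).
  have [z1 z2] : `|x'.1 - x.1| < d / 2 /\ `|x'.2 - x.2| < d / 2.
    have : ball x (d / 2) x' by near: x'; exact: nbhsx_ballx.
    by case=> /=; rewrite /ball /= !(distrC x'.1) !(distrC x'.2).
  have h1 : `|f y - f x| < e / 2.
    apply: hd => //.
      rewrite (_ : y.1 - x.1 = (y.1 - x'.1) + (x'.1 - x.1)); last by ring.
      by apply: le_lt_trans (ler_normD _ _) _; rewrite [ltRHS]splitr ltrD // (le_lt_trans y1).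
    rewrite (_ : y.2 - x.2 = (y.2 - x'.2) + (x'.2 - x.2)); last by ring.
    by apply: le_lt_trans (ler_normD _ _) _; rewrite [ltRHS]splitr ltrD // (le_lt_trans y2).
  have h2 : `|f x' - f x| < e / 2.
    by apply: hd; [exact: KX|exact: lt_trans z1 dd|exact: lt_trans z2 dd].
  rewrite (_ : f y - f x' = (f y - f x) - (f x' - f x)); last by ring.
  by apply: le_trans (ler_normB _ _) _; rewrite [leRHS]splitr lerD // ltW.
exists n => x y Kx Xy; apply: (hn n _ x Kx Kx y Xy); exact: leqnn.
Unshelve. all: end_near.
Qed.

Lemma Rintegral_sum_indic d (T : measurableType d) (R : realType)
    (mu : {measure set T -> \bar R}) (X : set T) (I : Type) (r : seq I)
    (Q : I -> set T) (c : I -> R) :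
  measurable X -> (mu X < +oo)%E -> (forall i, measurable (Q i)) -> (forall i, Q i `<=` X) ->
  mu.-integrable X (EFin \o (fun x => \sum_(i <- r) c i * \1_(Q i) x)) /\
  \int[mu]_(x in X) (\sum_(i <- r) c i * \1_(Q i) x) = \sum_(i <- r) c i * fine (mu (Q i)).
Proof.
move=> mX Xfin mQ QX.
have i1 i : mu.-integrable X (EFin \o \1_(Q i)).
  apply: measurable_bounded_integrable => //.
  exists 1; split => // M M1 x _ /=; rewrite ger0_norm //.
  by apply: le_trans (ltW M1); rewrite indicE lern1 leq_b1.
have iZ i : mu.-integrable X (EFin \o (fun x => c i * \1_(Q i) x)).
  exact: (integrableZl mX (c i) (i1 i)).
elim: r => [|i r [IH1 IH2]].
  split; last by under eq_Rintegral do rewrite big_nil; rewrite Rintegral_cst // mul0r big_nil.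
  by under eq_fun do rewrite big_nil; exact: integrable0.
split.
  have -> : (fun x => \sum_(j <- i :: r) c j * \1_(Q j) x) =
      (fun x => c i * \1_(Q i) x) \+ (fun x => \sum_(j <- r) c j * \1_(Q j) x).
    by apply/funext => x; rewrite big_cons.
  exact: (integrableD mX (iZ i) IH1).
under eq_Rintegral do rewrite big_cons.
rewrite RintegralD // IH2 big_cons RintegralZl //.
by rewrite /Rintegral integral_indic // setIidl.
Qed.

(** With [g] the step function and [s] the indicator of the union of the cells, |f - g| <= M + (e -
    M) s pointwise: it is at most [e] on the cells and at most [M] off them. *)
Lemma Rintegral_cells d (T : measurableType d) (R : realType)
    (mu : {measure set T -> \bar R}) (X : set T) (f : T -> R) (I : finType)
    (Q : I -> set T) (c : I -> R) (e M : R) :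
  measurable X -> (mu X <= 1)%E -> measurable_fun X f -> 0 <= M ->
  (forall x, X x -> `|f x| <= M) ->
  (forall i, measurable (Q i)) -> (forall i, Q i `<=` X) ->
  (forall i j x, Q i x -> Q j x -> i = j) -> 0 <= e ->
  (forall i x, Q i x -> `|f x - c i| <= e) ->
  `|\int[mu]_(x in X) f x - \sum_i c i * fine (mu (Q i))| <=
    e + M * (1 - \sum_i fine (mu (Q i))).
Proof.
move=> mX X1 mf M0 fM mQ QX Qd e0 fc.
have Xfin : (mu X < +oo)%E by rewrite (le_lt_trans X1) // ltry.
have bounded_int (h : T -> R) B : measurable_fun X h -> (forall x, X x -> `|h x| <= B) ->
    mu.-integrable X (EFin \o h).
  move=> mh hB; apply: measurable_bounded_integrable => //.
  exists B; split => [|N BN x Xx /=]; first exact: num_real.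
  exact: le_trans (hB _ Xx) (ltW BN).
have intf : mu.-integrable X (EFin \o f) by exact: bounded_int fM.
pose g x := \sum_(i <- index_enum I) c i * \1_(Q i) x.
pose s x : R := \sum_(i <- index_enum I) 1 * \1_(Q i) x.
have [ig Ig] : mu.-integrable X (EFin \o g) /\
    \int[mu]_(x in X) g x = \sum_i c i * fine (mu (Q i)).
  exact: Rintegral_sum_indic.
have [int_s Is] : mu.-integrable X (EFin \o s) /\
    \int[mu]_(x in X) s x = \sum_i 1 * fine (mu (Q i)).
  exact: (Rintegral_sum_indic (index_enum I) (fun=> 1)).
have sum1 (k : I -> R) i x : Q i x -> \sum_(j <- index_enum I) k j * \1_(Q j) x = k i.
  move=> Qi; rewrite (bigD1 i) //= indicE mem_set // mulr1 big1 ?addr0 // => j ji.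
  by rewrite indicE memNset ?mulr0 // => Qj; move: ji; rewrite (Qd _ _ _ Qi Qj) eqxx.
have gs x : (exists i, Q i x /\ g x = c i /\ s x = 1) \/ (g x = 0 /\ s x = 0).
  have [[i Qi]|nQ] := pselect (exists i, Q i x); [left|right].
     exists i; split => //; split; first exact: (@sum1 c i x Qi).
    exact: (@sum1 (fun=> 1) i x Qi).
  have H i : \1_(Q i) x = 0 :> R by rewrite indicE memNset // => Qi; apply: nQ; exists i.
  by split; rewrite /g /s big1 // => i _; rewrite H mulr0.
rewrite -Ig -RintegralB //.
have ifg : mu.-integrable X (EFin \o (fun x => f x - g x)).
  exact: (integrableB mX intf ig).
apply: le_trans (le_normr_Rintegral mX ifg) _.
have icst (r : R) : mu.-integrable X (EFin \o (fun=> r)).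
  by apply: (bounded_int _ `|r|) => //; exact: measurable_cst.
have Q0 i : 0 <= fine (mu (Q i)) by rewrite fine_ge0.
have {}Is : \int[mu]_(x in X) s x = \sum_i fine (mu (Q i)).
  by rewrite Is; apply: eq_bigr => i _; rewrite mul1r.
have X1' : fine (mu X) <= 1.
  by rewrite -lee_fin fineK // ge0_fin_numE.
have S1 : \sum_i fine (mu (Q i)) <= 1.
  rewrite -Is; apply: le_trans X1'; rewrite -[leRHS]mul1r -(Rintegral_cst mu mX).
  apply: le_Rintegral => // x Xx.
  by case: (gs x) => [[i [_ [_ ->]]]|[_ ->]].
have ih : mu.-integrable X (EFin \o (fun x => M + (e - M) * s x)).
  exact: (integrableD mX (icst M) (integrableZl mX (e - M) int_s)).
apply: (@le_trans _ _ (\int[mu]_(x in X) (M + (e - M) * s x))).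
  apply: le_Rintegral => //; first exact: (integrable_norm ifg).
  move=> x Xx; case: (gs x) => [[i [Qi [-> ->]]]|[-> ->]].
    have -> : M + (e - M) * 1 = e by ring.
    exact: fc.
  by rewrite subr0 mulr0 addr0 fM.
rewrite (RintegralD mX (icst M) (integrableZl mX (e - M) int_s)) RintegralZl //.
rewrite Rintegral_cst // Is.
set S := \sum_i _ in S1 *.
have S0 : 0 <= S by rewrite sumr_ge0.
have -> : M * fine (mu X) + (e - M) * S = e * S + M * (fine (mu X) - S) by ring.
apply: lerD; first by rewrite ler_piMr.
by rewrite ler_wpM2l // lerD2r.
Qed.

(** * The limit measure on the grid *)

Section Measure.
Variable R : realType.
Local Notation plane := (measurableTypeR R * measurableTypeR R)%type.
Local Notation T := (@farey_triangle R : set plane).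

Lemma farey_boxE (x1 x2 y1 y2 : R) : farey_box x1 x2 y1 y2 = `]x1, x2] `*` `]y1, y2].
Proof. by apply/seteqP; split => p /=; rewrite !in_itv. Qed.

Lemma measurable_farey_box (x1 x2 y1 y2 : R) :
  measurable (farey_box x1 x2 y1 y2 : set plane).
Proof. by rewrite farey_boxE; apply: measurableX; exact: measurable_itv. Qed.

Lemma farey_box_triangle (x1 x2 y1 y2 : R) : 0 <= x1 -> x2 <= 1 -> 0 <= y1 -> y2 <= 1 ->
  1 <= x1 + y1 -> farey_box x1 x2 y1 y2 `<=` @farey_triangle R.
Proof.
move=> x10 x21 y10 y21 xy p [/andP[a b] /andP[c d]]; split.
- by rewrite (le_lt_trans x10 a) (le_trans b x21).
- by rewrite (le_lt_trans y10 c) (le_trans d y21).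
- by apply: le_lt_trans xy _; rewrite ltrD.
Qed.

Lemma area_farey_box (x1 x2 y1 y2 : R) : x1 <= x2 -> y1 <= y2 ->
  (lebesgue_measure \x lebesgue_measure)%E (farey_box x1 x2 y1 y2 : set plane) =
  ((x2 - x1) * (y2 - y1))%:E.
Proof.
move=> x12 y12; rewrite farey_boxE product_measure1E; try exact: measurable_itv.
have E (x y : R) : x <= y -> lebesgue_measure (`]x, y]%classic : set R) = (y - x)%:E.
  move=> xy; rewrite (lebesgue_measure_itv `]x, y]) /= lte_fin.
  by move: xy; rewrite le_eqVlt => /orP[/eqP->|->]; rewrite ?ltxx ?subrr ?EFinB.
by rewrite EFinM; congr (_ * _)%E; apply: E.
Qed.

Lemma farey_measureE (A : set plane) : A `<=` T ->
  farey_measure R A = (2%:E * (lebesgue_measure \x lebesgue_measure) A)%E.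
Proof.
by move=> AT; rewrite -[in RHS](setIidl AT).
Qed.

(** The triangle is covered by n + 1 columns that overshoot its area 1/2 by 1 / (2 (n + 1)), and [n]
    is arbitrary. *)
Lemma farey_measure_triangle_le1 : (farey_measure R T <= 1)%E.
Proof.
rewrite farey_measureE //.
set A := (_ \x _)%E _.
suff H (n : nat) : (A <= (1 / 2 + n.+1%:R^-1 / 2)%:E)%E.
  have : (A <= (1 / 2)%:E)%E.
    apply/lee_addgt0Pr => e e0.
    have [n ne] : exists n : nat, n.+1%:R^-1 <= 2 * e.
      exists (Num.truncn (2 * e)^-1).
      by rewrite -[leRHS]invrK lef_pV2 ?posrE ?invr_gt0 ?mulr_gt0 // ltW // truncnS_gt.
    apply: le_trans (H n) _; rewrite -EFinD lee_fin.
    by move: ne; set r := n.+1%:R^-1; lra.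
  move=> h; apply: (@le_trans _ _ (2%:E * (1 / 2)%:E)%E); first by rewrite lee_pmul2l.
  by rewrite -EFinM lee_fin; lra.
pose Q i : set plane := farey_box (i%:R / n.+1%:R) (i.+1%:R / n.+1%:R) (1 - i.+1%:R / n.+1%:R) 1.
have n0 : 0 < n.+1%:R :> R by [].
have sub : T `<=` \big[setU/set0]_(i < n.+1) Q i.
  move=> p [/andP[p0 p1] /andP[q0 q1] pq].
  have [i /andP[i1 i2]] := grid_index n p0 p1.
  rewrite -bigcup_mkord; exists i => //=; split; rewrite ?q1 ?andbT ?i1 //.
  by rewrite ltrBlDr (lt_le_trans pq) // addrC lerD2l.
have mQ i : measurable (Q i) by exact: measurable_farey_box.
apply: le_trans (_ : (_ <= \sum_(i < n.+1) (lebesgue_measure \x lebesgue_measure) (Q i))%E) _.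
  apply: content_subadditive => //; exact: measurable_farey_triangle.
have area i : (lebesgue_measure \x lebesgue_measure)%E (Q i) =
    (n.+1%:R^-1 * (i.+1%:R / n.+1%:R))%:E.
  rewrite area_farey_box.
  - by congr EFin; rewrite -natr1; field.
  - by rewrite ler_pM2r ?invr_gt0 // ler_nat.
  - by rewrite gerBl divr_ge0.
under eq_bigr do rewrite area.
rewrite sumEFin lee_fin -mulr_sumr -mulr_suml.
rewrite sum_succ_natr; set r := n.+1%:R in n0 *.
rewrite le_eqVlt; apply/orP; left; apply/eqP; field; exact: lt0r_neq0.
Qed.

End Measure.

Section Grid.
Variable R : realType.
Local Notation plane := (measurableTypeR R * measurableTypeR R)%type.
Local Notation T := (@farey_triangle R : set plane).

(* Only the cells at height at least k / N above the antidiagonal are kept, so that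
   their upper corners lie in a fixed compact part of the triangle. *)
Definition grid_cell (N k : nat) (p : 'I_N * 'I_N) : set plane :=
  if (N + k <= p.1 + p.2)%N
  then farey_box (p.1%:R / N%:R) (p.1.+1%:R / N%:R) (p.2%:R / N%:R) (p.2.+1%:R / N%:R)
  else set0.

Lemma grid_coord (N i : nat) : (i < N)%N ->
  [/\ 0 <= i%:R / N%:R :> R, i%:R / N%:R < i.+1%:R / N%:R :> R, i.+1%:R / N%:R <= 1 :> R &
      i.+1%:R / N%:R - i%:R / N%:R = N%:R^-1 :> R].
Proof.
move=> iN; have N0 : 0 < N%:R :> R by rewrite ltr0n (leq_ltn_trans _ iN).
split.
- by rewrite divr_ge0.
- by rewrite ltr_pM2r ?invr_gt0 // ltr_nat.
- by rewrite ler_pdivrMr // mul1r ler_nat.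
- by rewrite -mulrBl -natrB // subSnn mul1r.
Qed.

Lemma grid_cell_cases N k (p : 'I_N * 'I_N) (P : set plane -> Prop) :
  P set0 -> ((N + k <= p.1 + p.2)%N ->
    1 <= p.1%:R / N%:R + p.2%:R / N%:R :> R -> 0 < p.1%:R / N%:R :> R -> 0 < p.2%:R / N%:R :> R ->
    P (farey_box (p.1%:R / N%:R) (p.1.+1%:R / N%:R) (p.2%:R / N%:R) (p.2.+1%:R / N%:R))) ->
  P (grid_cell k p).
Proof.
move=> P0 Pb; rewrite /grid_cell; case: ifP => // h; apply: Pb => //.
- have N0 : 0 < N%:R :> R by rewrite ltr0n (leq_ltn_trans _ (ltn_ord p.1)).
  by rewrite -mulrDl ler_pdivlMr // mul1r -natrD ler_nat (leq_trans (leq_addr _ _) h).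
- have := ltn_ord p.2; case: (nat_of_ord p.1) h => [|i]; first by rewrite add0n; lia.
  by move=> _ p2; rewrite divr_gt0 ?ltr0n // (leq_ltn_trans _ p2).
- have := ltn_ord p.1; case: (nat_of_ord p.2) h => [|i]; first by rewrite addn0; lia.
  by move=> _ p2; rewrite divr_gt0 ?ltr0n // (leq_ltn_trans _ p2).
Qed.

Lemma grid_cell_triangle N k (p : 'I_N * 'I_N) : grid_cell k p `<=` T.
Proof.
apply: (@grid_cell_cases N k p (fun A => A `<=` T)) => // _ h1 h2 h3.
have [_ _ a _] := grid_coord (ltn_ord p.1); have [_ _ b _] := grid_coord (ltn_ord p.2).
by apply: farey_box_triangle => //; exact: ltW.
Qed.

Lemma measurable_grid_cell N k (p : 'I_N * 'I_N) : measurable (grid_cell k p).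
Proof. by apply: (@grid_cell_cases N k p measurable) => // *; exact: measurable_farey_box. Qed.

Lemma grid_interval_inj N (i j : 'I_N) (x : R) :
  i%:R / N%:R < x <= i.+1%:R / N%:R -> j%:R / N%:R < x <= j.+1%:R / N%:R -> i = j.
Proof.
have N0 : 0 < N%:R :> R by rewrite ltr0n (leq_ltn_trans _ (ltn_ord i)).
have Ni : 0 < N%:R^-1 :> R by rewrite invr_gt0.
move=> /andP[a b] /andP[c d]; apply/val_inj/eqP; rewrite eqn_leq /=.
apply/andP; split; rewrite -ltnS -(ltr_nat R) -(ltr_pM2r Ni).
  exact: lt_le_trans a d.
exact: lt_le_trans c b.
Qed.

Lemma grid_cell_disjoint N k (p q : 'I_N * 'I_N) x : grid_cell k p x -> grid_cell k q x -> p = q.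
Proof.
rewrite /grid_cell; case: ifP => // _ [a b]; case: ifP => // _ [c d].
by rewrite [p]surjective_pairing [q]surjective_pairing (grid_interval_inj a c) (grid_interval_inj b d).
Qed.

Lemma farey_measure_grid_cell N k (p : 'I_N * 'I_N) :
  fine (farey_measure R (grid_cell k p)) = 2 * (N + k <= p.1 + p.2)%N%:R / N%:R ^+ 2.
Proof.
have [_ a _ a'] := grid_coord (ltn_ord p.1); have [_ b _ b'] := grid_coord (ltn_ord p.2).
rewrite farey_measureE; last exact: grid_cell_triangle.
rewrite /grid_cell; case: ifP => _; last by rewrite measure0 mule0 mulr0 mul0r.
by rewrite area_farey_box ?ltW // a' b' -EFinM /= mulr1 -invfM expr2.
Qed.

(** Row [i] retains at least i - k cells of mass $2/N^2$; summing over [i] gives the bound. *)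
Lemma grid_total N k : (0 < N)%N -> 1 - N%:R^-1 - 2 * k%:R / N%:R <=
  \sum_(p : 'I_N * 'I_N) 2 * (N + k <= p.1 + p.2)%N%:R / N%:R ^+ 2 :> R.
Proof.
move=> N0; have NR : N%:R != 0 :> R by rewrite pnatr_eq0 -lt0n.
have row c n : (\sum_(j < n) (c <= j) = n - c)%N.
  elim: n => [|n IH]; first by rewrite big_ord0 sub0n.
  by rewrite big_ord_recr /= IH; case: leqP => /=; lia.
have rowR (i : 'I_N) : i%:R - k%:R <= \sum_(j < N) (N + k <= i + j)%N%:R :> R.
  rewrite -natr_sum (eq_bigr (fun j : 'I_N => nat_of_bool (N + k - i <= j)%N)); last first.
    by move=> j _; rewrite leq_subLR.
  rewrite row lerBlDr -natrD ler_nat.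
  by have := ltn_ord i; lia.
rewrite -(pair_bigA _ (fun i j : 'I_N => 2 * (N + k <= i + j)%N%:R / N%:R ^+ 2)) /=.
under eq_bigr do rewrite -mulr_suml -mulr_sumr.
rewrite -mulr_suml -mulr_sumr.
apply: le_trans (_ : 2 * (\sum_(i < N) (i%:R - k%:R)) / N%:R ^+ 2 <= _); last first.
  rewrite ler_wpM2r ?invr_ge0 ?exprn_ge0 // ler_wpM2l //.
  by apply: ler_sum => i _; exact: rowR.
rewrite sumrB (eq_bigr (fun i : 'I_N => i.+1%:R - 1)) => [|i _]; last by rewrite -natr1 addrK.
rewrite sumrB sum_succ_natr !sumr_const card_ord -[k%:R *+ N]mulr_natr -[1 *+ N]/(N%:R).
rewrite le_eqVlt; apply/orP; left; apply/eqP; field; exact: NR.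
Qed.

End Grid.

(** * From cell masses to weak-* convergence *)

Lemma normr_le_shift (R : realType) (x e : R) : 0 <= e -> - e <= x -> `|x| <= x + 2 * e.
Proof. by move=> e0 h; rewrite ler_norml; apply/andP; split; lra. Qed.

(** The triangle is not closed along the antidiagonal and at two corners, so a bounded continuous
    function on it need not be uniformly continuous. The core is closed and avoids both, since x + y
    >= 1 + 1 / (d + 1) with x, y <= 1 forces x and y to be positive. *)
Definition triangle_core (R : realType) (d : nat) : set (R * R) :=
  (`[0, 1] `*` `[0, 1]) `&` (fun p => p.1 + p.2) @^-1` [set x | 1 + d.+1%:R^-1 <= x].

Lemma compact_triangle_core (R : realType) (d : nat) : compact (@triangle_core R d).
Proof.
apply: compact_closedI; first by apply: compact_setX; exact: segment_compact.
apply: preimage_closed; last exact: closed_ge.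
move=> p _; apply: cvgD; [exact: cvg_fst|exact: cvg_snd].
Qed.

Lemma triangle_core_sub (R : realType) (d : nat) : triangle_core d `<=` @farey_triangle R.
Proof.
move=> p [[/=]]; rewrite !in_itv /= => /andP[p0 p1] /andP[q0 q1] pq.
have d0 : 0 < d.+1%:R^-1 :> R by rewrite invr_gt0.
move: d0 pq; set r := d.+1%:R^-1 => d0 pq.
by split; [apply/andP; split; lra|apply/andP; split; lra|lra].
Qed.

(** Lower bounds on single cells become two-sided in the sum: by [normr_le_shift] the sum of |r - m|
    is at most the sum of r - m plus a small term. The unknown mass 1 - sum r that [r] leaves off
    the cells cancels against it. *)
Lemma weighted_sums_close (R : realType) (I : finType) (m r c : I -> R) (A B M e eps del : R) :
  0 <= M -> 0 <= del -> #|I|%:R * del <= eps -> (forall p, `|c p| <= M) ->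
  (forall p, - del <= r p - m p) -> \sum_p r p <= 1 -> 1 - eps <= \sum_p m p ->
  `|A - \sum_p c p * r p| <= e + M * (1 - \sum_p r p) ->
  `|B - \sum_p c p * m p| <= e + M * (1 - \sum_p m p) ->
  `|B - A| <= 2 * e + 6 * M * eps.
Proof.
move=> M0 del0 Idel cM rm r1 m1 hA hB.
set sr := \sum_p r p in r1 hA; set sm := \sum_p m p in m1 hB.
set cr := \sum_p c p * r p in hA; set cm := \sum_p c p * m p in hB.
have hc : `|cr - cm| <= M * (sr - sm + 2 * eps).
  rewrite -sumrB; apply: le_trans (ler_norm_sum _ _ _) _.
  apply: (@le_trans _ _ (\sum_p M * (r p - m p + 2 * del))).
    apply: ler_sum => p _; rewrite -mulrBr normrM ler_pM //.
    exact: normr_le_shift.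
  rewrite -mulr_sumr ler_wpM2l // big_split /= sumrB lerD //.
  by rewrite sumr_const -mulrnAr ler_wpM2l // -[del *+ _]mulr_natl.
have h : `|B - A| <= `|B - cm| + `|cr - cm| + `|A - cr|.
  have -> : B - A = (B - cm) - (cr - cm) - (A - cr) by ring.
  apply: le_trans (ler_normB _ _) _; rewrite lerD2r; exact: ler_normB.
have eps0 : 0 <= eps by apply: le_trans Idel; rewrite mulr_ge0.
apply: le_trans h _; apply: le_trans (lerD (lerD hB hc) hA) _.
have -> : e + M * (1 - sm) + M * (sr - sm + 2 * eps) + (e + M * (1 - sr)) =
  2 * e + 2 * M * (1 - sm + eps) by ring.
rewrite lerD2l; have -> : 6 * M * eps = 2 * M * (3 * eps) by ring.
by rewrite ler_wpM2l ?mulr_ge0 //; move: m1 eps0; clear; lra.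
Qed.

Theorem theorem10 (R : realType) (L : set (R * R)) (a b : R)
    (hL : unimodular_lattice L) (hab : a < b) :
  weak_star_cvg (@farey_triangle R) (rho L `[a, b]) (pinfty_nbhs R)
    (farey_measure R).
Proof.
move=> f cf [M0 fM0].
pose M := Num.max 0 M0.
have Mge0 : 0 <= M by rewrite le_max lexx.
have fM x : farey_triangle x -> `|f x| <= M.
  by move=> /fM0 h; rewrite le_max h orbT.
have mT := @measurable_farey_triangle R.
have mf := measurable_fun_within_continuous mT cf.
have rho1 tau : 0 < tau -> (rho L `[a, b] tau (@farey_triangle R) <= 1)%E.
  move=> t0; rewrite (rhoE hL) // -EFinM lee_fin.
  set s := farey_seq _ _ _; have [->|s0] := eqVneq s [::]; first by rewrite mulr0.
  rewrite mulrC ler_pdivrMr ?ltr0n ?lt0n ?size_eq0 // mul1r ler_nat; exact: count_size.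
have fint (mu : {measure set (measurableTypeR R * measurableTypeR R) -> \bar R}) :
    (mu (@farey_triangle R) <= 1)%E ->
    (\int[mu]_(x in @farey_triangle R) (f x)%:E)%E = (\int[mu]_(x in @farey_triangle R) f x)%:E.
  move=> mu1; rewrite /Rintegral fineK //; apply: integrable_fin_num => //.
  apply: measurable_bounded_integrable => //; first by rewrite (le_lt_trans mu1) // ltry.
  exists M; split => [|N MN x Xx /=]; first exact: num_real.
  exact: le_trans (fM _ Xx) (ltW MN).
rewrite fint; last exact: farey_measure_triangle_le1.
have cvgR : (fun tau => \int[rho L `[a, b] tau]_(x in @farey_triangle R) f x) @ +oo -->
    \int[farey_measure R]_(x in @farey_triangle R) f x.
  apply/cvgrPdist_le => e e0.
  (* Half of [e] pays for the term 6 M eps of [weighted_sums_close]; M + 1 covers the case M = 0.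
     The other half is twice the oscillation e / 4 allowed on a cell. *)
  pose eps := e / (12 * (M + 1)).
  have M1 : 0 < M + 1 by rewrite ltr_wpDl.
  have eps0 : 0 < eps by rewrite divr_gt0 // mulr_gt0.
  have epsM : 6 * M * eps <= e / 2.
    rewrite (_ : e / 2 = 6 * (M + 1) * eps); last first.
      by rewrite /eps; field; rewrite gt_eqF.
    by rewrite ler_wpM2r ?(ltW eps0) // ler_wpM2l // lerDl.
  (* By [grid_total] the cells miss a mass of at most 1 / N + 2 k / N, and both 1 / N and k / N will
     be at most 1 / d. *)
  pose d0 := Num.truncn (3 / eps); pose d := d0.+1.
  have d3 : 3 / d%:R <= eps.
    by rewrite ler_pdivrMr // mulrC -ler_pdivrMr // ltW // truncnS_gt.
  have [n hn] := uniformly_continuous_compact (@compact_triangle_core R d0) (@triangle_core_sub R d0) cf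
    (divr_gt0 e0 (ltr0Sn R 3)).
  (* The mesh 1 / N meets the modulus of continuity 1 / (n + 1), while k / N = 1 / d stays equal to
     the margin of the core, which was fixed before [n]. *)
  pose k := n.+1; pose N := (d * k)%N.
  have N0 : (0 < N)%N by [].
  have NR : 0 < N%:R :> R by rewrite ltr0n.
  have kN : k%:R / N%:R = d%:R^-1 :> R.
    by rewrite /N natrM; field; rewrite !pnatr_eq0.
  have Nn : N%:R^-1 <= n.+1%:R^-1 :> R.
    by rewrite lef_pV2 ?posrE // ler_nat leq_pmull.
  have Nd : N%:R^-1 <= d%:R^-1 :> R.
    by rewrite lef_pV2 ?posrE // ler_nat leq_pmulr.
  pose m (p : 'I_N * 'I_N) : R := fine (farey_measure R (grid_cell k p)).
  pose r tau (p : 'I_N * 'I_N) : R := fine (rho L `[a, b] tau (grid_cell k p)).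
  have mS : 1 - eps <= \sum_p m p.
    rewrite (eq_bigr _ (fun p _ => farey_measure_grid_cell R k p)).
    apply: le_trans (@grid_total R N k N0); rewrite -mulrA kN.
    by apply: le_trans (_ : 1 - 3 / d%:R <= _); [rewrite lerD2l lerN2|lra].
  have low p : exists tau0, forall tau, tau0 <= tau -> - (eps / N%:R ^+ 2) <= r tau p - m p.
    have N2 : 0 < eps / N%:R ^+ 2 by rewrite divr_gt0 // exprn_gt0.
    rewrite /r /m; apply: (@grid_cell_cases R N k p (fun A => exists tau0, forall tau, tau0 <= tau ->
      - (eps / N%:R ^+ 2) <= fine (rho L `[a, b] tau A) - fine (farey_measure R A))).
      by exists 0 => tau _; rewrite !measure0 /= subrr oppr_le0 ltW.
    move=> h1 h2 h3 h4.
    have [_ a1 a2 a3] := grid_coord R (ltn_ord p.1); have [_ b1 b2 b3] := grid_coord R (ltn_ord p.2).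
    have [T0 T00 hT] := farey_ratio_lower hL hab h3 a1 a2 h4 b1 b2 h2 N2.
    exists T0 => tau tT; have t0 : 0 < tau by exact: lt_le_trans tT.
    have := hT _ tT; rewrite (rhoE hL) // farey_measureE; last first.
      by apply: farey_box_triangle => //; exact: ltW.
    rewrite area_farey_box ?(ltW a1) ?(ltW b1) // -!EFinM /=.
    rewrite [_^-1 * _]mulrC /farey_count /farey_num lerBlDr => h.
    by rewrite lerBrDl -lerBrDr opprK.
  have [tau0 htau0] := choice low.
  have [tau1 tau10 htau1] := common_threshold tau0.
  near=> tau.
  have ht : tau1 <= tau by near: tau; apply: nbhs_pinfty_ge; exact: num_real.
  have t0 := lt_le_trans tau10 ht; have taup := htau1 tau ht.
  (* The value 0 is for discarded indices, whose [grid_cell] is empty. *)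
  pose c (p : 'I_N * 'I_N) : R :=
    if (N + k <= p.1 + p.2)%N then f (p.1.+1%:R / N%:R, p.2.+1%:R / N%:R) else 0.
  have corner (p : 'I_N * 'I_N) : (N + k <= p.1 + p.2)%N ->
      triangle_core d0 (p.1.+1%:R / N%:R : R, p.2.+1%:R / N%:R : R).
    move=> h; have [_ _ a2 _] := grid_coord R (ltn_ord p.1); have [_ _ b2 _] := grid_coord R (ltn_ord p.2).
    split; first by split; rewrite /= in_itv /= divr_ge0.
    rewrite /= -mulrDl -kN ler_pdivlMr // mulrDl mul1r divfK ?gt_eqF //.
    by rewrite -natrD -[leRHS]natrD ler_nat (leq_trans h) // leq_add.
  have cM p : `|c p| <= M.
    by rewrite /c; case: ifP => h; [apply/fM/triangle_core_sub/corner|rewrite normr0].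
  have fc p x : grid_cell k p x -> `|f x - c p| <= e / 4.
    move=> Qx; have Tx := grid_cell_triangle Qx; move: Qx.
    have near_corner i (y : R) : (i < N)%N -> i%:R / N%:R < y <= i.+1%:R / N%:R ->
        `|y - i.+1%:R / N%:R| <= n.+1%:R^-1.
      move=> /(grid_coord R)[_ _ _ iN] /andP[y1 y2]; apply: le_trans Nn.
      rewrite distrC ger0_norm ?subr_ge0 // lerBlDr -lerBlDl; apply: ltW.
      by apply: le_lt_trans y1; rewrite lerBlDr -lerBlDl iN.
    rewrite /grid_cell /c; case: ifP => // h [xi xj]; apply: hn => //.
    - exact: corner.
    - exact: near_corner (ltn_ord _) xi.
    - exact: near_corner (ltn_ord _) xj.
  have e4 : 0 <= e / 4 by rewrite divr_ge0 // ltW.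
  have cells (mu : {measure set (measurableTypeR R * measurableTypeR R) -> \bar R})
      (mu1 : (mu (@farey_triangle R) <= 1)%E) :=
    Rintegral_cells mT mu1 mf Mge0 fM (@measurable_grid_cell R N k) (@grid_cell_triangle R N k)
      (@grid_cell_disjoint R N k) e4 fc.
  (* This is [Rintegral_cells] for the zero function with bound 1: a nonnegative quantity is at most
     1 minus the sum. *)
  have mass1 : \sum_p r tau p <= 1.
    have Z x : @farey_triangle R x -> `|0 : R| <= 1 by move=> _; rewrite normr0.
    have Z' (p : 'I_N * 'I_N) x : @grid_cell R N k p x -> `|0 - 0 : R| <= 0 by move=> _; rewrite subrr normr0.
    have := @Rintegral_cells _ _ R (rho L `[a, b] tau) _ (fun=> 0) _ (@grid_cell R N k) (fun=> 0) 0 1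
      mT (rho1 _ t0) (measurable_cst _) ler01 Z (@measurable_grid_cell R N k)
      (@grid_cell_triangle R N k) (@grid_cell_disjoint R N k) (lexx 0) Z'.
    by rewrite add0r mul1r => /(le_trans (normr_ge0 _)); rewrite subr_ge0.
  have del0 : 0 <= eps / N%:R ^+ 2 by rewrite divr_ge0 ?exprn_ge0 // ltW.
  have cardE : #|(('I_N * 'I_N)%type : finType)|%:R * (eps / N%:R ^+ 2) <= eps.
    rewrite card_prod card_ord natrM -expr2 mulrC divfK //.
    by rewrite expf_neq0 // gt_eqF.
  apply: le_trans (weighted_sums_close Mge0 del0 cardE cM
    (fun p => htau0 p tau (taup p)) mass1 mS (cells _ (rho1 _ t0))
    (cells _ (farey_measure_triangle_le1 R))) _.
  apply: le_trans (lerD (lexx _) epsM) _.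
  have -> : 2 * (e / 4) + e / 2 = e by field.
  exact: lexx.
apply: cvg_EFin; last exact: cvgR.
near=> tau; rewrite fint //; apply: rho1.
by near: tau; exact: nbhs_pinfty_gt.
Unshelve. all: by end_near.
Qed.
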